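(* Let $G$ be a finite almost simple group with socle $\mathrm{A}_n$ ($n\geqslant 5$), and let $H$ be an insoluble proper subgroup of $G$ of odd index. Then $G\in\{\mathrm{A}_n,\mathrm{S}_n\}$ and either (i) every insoluble composition factor of $H$ is an alternating group; or (ii) $(G,H)$ is $(\mathrm{A}_7,\mathrm{GL}(3,2))$, $(\mathrm{A}_8,\mathrm{AGL}(3,2))$ or $(\mathrm{A}_9,\mathrm{AGL}(3,2))$ (up to isomorphism of $H$).
   Context: A group $G$ is almost simple with socle $T$ if $T\leqslant G\leqslant\mathrm{Aut}(T)$ for a nonabelian simple group $T$. *)

(* Defs.v *)
From HB Require Import structures.
From mathcomp Require Import all_boot all_order all_algebra.
From mathcomp Require Import all_fingroup all_solvable.

Set Implicit Arguments.
Unset Strict Implicit.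
Unset Printing Implicit Defensive.

Import GRing.Theory GroupScope.

(* T <= G <= Aut(T) is read, as usual, up to isomorphism of G and with T       *)
(* identified with its image Inn(T) = conj_aut T @* T in Aut(T).               *)
Definition almost_simple_with_socle (gT aT : finGroupType)
    (G : {group gT}) (T : {group aT}) : Prop :=
  [/\ simple T, ~~ abelian T
    & exists A : {group {perm aT}},
        [/\ conj_aut T @* T \subset A, A \subset Aut T & G \isog A]].

(* A section U coerces to the quotient group U.1 / U.2; pairmap lists the      *)
(* quotients of consecutive terms of the composition series H :: s.            *)
Definition composition_factor (gT : finGroupType)
    (H : {group gT}) (U : section gT) : Prop :=
  exists2 s : seq {group gT}, comps H s & U \in pairmap (@mkSec gT) H s.

Section AffineGroup.

Variables (n : nat) (F : finFieldType).
Local Open Scope ring_scope.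

Definition AGL : {set {perm 'rV[F]_n}} :=
  [set s : {perm 'rV[F]_n} | [exists A : 'M[F]_n, exists v : 'rV[F]_n,
     (A \in unitmx) && [forall x, s x == x *m A + v]]].

Lemma AGLP (s : {perm 'rV[F]_n}) :
  reflect (exists A : 'M[F]_n, exists v : 'rV[F]_n,
             A \in unitmx /\ forall x, s x = x *m A + v)
          (s \in AGL).
Proof.
rewrite inE; apply: (iffP existsP) => [[A /existsP[v /andP[uA /forallP sE]]]|].
  by exists A, v; split=> // x; apply/eqP.
case=> A [v [uA sE]]; exists A; apply/existsP; exists v; rewrite uA.
by apply/forallP=> x; apply/eqP.
Qed.

Lemma AGL_group_set : group_set AGL.
Proof.
apply/group_setP; split.
  apply/AGLP; exists 1%:M, 0; split=> [|x]; first exact: unitmx1.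
  by rewrite perm1 mulmx1 addr0.
move=> s t /AGLP[A [v [uA sE]]] /AGLP[B [w [uB tE]]]; apply/AGLP.
exists (A *m B), (v *m B + w); split=> [|x]; first by rewrite unitmx_mul uA.
by rewrite permM sE tE mulmxDl mulmxA addrA.
Qed.

Canonical AGL_group := Group AGL_group_set.

End AffineGroup.

(* Main.v *)
Require Import Defs.
From HB Require Import structures.
From mathcomp Require Import all_boot all_order all_algebra.
From mathcomp Require Import all_fingroup all_solvable.
From mathcomp Require Import zify.

(* Let H have odd index in S_n or A_n.  Everything rests on the elements of   *)
(* small support that H inherits from a Sylow 2-subgroup, so no list of       *)
(* primitive groups is needed.                                                *)
(*   In S_n, the transpositions of H generate a product of symmetric groups,  *)
(* normal in H, and H acts on its orbits with odd index in the group that     *)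
(* preserves the orbit sizes; induction shows that all nonabelian composition *)
(* factors of H are alternating.  In A_n the same argument works with         *)
(* 3-cycles, once H contains one.                                             *)
(*   Suppose that H <= A_n contains no 3-cycle.  Two elements of H whose      *)
(* supports meet in a single point have a 3-cycle as commutator.  For n > 9   *)
(* this forces the near-perfect matching formed by the transpositions of a    *)
(* Sylow 2-subgroup to be unique, so that H <= 2 wr S_m with odd index.  For  *)
(* n < 10 call A a quad when H contains the Klein four-group on the 4-set A.  *)
(* Quads meet in an even number of points and are closed under symmetric      *)
(* difference, hence form a binary code.  Either the code does not separate   *)
(* points and H preserves a partition into blocks of size at most 4, or the   *)
(* quads are the complements of the lines of the Fano plane (n = 7) or the    *)
(* planes of the affine space of dimension 3 over F_2 (n = 8, 9), and H is    *)
(* the full linear or affine group.                                           *)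
(*   Finally Aut(A_n) = S_n for n <> 6 because automorphisms permute the      *)
(* 3-cycles: the commutators [x, g] of a 3-cycle x have order 1, 2, 3 or 5,   *)
(* which fails for the other elements of order 3 as soon as n > 6.  For n = 6 *)
(* the square of an automorphism preserves the 3-cycles, so that G / A_6 is a *)
(* 2-group, while odd index proper subgroups of A_6 are solvable: there is no *)
(* insoluble H.                                                               *)

Set Implicit Arguments.
Unset Strict Implicit.
Unset Printing Implicit Defensive.

Import GroupScope.

(** The property carried through the proof is [alt_factors]. It speaks of all simple sections on
    subnormal subgroups rather than of one composition series, so it passes to normal subgroups and
    extensions ([alt_factors_ext]) without any appeal to Jordan-Holder, and it controls every
    composition series ([alt_factors_composition]).

    Odd index enters through Sylow: every 2-subgroup of the big group has a conjugate inside H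
    ([odd_index_conj]). When H preserves a partition, H is an extension of its action on the blocks
    by the subgroup fixing each block, and this action again has odd index in the group of all
    permutations of the blocks that respect sizes and colors ([odd_index_block_perm]). This
    reduction settles the symmetric case by induction ([alt_factors_odd_color_sym]).

    In [odd_index_Alt], a 3-cycle of H yields blocks on which H contains the alternating group
    ([alt_factors_cyc3]). Without 3-cycles, supports of elements of H cannot meet in a single point.
    From 10 points on, this makes a matching canonical ([good_matching_unique]) and its pairs are
    blocks. On fewer points, it makes the quads a binary code: either points with the same quads
    form blocks of size at most 4, or the code is determined ([seven_basis]). In that case multiple
    transitivity and the 2-part of the order make H as large as the linear or affine group that
    contains it ([linear_isog], [affine_isog]).

    The passage from Aut(A_n) to S_n is [Aut_Alt_conj] together with [Aut_Alt_cyc3]; the exceptional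
    degree 6 is disposed of by [no_odd_index_Aut_Alt6]. *)

Definition alt_factors (gT : finGroupType) (G : {group gT}) : Prop :=
  forall L K : {group gT}, L <|<| G -> K <| L -> simple (L / K) ->
  ~~ solvable (L / K) -> exists m : nat, L / K \isog 'Alt_('I_m).

(** * Groups whose insoluble simple subnormal sections are alternating *)

Section AltFactors.

Implicit Types gT aT rT : finGroupType.

Lemma alt_factors_sol gT (G : {group gT}) : solvable G -> alt_factors G.
Proof.
move=> solG L K /subnormal_sub sLG _ _ /negP[].
exact: quotient_sol (solvableS sLG solG).
Qed.

Lemma alt_factors_normal gT (G N : {group gT}) :
  N <| G -> alt_factors G -> alt_factors N.
Proof.
move=> nNG altG L K snLN; apply: altG.
exact: subnormal_trans snLN (normal_subnormal nNG).
Qed.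

(** The intersection N of L with the kernel has trivial or full image in the simple group L / K. In
    the first case [f] carries L / K isomorphically to a section of the image; in the second, L / K
    is isomorphic to N / (K :&: N), a section of the kernel. *)
Lemma alt_factors_ext aT rT (G : {group aT}) (f : {morphism G >-> rT}) :
  alt_factors ('ker f)%G -> alt_factors (f @* G)%G -> alt_factors G.
Proof.
move=> altK altI L K snLG nKL simLK nsolLK; have sLG := subnormal_sub snLG.
have [sKL nKLs] := andP nKL.
pose N := (L :&: 'ker f)%G.
have nNL : N <| L by rewrite /normal subsetIl normsI ?normG // (subset_trans sLG) ?ker_norm.
have nNKs : N \subset 'N(K) by apply: subset_trans (normal_sub nNL) nKLs.
have [NK1 | NKL] : N / K :=: 1 \/ N / K :=: L / K.
- have [_ simN] := simpleP _ simLK.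
  by case: (simN (N / K)%G (quotient_normal _ nNL)) => [-> | ->]; [left | right].
- have sNK : N \subset K by rewrite -quotient_sub1 // NK1.
  have nfK : f @* K <| f @* L by apply: morphim_normal.
  have nfL : f @* L \subset 'N(f @* K) by case/andP: nfK.
  have isoLK : L / K \isog (f @* L) / (f @* K).
    pose fL := restrm sLG f.
    have fLE : fL @* L = f @* L by rewrite morphim_restrm setIid.
    have nfL' : fL @* L \subset 'N(f @* K) by rewrite fLE.
    pose h := [morphism of restrm sLG f].
    have sLd : L \subset h @*^-1 'N(f @* K).
      by rewrite -sub_morphim_pre ?subxx // fLE.
    pose g' := restrm sLd [morphism of coset (f @* K) \o h].
    have kg : 'ker_L g' = K.
      apply/setP=> x; apply/setIP/idP=> [[Lx]|Kx]; last first.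
        have Lx := subsetP sKL x Kx; split=> //.
        rewrite ker_restrm inE Lx /=; apply/kerP.
          by rewrite (subsetP sLd).
        apply/coset_id/mem_morphim => //; exact: (subsetP sLG).
      rewrite ker_restrm inE Lx /= => /mker /= kx.
      have nx : f x \in 'N(f @* K).
        by apply: (subsetP nfL); apply: mem_morphim=> //; apply: (subsetP sLG).
      have fxK : f x \in f @* K by apply: coset_idr.
      have [k Gk Kk fk] := morphimP fxK.
      have kerx : x * k^-1 \in 'ker f.
        apply/kerP; first by rewrite groupM ?groupV // (subsetP sLG).
        by rewrite morphM ?groupV // ?(subsetP sLG) // morphV // fk mulgV.
      have : x * k^-1 \in K.
        apply: (subsetP sNK); rewrite inE kerx andbT groupM ?groupV //.
        exact: (subsetP sKL).
      by rewrite groupMr ?groupV.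
    have := first_isog_loc g' (subxx L); rewrite kg.
    suff -> : g' @* L = (f @* L) / (f @* K) by [].
    by rewrite morphim_restrm setIid morphim_comp /= morphim_restrm setIid.
  have snf : f @* L <|<| f @* G by apply: morphim_subnormal.
  have simI : simple (f @* L / f @* K) by rewrite -(isog_simple isoLK).
  have nsI : ~~ solvable (f @* L / f @* K) by rewrite -(isog_sol isoLK).
  have [m iso_m] := altI _ _ snf nfK simI nsI.
  by exists m; apply: isog_trans isoLK iso_m.
have isoN : N / (K :&: N) \isog L / K by rewrite -NKL; apply: second_isog.
have snN : N <|<| 'ker f.
  by apply: (@setI_subnormal _ G L ('ker f)%G) => //; apply: subsetIl.
have nKN : (K :&: N)%G <| N.
  by rewrite /normal subsetIr normsI ?normG.
have simN : simple (N / (K :&: N)) by rewrite (isog_simple isoN).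
have nsN : ~~ solvable (N / (K :&: N)) by rewrite (isog_sol isoN).
have [m iso_m] := altK _ _ snN nKN simN nsN.
by exists m; apply: isog_trans iso_m; rewrite isog_sym.
Qed.

Lemma sol_ext aT rT (G : {group aT}) (f : {morphism G >-> rT}) :
  solvable ('ker f)%G -> solvable (f @* G)%G -> solvable G.
Proof.
move=> solK solI; rewrite (series_sol (ker_normal f)) solK.
by rewrite (isog_sol (first_isog f)).
Qed.

Lemma alt_factors_inj aT rT (G : {group aT}) (f : {morphism G >-> rT}) :
  'injm f -> alt_factors (f @* G)%G -> alt_factors G.
Proof.
move=> injf; apply: alt_factors_ext; apply: alt_factors_sol.
by rewrite (trivgP injf) solvable1.
Qed.

Lemma alt_factors_isog aT rT (G : {group aT}) (H : {group rT}) :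
  G \isog H -> alt_factors H -> alt_factors G.
Proof.
case/isogP=> f injf fG altH; apply: (alt_factors_inj injf).
by move: altH; congr (alt_factors _); apply/val_inj.
Qed.

(** The terms of a composition series are subnormal, so its factors are among the sections that
    [alt_factors] controls. *)
Lemma alt_factors_composition gT (H : {group gT}) (U : section gT) :
    alt_factors H -> composition_factor H U -> ~~ solvable U ->
  exists m : nat, U \isog 'Alt_('I_m).
Proof.
move=> altH [s /andP[_ ser_s] Us] nsolU.
suff [L [K [snL maxK defU]]] : exists L K : {group gT},
    [/\ L <|<| H, maxnormal K L L & U = mkSec L K].
  rewrite {}defU in nsolU *; have nKL := maxnormal_normal maxK.
  by apply: altH => //; rewrite quotient_simple.
suff gen (G : {group gT}) : G <|<| H ->
    (fun x y : {set gT} => maxnormal y x x).-series G s ->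
    U \in pairmap (@mkSec gT) G s ->
  exists L K : {group gT},
    [/\ L <|<| H, maxnormal K L L & U = mkSec L K].
  exact: gen (subnormal_refl H) ser_s Us.
elim: s G {ser_s Us} => //= K s IHs G snG /andP[maxK ser_s].
rewrite inE => /predU1P[-> | Us]; first by exists G, K.
apply: (IHs K) => //; apply: subnormal_trans snG.
exact: normal_subnormal (maxnormal_normal maxK).
Qed.

End AltFactors.

(** * Subgroups of odd index and 2-subgroups *)

Section OddIndex.

Variable gT : finGroupType.
Implicit Types G H M N Q : {group gT}.

(** A Sylow 2-subgroup of H is also one of G, so Sylow's theorem applies. This is the source of
    elements of small support in H. *)
Lemma odd_index_conj G H Q : H \subset G -> odd #|G : H| -> Q \subset G ->
  2.-group Q -> exists2 x, x \in G & Q :^ x \subset H.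
Proof.
move=> sHG oddH sQG pQ; have [P sylP] := Sylow_exists 2 H.
have sylPG : 2.-Sylow(G) P.
  rewrite pHallE (subset_trans (pHall_sub sylP)) //= (card_Hall sylP).
  rewrite -(Lagrange sHG) partnM ?cardG_gt0 ?indexg_gt0 //.
  have o2 : 2^'.-nat #|G : H| by rewrite p'natE // dvdn2 oddH.
  by rewrite (part_p'nat o2) muln1.
have [x Gx sQP] := Sylow_Jsub sylPG sQG pQ.
by exists x => //; apply: subset_trans (pHall_sub sylP).
Qed.

Lemma odd_indexS G H M : H \subset M -> M \subset G -> odd #|G : H| ->
  odd #|M : H|.
Proof. by move=> sHM sMG; rewrite -(Lagrange_index sMG sHM) oddM => /andP[]. Qed.

(** The index of N :&: H in N is the index of H in NH, which divides that of H in G. *)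
Lemma odd_index_normal G H N : H \subset G -> N <| G -> odd #|G : H| ->
  odd #|N : N :&: H|.
Proof.
move=> sHG /andP[sNG nNG] oddH.
rewrite indexgI -indexMg -norm_joinEl ?(subset_trans sHG) //.
by apply: odd_indexS oddH; rewrite ?joing_subl // join_subG sHG.
Qed.

Lemma square1_2group G : (forall x, x \in G -> x ^+ 2 = 1) -> 2.-group G.
Proof.
move=> sq; rewrite -pnat_exponent; apply: (@pnat_dvd _ 2) => //.
by apply/exponentP.
Qed.

Lemma gen_involutions_2group (S : {set gT}) :
    (forall x, x \in S -> x ^+ 2 = 1) ->
    (forall x y, x \in S -> y \in S -> commute x y) ->
  2.-group <<S>>.
Proof.
move=> sqS cS; have abS : abelian <<S>>.
  rewrite abelian_gen; apply/centsP => x Sx y Sy; exact: cS.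
apply: square1_2group => x; move: x.
(* Since [<<S>>] is abelian, its elements of trivial square form a subgroup, which contains [S]. *)
pose R := [set x in <<S>> | x ^+ 2 == 1].
have gR : group_set R.
  apply/group_setP; split; first by rewrite !inE group1 expg1n eqxx.
  move=> x y /[!inE] /andP[Sx /eqP x2] /andP[Sy /eqP y2].
  have cxy : commute x y by apply: (centsP abS).
  by rewrite groupM // expgMn // x2 y2 mulg1 eqxx.
have sSR : <<S>> \subset Group gR.
  rewrite gen_subG; apply/subsetP=> x Sx.
  by rewrite !inE mem_gen //= sqS.
by move=> x /(subsetP sSR); rewrite inE => /andP[_ /eqP].
Qed.

End OddIndex.

Lemma odd_index_morphim (aT rT : finGroupType) (G H : {group aT})
    (f : {morphism G >-> rT}) :
  H \subset G -> odd #|G : H| -> odd #|f @* G : f @* H|.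
Proof. by move=> sHG; apply: dvdn_odd; apply: index_morphim; rewrite subIset ?subxx. Qed.

(** * Young subgroups: permutations preserving a coloring *)

Section ColorSym.

Variables (T : finType) (C : eqType) (c : T -> C).

Definition color_sym : {set {perm T}} :=
  [set s : {perm T} | [forall x, c (s x) == c x]].

Lemma color_symP (s : {perm T}) : reflect (forall x, c (s x) = c x) (s \in color_sym).
Proof. by rewrite inE; apply: (iffP forallP) => cs x; apply/eqP. Qed.

Lemma color_sym_group_set : group_set color_sym.
Proof.
apply/group_setP; split; first by apply/color_symP => x; rewrite perm1.
move=> s t /color_symP cs /color_symP ct; apply/color_symP => x.
by rewrite permM ct cs.
Qed.

Canonical color_sym_group := Group color_sym_group_set.

Lemma tperm_color_sym x y : (tperm x y \in color_sym) = (c x == c y).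
Proof.
apply/color_symP/eqP => [/(_ x) | cxy z]; first by rewrite tpermL.
by case: tpermP => [->|->|].
Qed.

(** Induction on the support: if s moves x, then multiplying s by the transposition of x and its
    preimage fixes x and moves no new point. *)
Lemma color_sym_gen (N : {group {perm T}}) :
  (forall x y, c x = c y -> tperm x y \in N) -> color_sym \subset N.
Proof.
move=> tN; apply/subsetP => s.
have [n] := ubnP #|[pred x | s x != x]|; elim: n s => // n IHn s /ltnSE-le_s_n.
case: (pickP (fun x => s x != x)) => [x s_x cs | s_id _]; last first.
  suff -> : s = 1 by apply: group1.
  by apply/permP => x; rewrite perm1; apply/eqP/negbFE/s_id.
have cx : c (s^-1 x) = c x by rewrite -{2}(permKV s x) (color_symP _ cs).
have tx : tperm x (s^-1 x) \in N by apply: tN.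
rewrite -(groupMl _ tx); apply: IHn; last first.
  by rewrite groupM // tperm_color_sym cx.
rewrite (cardD1 x) !inE s_x in le_s_n; apply: leq_ltn_trans le_s_n.
have sx' : s^-1 x != x by apply: contraNneq s_x => e; rewrite -{1}e permKV.
apply: subset_leq_card; apply/subsetP=> y; rewrite !inE permM.
case: tpermP => [->|-> _|/eqP -> _ -> //]; first by rewrite permKV eqxx.
by rewrite permKV sx' eq_sym sx'.
Qed.

End ColorSym.

Arguments color_sym {T C} c.
Arguments color_symP {T C c s}.

(** * The action of a permutation group on the blocks of a partition *)

Section Blocks.

Variables (T D : finType) (d : T -> D).

Definition block_stab : {set {perm T}} :=
  [set s : {perm T} | [forall x, forall y, (d (s x) == d (s y)) == (d x == d y)]].

Lemma block_stabP (s : {perm T}) :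
  reflect (forall x y, (d (s x) == d (s y)) = (d x == d y)) (s \in block_stab).
Proof.
rewrite inE; apply: (iffP forallP) => [ds x y | ds x].
  by have /forallP/(_ y)/eqP := ds x.
by apply/forallP=> y; rewrite ds.
Qed.

Lemma block_stab_group_set : group_set block_stab.
Proof.
apply/group_setP; split; first by apply/block_stabP => x y; rewrite !perm1.
move=> s t /block_stabP ds /block_stabP dt; apply/block_stabP => x y.
by rewrite !permM dt ds.
Qed.

Canonical block_stab_group := Group block_stab_group_set.

Lemma color_sym_block_stab : color_sym d \subset block_stab.
Proof.
by apply/subsetP=> s /color_symP ds; apply/block_stabP=> x y; rewrite !ds.
Qed.

(** The fallback value [v], off [block_stab] and off the image of [d], makes this function injective
    for every [s], hence a permutation of the whole of [D]. *)
Definition block_fun (s : {perm T}) (v : D) : D :=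
  if s \in block_stab then
    if [pick x | d x == v] is Some x then d (s x) else v
  else v.

Lemma block_funE s x : s \in block_stab -> block_fun s (d x) = d (s x).
Proof.
move=> Ws; rewrite /block_fun Ws; case: pickP => [y dy | /(_ x)].
  by apply/eqP; rewrite (block_stabP _ Ws).
by rewrite eqxx.
Qed.

Lemma block_fun_out s v : v \notin codom d -> block_fun s v = v.
Proof.
move=> dv; rewrite /block_fun; case: ifP => // _; case: pickP => // x /eqP dx.
by rewrite -dx codom_f in dv.
Qed.

Lemma block_fun_inj s : injective (block_fun s).
Proof.
case Ws: (s \in block_stab); last by move=> v w; rewrite /block_fun Ws.
move=> v w.
case: (boolP (v \in codom d)) => [/codomP[x ->] | dv];
case: (boolP (w \in codom d)) => [/codomP[y ->] | dw].
- by rewrite !block_funE // => /eqP; rewrite (block_stabP _ Ws) => /eqP.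
- by rewrite block_funE // block_fun_out // => dw'; rewrite -dw' codom_f in dw.
- by rewrite block_funE // block_fun_out // => dv'; rewrite dv' codom_f in dv.
by rewrite !block_fun_out.
Qed.

Definition block_perm (s : {perm T}) : {perm D} := perm (@block_fun_inj s).

Lemma block_permM : {in block_stab &, {morph block_perm : s t / s * t}}.
Proof.
move=> s t Ws Wt; apply/permP=> v; rewrite permM !permE.
case: (boolP (v \in codom d)) => [/codomP[x ->] | dv].
  by rewrite !block_funE ?groupM // permM.
by rewrite !block_fun_out.
Qed.

Canonical block_morphism := Morphism block_permM.

Lemma ker_block_perm : 'ker block_perm = color_sym d.
Proof.
apply/setP=> s; apply/idP/idP => [ks | ds].
  have Ws := dom_ker ks; apply/color_symP=> x.
  by rewrite -block_funE // -[RHS](perm1 (d x)) -(mker ks) permE.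
have Ws := subsetP color_sym_block_stab s ds; apply/kerP => //; apply/permP=> v.
rewrite permE perm1; case: (boolP (v \in codom d)) => [/codomP[x ->] | dv].
  by rewrite block_funE // (color_symP ds).
by rewrite block_fun_out.
Qed.

Definition fiber (v : D) := [set x | d x == v].

Variables (C : eqType) (c : T -> C).

(* The second component keeps the values outside the image of [d] apart, so  *)
(* that a permutation preserving [block_color] fixes each of them.           *)
Definition block_color (v : D) : option (C * nat) * option D :=
  if [pick x | d x == v] is Some x then (Some (c x, #|fiber v|), None)
  else (None, Some v).

Hypothesis d_c : forall x y, d x = d y -> c x = c y.

Lemma block_colorE x : block_color (d x) = (Some (c x, #|fiber (d x)|), None).
Proof.
rewrite /block_color; case: pickP => [y /eqP/d_c -> // | /(_ x)].
by rewrite eqxx.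
Qed.

Lemma block_color_out v : v \notin codom d -> block_color v = (None, Some v).
Proof.
move=> dv; rewrite /block_color; case: pickP => // x /eqP dx.
by rewrite -dx codom_f in dv.
Qed.

Section Lift.

Variable p : {perm D}.
Hypothesis cp : p \in color_sym block_color.

Lemma lift_codom x : p (d x) \in codom d.
Proof.
apply: contraT => dp; have := color_symP cp (d x).
by rewrite block_colorE block_color_out.
Qed.

Lemma lift_card x : #|fiber (p (d x))| = #|fiber (d x)|.
Proof.
have := color_symP cp (d x); have /codomP[y ->] := lift_codom x.
by rewrite !block_colorE => [[_ ->]].
Qed.

(** The i-th point of a block goes to the i-th point of the image block; both have the same size
    because [block_color] records it, so the default of [nth] is never reached. *)
Definition lift_fun x :=
  nth x (enum (fiber (p (d x)))) (index x (enum (fiber (d x)))).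

Lemma lift_index x : index x (enum (fiber (d x))) < size (enum (fiber (p (d x)))).
Proof. by rewrite -cardE lift_card cardE index_mem mem_enum inE. Qed.

Lemma lift_d x : d (lift_fun x) = p (d x).
Proof.
have := mem_nth x (lift_index x); rewrite -/(lift_fun x) mem_enum inE.
by move/eqP.
Qed.

Lemma lift_inj : injective lift_fun.
Proof.
move=> x y eq_l; have := congr1 d eq_l; rewrite !lift_d => /perm_inj dxy.
move: eq_l; rewrite /lift_fun dxy (set_nth_default y) => [/eqP|].
  rewrite nth_uniq ?enum_uniq // => [/eqP eq_i| |]; last exact: lift_index.
    by apply: (@index_inj _ y (enum (fiber (d y)))) => //; rewrite mem_enum inE ?dxy.
  by rewrite -{1}dxy -dxy lift_index.
by rewrite -dxy lift_index.
Qed.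

Definition lift_perm' := perm lift_inj.

Lemma lift_block_stab : lift_perm' \in block_stab.
Proof.
by apply/block_stabP=> x y; rewrite !permE !lift_d (inj_eq perm_inj).
Qed.

Lemma lift_color_sym : lift_perm' \in color_sym c.
Proof.
apply/color_symP=> x; rewrite permE; have := color_symP cp (d x).
by rewrite -lift_d !block_colorE => [[]].
Qed.

Lemma block_perm_lift : block_perm lift_perm' = p.
Proof.
apply/permP=> v; rewrite permE.
case: (boolP (v \in codom d)) => [/codomP[x ->] | dv].
  by rewrite block_funE ?lift_block_stab // permE lift_d.
rewrite block_fun_out //; have := color_symP cp v; rewrite (block_color_out dv).
case: (boolP (p v \in codom d)) => [/codomP[x ->] | dp].
  by rewrite block_colorE.
by rewrite block_color_out // => [[->]].
Qed.

End Lift.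

Lemma block_perm_color s : s \in block_stab -> s \in color_sym c ->
  block_perm s \in color_sym block_color.
Proof.
move=> Ws cs; apply/color_symP=> v; rewrite permE.
case: (boolP (v \in codom d)) => [/codomP[x ->] | dv]; last by rewrite block_fun_out.
rewrite block_funE // !block_colorE (color_symP cs); congr (Some (_, _), _).
rewrite -(card_imset (mem (fiber (d x))) (@perm_inj _ s)).
apply: eq_card => y; apply/idP/imsetP => [|[z]]; rewrite !inE.
  move=> dy; exists (s^-1 y); rewrite ?permKV // inE.
  by rewrite -(block_stabP _ Ws) permKV.
by move=> dz ->; rewrite (block_stabP _ Ws).
Qed.

(** The block stabilizer in G induces all of [color_sym block_color]: a permutation of the blocks
    lifts to the points, and some k fixing every block corrects the lift into G without changing the
    action. The index of H in that stabilizer is odd, and the index of its image divides it. *)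
Lemma odd_index_block_perm (G H : {group {perm T}}) :
    G \subset color_sym c -> H \subset G -> odd #|G : H| ->
    H \subset block_stab ->
    (forall s, s \in color_sym c -> exists2 k, k \in color_sym d & s * k \in G) ->
  (block_perm @* H \subset color_sym block_color) /\
  odd #|color_sym block_color : block_perm @* H|.
Proof.
move=> sGc sHG oddH sHW liftG; pose M := (block_stab_group :&: G)%G.
have imM : block_perm @* M = color_sym block_color.
  apply/setP=> p; apply/idP/idP => [/morphimP[s Ws]|cp].
    by rewrite inE => /andP[_ Gs] ->; rewrite block_perm_color // (subsetP sGc).
  have [k dk Gsk] := liftG _ (lift_color_sym cp).
  have Wk := subsetP color_sym_block_stab k dk.
  have Wl := lift_block_stab cp.
  apply/morphimP; exists (lift_perm' cp * k); first by rewrite groupM.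
    by apply/setIP; split; first rewrite groupM.
  rewrite morphM //= block_perm_lift.
  have : k \in 'ker block_perm by rewrite ker_block_perm.
  by move/mker => /= ->; rewrite mulg1.
have sHM : H \subset M by rewrite subsetI sHW.
rewrite -imM; split; first exact: morphimS.
apply: dvdn_odd (odd_indexS sHM (subsetIr _ _) oddH).
by apply: index_morphim; rewrite subIset // subsetIl.
Qed.

End Blocks.

(** * Extending permutations along an injection *)

Section ExtPerm.

Variables (T1 T2 : finType) (j : T1 -> T2).
Hypothesis injj : injective j.

Definition ext_fun (s : {perm T1}) (y : T2) : T2 :=
  if [pick x | j x == y] is Some x then j (s x) else y.

Lemma ext_funE s x : ext_fun s (j x) = j (s x).
Proof.
by rewrite /ext_fun; case: pickP => [y /eqP/injj -> // | /(_ x)]; rewrite eqxx.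
Qed.

Lemma ext_fun_out s y : y \notin codom j -> ext_fun s y = y.
Proof.
by rewrite /ext_fun; case: pickP => // x /eqP <-; rewrite codom_f.
Qed.

Lemma ext_fun_inj s : injective (ext_fun s).
Proof.
move=> v w.
case: (boolP (v \in codom j)) => [/codomP[x ->] | jv];
case: (boolP (w \in codom j)) => [/codomP[y ->] | jw].
- by rewrite !ext_funE => /injj/perm_inj ->.
- by rewrite ext_funE ext_fun_out // => jw'; rewrite -jw' codom_f in jw.
- by rewrite ext_funE ext_fun_out // => jv'; rewrite jv' codom_f in jv.
by rewrite !ext_fun_out.
Qed.

Definition ext_perm (s : {perm T1}) : {perm T2} := perm (@ext_fun_inj s).

Lemma ext_permE s x : ext_perm s (j x) = j (s x).
Proof. by rewrite permE ext_funE. Qed.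

Lemma ext_perm_out s y : y \notin codom j -> ext_perm s y = y.
Proof. by move=> jy; rewrite permE ext_fun_out. Qed.

Lemma ext_permM : {in 'Sym_T1 &, {morph ext_perm : s t / s * t}}.
Proof.
move=> s t _ _; apply/permP=> v; rewrite permM.
case: (boolP (v \in codom j)) => [/codomP[x ->] | dv].
  by rewrite !ext_permE permM.
by rewrite !ext_perm_out.
Qed.

Canonical ext_morphism := Morphism ext_permM.

Lemma injm_ext_perm : 'injm ext_perm.
Proof.
apply/injmP => s t _ _ est; apply/permP=> x; apply: injj.
by rewrite -!ext_permE est.
Qed.

Lemma ext_perm_onto (s : {perm T2}) :
  (forall y, y \notin codom j -> s y = y) -> exists t, s = ext_perm t.
Proof.
move=> s_out.
have s_in x : s (j x) \in codom j.
  apply: contraT => js; have := s_out _ js => /perm_inj sj.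
  by rewrite sj codom_f in js.
have inj_t : injective (fun x => iinv (s_in x)).
  by move=> x y /(congr1 j); rewrite !f_iinv => /perm_inj/injj.
exists (perm inj_t); apply/permP=> y.
case: (boolP (y \in codom j)) => [/codomP[x ->] | jy].
  by rewrite ext_permE permE f_iinv.
by rewrite ext_perm_out // s_out.
Qed.

End ExtPerm.

Lemma alt_factors_ext_eq (aT rT : finGroupType) (G K : {group aT})
    (I : {group rT}) (f : {morphism G >-> rT}) :
  'ker f = K -> f @* G = I -> alt_factors K -> alt_factors I -> alt_factors G.
Proof.
move=> defK defI altK altI; apply: (alt_factors_ext (f := f)).
  by move: altK; congr (alt_factors _); apply/val_inj.
by move: altI; congr (alt_factors _); apply/val_inj.
Qed.

(** * Solvability and alternating factors of Young subgroups *)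

Lemma sol_card_le6 (gT : finGroupType) (G : {group gT}) : #|G| <= 6 -> solvable G.
Proof.
have sol_p p : prime p -> p.-nat #|G| -> solvable G.
  by move=> _; apply: pgroup_sol.
case oG: #|G| (cardG_gt0 G) => [|[|[|[|[|[|[|n]]]]]]] // _ _.
- by apply: (sol_p 2); rewrite ?oG.
- by apply: (sol_p 2); rewrite ?oG.
- by apply: (sol_p 3); rewrite ?oG.
- by apply: (sol_p 2); rewrite ?oG.
- by apply: (sol_p 5); rewrite ?oG.
have [P sylP] := Sylow_exists 3 G.
have oP : #|P| = 3 by rewrite (card_Hall sylP) oG p_part.
have sPG := pHall_sub sylP.
have iP : #|G : P| = 2 by rewrite -divgS // oG oP.
have nPG := index2_normal sPG iP.
rewrite (series_sol nPG) (pgroup_sol (pHall_pgroup sylP)) /=.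
apply: (@pgroup_sol _ 2).
by rewrite /pgroup card_quotient ?normal_norm // iP.
Qed.

(** A_4 has order 12 and is not simple, so some normal subgroup and its quotient both have order at
    most 6. *)
Lemma sol_Alt_le4 (T : finType) : #|T| <= 4 -> solvable 'Alt_T.
Proof.
rewrite leq_eqVlt => /predU1P[T4 | T3]; last first.
  apply: sol_card_le6; rewrite -leq_double -mul2n /=.
  case: (leqP 2 #|T|) => [/card_Alt -> | T2]; last first.
    by rewrite /= trivial_Alt_2 ?cards1 // ltnW.
  by case: #|T| T3 => [|[|[|[|]]]].
have oA : #|'Alt_T| = 12 by apply: double_inj; rewrite -mul2n card_Alt T4.
have nsA := negP (not_simple_Alt_4 T4).
case: (pickP [pred N : {group {perm T}} | [&& N <| 'Alt_T, N :!=: 1 & N :!=: 'Alt_T]]).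
  move=> N /and3P[nNA ntN NA]; rewrite (series_sol nNA).
  have := Lagrange (normal_sub nNA); rewrite oA -card_quotient ?normal_norm //.
  have N1 : 1 < #|N| by rewrite cardG_gt1.
  have Q1 : 1 < #|'Alt_T / N|.
    rewrite card_quotient ?normal_norm // indexg_gt1.
    by apply: contra NA => sAN; rewrite eqEsubset normal_sub.
  move=> e; rewrite !sol_card_le6 //.
    by rewrite -(leq_pmul2r (ltnW N1)) mulnC e (leq_trans _ (leq_mul (leqnn 6) N1)).
  by rewrite -(leq_pmul2r (ltnW Q1)) e (leq_trans _ (leq_mul (leqnn 6) Q1)).
move=> noN; case: nsA; apply/simpleP; split; first by rewrite -cardG_gt1 oA.
move=> N nN; have /= := noN N; rewrite nN /=.
by case: eqP => [-> | _]; [left | case: eqP => // -> _; right].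
Qed.

Section ColorInd.

Variables (Q : forall gT : finGroupType, {group gT} -> Prop) (b : nat).
Hypothesis Q_ext : forall (aT rT : finGroupType) (G K : {group aT})
    (I : {group rT}) (f : {morphism G >-> rT}),
  'ker f = K -> f @* G = I -> Q K -> Q I -> Q G.
Hypothesis Q1 : forall gT : finGroupType, Q [1 gT].
Hypothesis Q_Sym : forall k, k <= b -> Q ('Sym_('I_k))%G.

(** Restriction to one fiber with at least two points is onto the symmetric group of that fiber; its
    kernel is the Young subgroup of [c1], where the points of this fiber have become singletons. The
    property [Q] is abstract because the induction serves both solvability and [alt_factors]. *)
Lemma color_sym_ind (T : finType) (C : eqType) (c : T -> C) :
  (forall x, #|[set y | c y == c x]| <= b) -> Q (color_sym_group c).
Proof.
have [n] := ubnP #|color_sym c|.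
elim: n C c => // n IHn C c /ltnSE-le_n cb.
case: (pickP [pred z : T * T | (z.1 != z.2) && (c z.1 == c z.2)]); last first.
  move=> injc; suff -> : color_sym_group c = 1%G by [].
  apply/val_inj/trivgP/subsetP => s /color_symP cs; rewrite inE; apply/eqP/permP=> x.
  have := injc (s x, x); rewrite /= cs eqxx andbT perm1.
  by move/negbFE/eqP.
case=> x0 y0 /= /andP[nxy /eqP cxy].
pose A := [set y | c y == c x0].
have sGN : color_sym c \subset 'N(A | 'P).
  apply/subsetP=> s /color_symP cs; apply/astabsP=> x; rewrite !inE /=.
  by rewrite /aperm cs.
pose f := [morphism of restrm sGN (restr_perm A)].
pose c1 x := (c x, if c x == c x0 then Some x else None).
have kerf : 'ker f = color_sym c1.
  rewrite ker_restrm ker_restr_perm; apply/setP=> s; rewrite inE.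
  apply/andP/idP => [[/color_symP cs /astabP sA]|/color_symP cs].
    apply/color_symP => x; rewrite /c1 cs; case: eqP => // cx.
    by have := sA x; rewrite inE cx eqxx /= /aperm => ->.
  have cs' : s \in color_sym c by apply/color_symP => x; case: (cs x).
  split=> //; apply/astabP=> x; rewrite inE => /eqP cx; rewrite /= /aperm.
  by have := cs x; rewrite /c1 (color_symP cs') cx eqxx => [[]].
pose j : 'I_#|A| -> T := enum_val.
have injj : injective j by apply: enum_val_inj.
have codj y : (y \in codom j) = (y \in A).
  apply/codomP/idP=> [[i ->]|Ay]; first exact: enum_valP.
  by exists (enum_rank_in Ay y); rewrite /j enum_rankK_in.
have imf : f @* color_sym c = ext_perm injj @* 'Sym_('I_#|A|).
  rewrite morphim_restrm setIid; apply/setP=> s.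
  apply/morphimP/morphimP => [[t Nt ct ->]|[t _ _ ->]].
    have [y jy|u eu] := ext_perm_onto injj (s := restr_perm A t).
      by apply: out_perm (restr_perm_on _ _) _; rewrite -codj.
    by exists u; rewrite ?inE //= eu.
  have Nt : ext_perm injj t \in color_sym c.
    apply/color_symP=> x; case: (boolP (x \in codom j)) => [/codomP[i ->]|].
      rewrite ext_permE.
      have := enum_valP (t i); have := enum_valP i; rewrite !inE.
      by move=> /eqP -> /eqP ->.
    by move/(ext_perm_out injj) ->.
  exists (ext_perm injj t) => //; first exact: (subsetP sGN).
  apply/permP=> x; case: (boolP (x \in A)) => Ax.
    by rewrite restr_permE ?(subsetP sGN).
  by rewrite (out_perm (restr_perm_on _ _) Ax) ext_perm_out // codj.
have QI : Q (ext_perm injj @* 'Sym_('I_#|A|))%G.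
  have inje := injm_ext_perm injj.
  have := @Q_ext _ _ (ext_perm injj @* 'Sym_('I_#|A|))%G 1%G
    ('Sym_('I_#|A|))%G [morphism of invm inje].
  apply=> //; last by apply: Q_Sym; apply: cb.
    by apply/trivgP; apply: injm_invm.
  by rewrite /= im_invm.
apply: (Q_ext (f := f) (K := color_sym_group c1) kerf imf) => //.
apply: IHn => [|x]; last first.
  apply: leq_trans (cb x); apply: subset_leq_card; apply/subsetP=> y.
  by rewrite !inE => /eqP[->] _.
apply: leq_trans le_n; apply: proper_card; apply/properP; split.
  by rewrite -kerf subsetIl.
exists (tperm x0 y0); rewrite tperm_color_sym ?cxy // /c1 cxy eqxx.
by apply: contra nxy => /eqP[->].
Qed.

End ColorInd.

Lemma sol_Sym_le4 (T : finType) : #|T| <= 4 -> solvable 'Sym_T.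
Proof.
move=> T4; apply: (sol_ext (f := sign_morph T)); first exact: sol_Alt_le4.
by apply: sol_card_le6; apply: leq_trans (max_card _) _; rewrite card_bool.
Qed.

Lemma color_sym_sol (T : finType) (C : eqType) (c : T -> C) :
  (forall x, #|[set y | c y == c x]| <= 4) -> solvable (color_sym c).
Proof.
apply: (color_sym_ind (Q := fun gT G => solvable G)) => [aT rT G K I f <- <-|gT|k k4].
- by move=> sK sI; apply: (sol_ext (f := f)).
- exact: solvable1.
by apply: sol_Sym_le4; rewrite card_ord.
Qed.

Lemma alt_factors_Alt k : 4 < k -> alt_factors ('Alt_('I_k))%G.
Proof.
move=> k4; have simA : simple 'Alt_('I_k) by apply: simple_Alt5; rewrite card_ord.
move=> L K snL nKL simLK _; exists k.
have [_ simN] := simpleP _ simA.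
have [defL | defL] : L :=: 1 \/ L :=: 'Alt_('I_k).
- case: (subnormalEr snL) => [-> | [N [snN nN pN]]]; first by right.
  left; case: (simN N nN) => defN; last by rewrite defN properxx in pN.
  by apply/trivgP; rewrite -defN subnormal_sub.
- move: simLK; rewrite defL quotient1.
  by case/simpleP; rewrite eqxx.
have [defK | defK] := simN K (eq_ind _ (fun X => K <| X) nKL _ defL).
  by rewrite defL defK isog_sym quotient1_isog.
move: simLK; rewrite defL defK trivg_quotient.
by case/simpleP; rewrite eqxx.
Qed.

Lemma alt_factors_Sym k : alt_factors ('Sym_('I_k))%G.
Proof.
case: (leqP k 4) => k4.
  by apply/alt_factors_sol/sol_Sym_le4; rewrite card_ord.
apply: (alt_factors_ext_eq (f := sign_morph 'I_k) (K := ('Alt_('I_k))%G)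
  (I := (sign_morph 'I_k @* 'Sym_('I_k))%G)) => //.
  exact: alt_factors_Alt.
apply/alt_factors_sol/sol_card_le6.
by apply: leq_trans (max_card _) _; rewrite card_bool.
Qed.

Lemma alt_factors_color_sym (T : finType) (C : eqType) (c : T -> C) :
  alt_factors (color_sym_group c).
Proof.
apply: (color_sym_ind (b := #|T|)) => [aT rT G K I f|gT|k _|x].
- exact: alt_factors_ext_eq.
- exact/alt_factors_sol/solvable1.
- exact: alt_factors_Sym.
exact: max_card.
Qed.

(** * Odd index subgroups of symmetric and Young groups *)

Section BlockExt.

Variables (T D : finType) (d : T -> D) (H : {group {perm T}}).
Hypothesis sHW : H \subset block_stab d.

Let f := [morphism of restrm sHW (block_perm d)].

Lemma ker_block_restr : 'ker f = H :&: color_sym d.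
Proof. by rewrite ker_restrm ker_block_perm. Qed.

Lemma im_block_restr : f @* H = block_perm d @* H.
Proof. by rewrite morphim_restrm setIid. Qed.

Lemma block_perm_alt_factors :
    alt_factors (H :&: color_sym d)%G -> alt_factors (block_perm d @* H)%G ->
  alt_factors H.
Proof. exact: alt_factors_ext_eq ker_block_restr im_block_restr. Qed.

Lemma block_perm_sol : solvable (H :&: color_sym d) ->
  solvable (block_perm d @* H) -> solvable H.
Proof.
rewrite -ker_block_restr -im_block_restr => solK solI.
exact: (sol_ext (f := f)).
Qed.

End BlockExt.

Section TpermBlocks.

Variables (T : finType) (H : {group {perm T}}).

Definition tperm_block (x : T) : {set T} := [set y | tperm x y \in H].

(** Sharing a transposition of H is an equivalence relation, because conjugating (x z) by (x y)
    gives (y z); each [tperm_block] is a class. *)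
Lemma tperm_block_eq x y : (tperm_block x == tperm_block y) = (tperm x y \in H).
Proof.
apply/eqP/idP => [/setP/(_ y)|Hxy]; first by rewrite !inE tperm1 group1 => ->.
apply/setP=> z; rewrite !inE.
have [->|nzx] := eqVneq z x; first by rewrite tperm1 group1 tpermC Hxy.
have [->|nzy] := eqVneq z y; first by rewrite tperm1 group1 Hxy.
by rewrite -(groupJr _ Hxy) tpermJ tpermL tpermD // eq_sym.
Qed.

Lemma tperm_block_stab : H \subset block_stab tperm_block.
Proof.
apply/subsetP=> h Hh; apply/block_stabP=> x y.
by rewrite !tperm_block_eq -tpermJ groupJr.
Qed.

Lemma color_sym_tperm_block : color_sym tperm_block \subset H.
Proof. by apply: color_sym_gen => x y /eqP; rewrite tperm_block_eq. Qed.

End TpermBlocks.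

(* The transpositions of H generate a normal subgroup, a product of symmetric *)
(* groups, and H acts on its orbits as a subgroup of odd index of the group   *)
(* preserving the sizes and the colors of these orbits.                       *)
Theorem alt_factors_odd_color_sym (T : finType) (C : eqType) (c : T -> C)
    (H : {group {perm T}}) :
  H \subset color_sym c -> odd #|color_sym c : H| -> alt_factors H.
Proof.
have [n] := ubnP #|H|.
elim: n T C c H => // n IHn T C c H /ltnSE-le_n sHc oddH.
case: (pickP [pred z : T * T | (z.1 != z.2) && (c z.1 == c z.2)]); last first.
  move=> injc; apply/alt_factors_sol/(solvableS sHc).
  apply: color_sym_sol => x; apply: leq_trans (_ : #|[set x]| <= 4); last first.
    by rewrite cards1.
  apply/subset_leq_card/subsetP=> y; rewrite !inE => cxy.
  by have /= := injc (y, x); rewrite cxy andbT => /negbFE.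
case=> x0 y0 /= /andP[nxy cxy].
(* A transposition generates a 2-group, and its conjugates are transpositions. *)
have [x [y [nxy' Hxy]]] : exists x y, x != y /\ tperm x y \in H.
  have sQ : <[tperm x0 y0]> \subset color_sym c by rewrite cycle_subG tperm_color_sym.
  have pQ : 2.-group <[tperm x0 y0]>.
    apply: square1_2group => _ /cycleP[i ->].
    by rewrite expgAC expg2 tperm2 expg1n.
  have [s _] := odd_index_conj sHc oddH sQ pQ.
  rewrite -cycleJ cycle_subG tpermJ => Hs.
  by exists (s x0), (s y0); rewrite (inj_eq perm_inj).
have sHW := tperm_block_stab H; have sdH := color_sym_tperm_block H.
have d_c u v : tperm_block H u = tperm_block H v -> c u = c v.
  move/eqP; rewrite tperm_block_eq => /(subsetP sHc).
  by rewrite tperm_color_sym => /eqP.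
have [|sI oddI] := odd_index_block_perm d_c (subxx _) sHc oddH sHW.
  by move=> s cs; exists 1; rewrite ?group1 ?mulg1.
apply: (block_perm_alt_factors sHW).
  suff -> : (H :&: color_sym (tperm_block H))%G = color_sym_group (tperm_block H).
    exact: alt_factors_color_sym.
  by apply/val_inj/setIidPr.
(* The order drops because the transposition found above lies in the kernel of the action on the
   blocks. *)
apply: IHn sI oddI; apply: leq_trans le_n.
apply: ltn_morphim; rewrite ker_block_perm; apply/properP; split; first exact: sub1G.
exists (tperm x y); first by rewrite inE Hxy tperm_color_sym tperm_block_eq.
by apply: contra nxy' => /set1P t1; rewrite -[y](tpermL x) t1 perm1.
Qed.

(** * Block systems of odd index subgroups of alternating groups *)

Section AltBlocks.

Variables (T D : finType) (d : T -> D) (H : {group {perm T}}) (x y : T).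
Hypotheses (sHA : H \subset 'Alt_T) (oddH : odd #|'Alt_T : H|).
Hypotheses (sHW : H \subset block_stab d) (nxy : x != y) (dxy : d x = d y).

Let one_color : T -> unit := fun _ => tt.

(** The transposition of two points of one block fixes all blocks, so it can correct the parity of a
    lift: on the blocks, A_n induces as much as S_n. *)
Lemma odd_index_Alt_block_perm :
  (block_perm d @* H \subset color_sym (block_color d one_color)) /\
  odd #|color_sym (block_color d one_color) : block_perm d @* H|.
Proof.
have sA : 'Alt_T \subset color_sym one_color.
  by apply/subsetP=> s _; apply/color_symP.
apply: (odd_index_block_perm _ sA sHA oddH sHW) => // s _.
exists (tperm x y ^+ odd_perm s).
  by case: odd_perm; rewrite ?expg1 ?group1 // tperm_color_sym dxy.
rewrite Alt_even odd_permM; case: (boolP (odd_perm s)) => _.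
  by rewrite expg1 odd_tperm nxy.
by rewrite expg0 odd_perm1.
Qed.

Lemma alt_factors_Alt_blocks :
  alt_factors (H :&: color_sym d)%G -> alt_factors H.
Proof.
have [sI oddI] := odd_index_Alt_block_perm => altK.
by apply: (block_perm_alt_factors sHW altK); apply: alt_factors_odd_color_sym oddI.
Qed.

Lemma alt_factors_small_blocks :
  (forall z, #|[set u | d u == d z]| <= 4) -> alt_factors H.
Proof.
move=> d4; apply/alt_factors_Alt_blocks/alt_factors_sol.
exact: solvableS (subsetIr _ _) (color_sym_sol d4).
Qed.

(** Blocks have at most 4 points, and at most 4 blocks share a size: five blocks of equal size on at
    most 6 points would be singletons, all outside the block of [x] and [y], where only 4 points
    remain. So both the kernel and the action lie in soluble Young subgroups. *)
Lemma sol_Alt_blocks : #|T| <= 6 ->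
  (forall z, #|[set u | d u == d z]| <= 4) -> solvable H.
Proof.
move=> T6 d4; apply: (block_perm_sol sHW).
  exact: solvableS (subsetIr _ _) (color_sym_sol d4).
have [sI _] := odd_index_Alt_block_perm; apply: solvableS sI _.
apply: color_sym_sol => v.
case: (boolP (v \in codom d)) => [/codomP[z ->] | dv]; last first.
  apply: leq_trans (_ : #|[set v]| <= 4); last by rewrite cards1.
  apply/subset_leq_card/subsetP=> w; rewrite !inE (block_color_out _ dv).
  case: (boolP (w \in codom d)) => [/codomP[u ->] | dw]; last first.
    by rewrite block_color_out // => /eqP[->].
  by rewrite block_colorE //.
pose B := [set w | block_color d one_color w == block_color d one_color (d z)].
rewrite -/B leqNgt; apply/negP=> B5.
have Bd w : w \in B -> exists2 u, w = d u & #|fiber d w| = #|fiber d (d z)|.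
  rewrite inE; case: (boolP (w \in codom d)) => [/codomP[u ->] | dw].
    by rewrite !block_colorE // => /eqP[->]; exists u.
  by rewrite block_color_out // block_colorE.
pose k := #|fiber d (d z)|; pose U := [set u | d u \in B].
have cardU : #|U| = (#|B| * k)%N.
  rewrite -sum1_card (partition_big d (mem B)) => [|u]; last by rewrite inE.
  rewrite -sum_nat_const; apply: eq_bigr => w Bw.
  have [u _ kw] := Bd w Bw; rewrite /k -kw sum1dep_card; apply: eq_card => t.
  rewrite !in_set -/B; case: (eqVneq (d t) w) => [-> | _]; last by rewrite andbF.
  by move: Bw; rewrite /= in_set => ->.
have k_gt0 : 0 < k by apply/card_gt0P; exists z; rewrite inE.
have [k1 | k2] := leqP k 1; last first.
  have := leq_trans (max_card (mem U)) T6; rewrite cardU.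
  by rewrite leqNgt (leq_trans _ (leq_mul B5 k2)).
have /subset_leq_card : U \subset ~: [set x; y].
  apply/subsetP=> u; rewrite inE => /Bd[u' _ ku]; rewrite !inE; apply/negP=> uxy.
  have : [set x; y] \subset fiber d (d u).
    apply/subsetP=> t; rewrite !inE.
    by case/orP: uxy => /eqP ->; case/orP=> /eqP ->; rewrite ?dxy.
  by move/subset_leq_card; rewrite cards2 nxy ku leqNgt ltnS k1.
rewrite cardU (cardsCs (~: _)) setCK cards2 nxy leqNgt => /negP[].
apply: leq_trans (leq_mul B5 k_gt0); by rewrite ltnS leq_subLR.
Qed.

End AltBlocks.

(** * Subgroups containing 3-cycles *)

Ltac neq_tac :=
  solve [ assumption | by rewrite eq_sym | by apply/eqP; assumption ].

Ltac tperm_tac :=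
  repeat first
    [ rewrite permM
    | rewrite tpermL
    | rewrite tpermR
    | match goal with |- context [fun_of_perm (tperm ?a ?b) ?c] =>
        rewrite (@tpermD _ a b c); [ | neq_tac | neq_tac ] end ].

Section ThreeCycles.

Variable T : finType.
Implicit Types (x y z u v w : T) (s t : {perm T}) (H K : {group {perm T}}).

(** Products act from left to right, so for distinct points this is the cycle x -> y -> z -> x. *)
Definition cyc3 x y z : {perm T} := tperm x y * tperm x z.

Definition distinct3 x y z := [&& x != y, x != z & y != z].

Lemma cyc3J x y z s : cyc3 x y z ^ s = cyc3 (s x) (s y) (s z).
Proof. by rewrite /cyc3 conjMg !tpermJ. Qed.

Lemma cyc3V x y z : (cyc3 x y z)^-1 = cyc3 x z y.
Proof. by rewrite /cyc3 invMg !tpermV. Qed.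

Lemma cyc3_rot x y z : distinct3 x y z -> cyc3 x y z = cyc3 y z x.
Proof.
case/and3P=> nxy nxz nyz; rewrite /cyc3.
have -> : tperm y z = tperm x z ^ tperm x y.
  by rewrite tpermJ tpermL tpermD // eq_sym.
by rewrite (tpermC y x) /conjg tpermV -!mulgA tperm2 mulg1.
Qed.

Lemma cyc3_x x y z : distinct3 x y z -> cyc3 x y z x = y.
Proof. by case/and3P=> ? ? ?; rewrite permM; tperm_tac. Qed.

Lemma cyc3_y x y z : distinct3 x y z -> cyc3 x y z y = z.
Proof. by case/and3P=> ? ? ?; rewrite permM; tperm_tac. Qed.

Lemma cyc3_z x y z : distinct3 x y z -> cyc3 x y z z = x.
Proof. by case/and3P=> ? ? ?; rewrite permM; tperm_tac. Qed.

Lemma cyc3_out x y z u : u != x -> u != y -> u != z -> cyc3 x y z u = u.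
Proof.
by move=> ? ? ?; rewrite permM; tperm_tac.
Qed.

Lemma cyc3_Alt x y z : distinct3 x y z -> cyc3 x y z \in 'Alt_T.
Proof. by case/and3P=> nxy nxz _; rewrite Alt_even odd_permM !odd_tperm nxy nxz. Qed.

Lemma distinct3_rot x y z : distinct3 x y z = distinct3 y z x.
Proof.
by rewrite /distinct3 !(eq_sym _ x); case: (x == y); case: (x == z); case: (y == z).
Qed.

Lemma distinct3_swap x y z : distinct3 x y z = distinct3 y x z.
Proof. by rewrite /distinct3 (eq_sym x y); case: (_ == _); rewrite //= andbC. Qed.

Lemma mem_cyc3_rot H x y z : distinct3 x y z ->
  (cyc3 x y z \in H) = (cyc3 y z x \in H).
Proof. by move/cyc3_rot ->. Qed.

Lemma mem_cyc3_swap H x y z : distinct3 x y z ->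
  (cyc3 x y z \in H) = (cyc3 y x z \in H).
Proof.
by move=> d3; rewrite mem_cyc3_rot // -groupV cyc3V.
Qed.

Section Blocks3.

Variable H : {group {perm T}}.

Definition rel3 x y :=
  (x == y) || [exists z, distinct3 x y z && (cyc3 x y z \in H)].

Lemma rel3_refl x : rel3 x x.
Proof. by rewrite /rel3 eqxx. Qed.

Lemma rel3_cyc x y z : distinct3 x y z -> cyc3 x y z \in H -> rel3 x y.
Proof. by move=> d3 Hxyz; apply/orP; right; apply/existsP; exists z; rewrite d3. Qed.

Lemma rel3P x y : x != y -> rel3 x y ->
  exists2 z, distinct3 x y z & cyc3 x y z \in H.
Proof. by rewrite /rel3 => /negPf -> /existsP[z /andP[]]; exists z. Qed.

Lemma rel3_sym x y : rel3 x y = rel3 y x.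
Proof.
apply/idP/idP.
  have [->|nxy] := eqVneq x y; first by rewrite rel3_refl.
  case/(rel3P nxy)=> z d3; rewrite mem_cyc3_swap //; apply: rel3_cyc.
  by rewrite distinct3_swap.
have [->|nxy] := eqVneq y x; first by rewrite rel3_refl.
case/(rel3P nxy)=> z d3; rewrite mem_cyc3_swap //; apply: rel3_cyc.
by rewrite distinct3_swap.
Qed.

(* All 3-cycles on points x, y, w with x, y and x, w related lie in H; this  *)
(* gives both the transitivity of the relation and the structure of blocks.  *)
Lemma rel3_cyc3 x y w : distinct3 x y w -> rel3 x y -> rel3 x w ->
  cyc3 x y w \in H.
Proof.
move=> d3 /rel3P rxy /rel3P rxw; have /and3P[nxy nxw nyw] := d3.
have [z dxyz Hxyz] := rxy nxy; have [u dxwu Hxwu] := rxw nxw.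
have /and3P[_ nxz nyz] := dxyz; have /and3P[_ nxu nwu] := dxwu.
(* the two 3-cycles share two points *)
have share2 a b p q : distinct3 a b p -> distinct3 a b q -> p != q ->
    cyc3 a b p \in H -> cyc3 a b q \in H -> cyc3 a p q \in H.
  move=> dp dq npq Hp Hq; have /and3P[nab nap nbp] := dp.
  have /and3P[_ naq nbq] := dq.
  have := groupJ (groupJ Hq Hp) Hp; rewrite !cyc3J /cyc3; tperm_tac.
  rewrite -/(cyc3 p a q) mem_cyc3_swap //.
  by rewrite /distinct3 eq_sym nap npq naq.
have [zw | nzw] := eqVneq z w; first by rewrite -zw.
have [uy | nuy] := eqVneq u y.
  rewrite -cyc3V groupV -uy //.
have [uz | nuz] := eqVneq u z.
  (* cyc3 x w z and cyc3 x y z share x and z *)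
  rewrite {}uz in dxwu Hxwu nxu nwu nuy.
  apply: (share2 x z y w).
  - by rewrite /distinct3 nxz nxy eq_sym.
  - by rewrite /distinct3 nxz nxw.
  - by [].
  - by rewrite -cyc3V groupV.
  by rewrite -cyc3V groupV.
have := groupJ Hxyz Hxwu; rewrite cyc3J /cyc3; tperm_tac => Hwyz.
rewrite -/(cyc3 w y z) in Hwyz; rewrite mem_cyc3_swap //.
have dyzx : distinct3 y z x by rewrite -distinct3_rot.
have dwyz : distinct3 w y z by rewrite /distinct3 nyz eq_sym nyw eq_sym nzw.
apply: (share2 y z x w) => //; first by rewrite -distinct3_rot.
  by rewrite -mem_cyc3_rot.
by rewrite -mem_cyc3_rot.
Qed.

Lemma rel3_trans x y w : rel3 x y -> rel3 x w -> rel3 y w.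
Proof.
move=> rxy rxw.
have [<-|nxy] := eqVneq x y; first by [].
have [<-|nxw] := eqVneq x w; first by rewrite rel3_sym.
have [->|nyw] := eqVneq y w; first exact: rel3_refl.
have d3 : distinct3 x y w by rewrite /distinct3 nxy nxw.
have := rel3_cyc3 d3 rxy rxw; rewrite mem_cyc3_rot //; apply: rel3_cyc.
by rewrite -distinct3_rot.
Qed.

Definition block3 x : {set T} := [set y | rel3 x y].

Lemma block3_eq x y : (block3 x == block3 y) = rel3 x y.
Proof.
apply/eqP/idP => [/setP/(_ y)|rxy]; first by rewrite !inE rel3_refl => ->.
apply/setP=> z; rewrite !inE; apply/idP/idP => rz; first exact: rel3_trans rz.
by apply: rel3_trans rz; rewrite rel3_sym.
Qed.

Lemma block3_stab : H \subset block_stab block3.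
Proof.
have sub h x y : h \in H -> rel3 x y -> rel3 (h x) (h y).
  move=> Hh; have [->|nxy] := eqVneq x y; first by rewrite !rel3_refl.
  case/(rel3P nxy)=> z d3 Hz; apply: (@rel3_cyc _ _ (h z)).
    by rewrite /distinct3 !(inj_eq perm_inj).
  by rewrite -cyc3J groupJ.
apply/subsetP=> h Hh; apply/block_stabP=> x y; rewrite !block3_eq.
apply/idP/idP=> [r|]; last exact: sub.
by have := sub _ _ _ (groupVr Hh) r; rewrite !permK.
Qed.

(** Transpositions with a common point multiply to 1 or to a 3-cycle, covered by [rel3_cyc3];
    otherwise inserting (a c) twice splits the product into two such pairs. *)
Lemma block3_tperm2 a b c d : a != b -> c != d ->
  rel3 a b -> rel3 a c -> rel3 a d -> tperm a b * tperm c d \in H.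
Proof.
have share u v w : u != v -> u != w -> rel3 u v -> rel3 u w ->
    tperm u v * tperm u w \in H.
  move=> nuv nuw ruv ruw; have [->|nvw] := eqVneq v w; first by rewrite tperm2.
  by apply: rel3_cyc3 => //; rewrite /distinct3 nuv nuw.
move=> nab ncd rab rac rad.
have [eac | nac] := eqVneq a c; first by rewrite -{}eac in ncd *; apply: share.
have rcd : rel3 c d by apply: rel3_trans rac rad.
have -> : tperm a b * tperm c d = (tperm a b * tperm a c) * (tperm c a * tperm c d).
  by rewrite -!mulgA (tpermC c a) (mulgA (tperm a c)) tperm2 mul1g.
by rewrite groupM ?share // 1?eq_sym // rel3_sym.
Qed.

(** Conjugating k by a transposition (x y) inside a block multiplies k by (kx ky)(x y). These four
    points lie in one block, so the factor is in H by [block3_tperm2]. *)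
Lemma block3_normal : H :&: color_sym block3 <| color_sym block3.
Proof.
rewrite /normal subsetIr /=; apply: color_sym_gen => x y /eqP; rewrite block3_eq => rxy.
have [->|nxy] := eqVneq x y; first by rewrite tperm1 group1.
apply/normP/eqP; rewrite eqEcard cardJg leqnn andbT.
apply/subsetP=> _ /imsetP[k /setIP[Hk dk] ->].
have rk z : rel3 z (k z).
  by rewrite rel3_sym -block3_eq (color_symP dk).
have dt : tperm x y \in color_sym block3 by rewrite tperm_color_sym block3_eq.
apply/setIP; split; last by rewrite groupJ.
have -> : k ^ tperm x y = k * (tperm (k x) (k y) * tperm x y).
  by rewrite -tpermJ /conjg tpermV !mulgA mulgV mul1g.
have rkx : rel3 (k x) x by rewrite rel3_sym.
rewrite groupMl // block3_tperm2 ?(inj_eq perm_inj) //.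
  by apply: rel3_trans (rk x) _; apply: rel3_trans (rk y); rewrite rel3_sym.
by apply: rel3_trans rxy; apply: rk.
Qed.

Lemma alt_factors_cyc3 x y z : H \subset 'Alt_T -> odd #|'Alt_T : H| ->
  distinct3 x y z -> cyc3 x y z \in H -> alt_factors H.
Proof.
move=> sHA oddH d3 Hxyz; have /and3P[nxy _ _] := d3.
have dxy : block3 x = block3 y by apply/eqP; rewrite block3_eq (rel3_cyc d3).
apply: (alt_factors_Alt_blocks sHA oddH block3_stab nxy dxy).
apply: (alt_factors_normal (G := color_sym_group block3)).
  exact: block3_normal.
exact: alt_factors_color_sym.
Qed.

End Blocks3.
End ThreeCycles.

(** * No 3-cycles, at least ten points: the canonical matching *)

Section TwoElements.

Variable T : finType.
Implicit Types (x y z a b c : T) (t : {perm T}).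

Definition free_of_cyc3 (H : {set {perm T}}) :=
  forall x y z, distinct3 x y z -> cyc3 x y z \notin H.

Variable H : {group {perm T}}.
Hypothesis no3 : free_of_cyc3 H.

(* Otherwise the quotient of s := (x a)(b c) by its conjugate s ^ t is the    *)
(* 3-cycle (a x t(x)).                                                        *)
Lemma single_meet x a b c t : tperm x a * tperm b c \in H -> t \in H ->
  t a = a -> t b = b -> t c = c -> a != x -> t x = x.
Proof.
move=> Hs Ht ta tb tc nax; apply/eqP; apply: contraT => ntx.
have d3 : distinct3 a x (t x).
  by rewrite /distinct3 nax -{1}ta (inj_eq perm_inj) nax eq_sym.
case/negP: (no3 d3); have := groupM Hs (groupVr (groupJ Hs Ht)).
rewrite conjMg !tpermJ ta tb tc invMg !tpermV -mulgA (mulgA (tperm b c)) tperm2.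
by rewrite mul1g /cyc3 ![tperm a _]tpermC.
Qed.

(** A matching with at most one unmatched point, such that H contains the even part of the
    elementary abelian group generated by its transpositions. *)
Definition good_matching (m : {perm T}) :=
  [/\ involutive m,
      forall x y, m x = x -> m y = y -> x = y
    & forall x y, m x != x -> m y != y -> tperm x (m x) * tperm y (m y) \in H].

Lemma good_matchingJ m h : h \in H -> good_matching m -> good_matching (m ^ h).
Proof.
move=> Hh [mK mfix mH].
have E x : (m ^ h) x = h (m (h^-1 x)) by rewrite -{1}(permKV h x) permJ.
split=> [x | x y | x y].
- by rewrite !E permK mK permKV.
- rewrite !E => /(canRL (permK h)) /mfix hx /(canRL (permK h)) /hx.
  exact: perm_inj.
rewrite !E => nx ny; have := groupJ (mH (h^-1 x) (h^-1 y) _ _) Hh.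
rewrite conjMg !tpermJ !permKV; apply.
  by apply: contraNneq nx => ->; rewrite permKV.
by apply: contraNneq ny => ->; rewrite permKV.
Qed.

Lemma matching_differ m k : good_matching m -> good_matching k -> m != k ->
  exists x, [/\ m x != x, k x != x & m x != k x].
Proof.
move=> [mK mf _] [kK kf _] nmk.
have [x nx] : exists x, m x != k x.
  apply/existsP; apply: contraR nmk; rewrite negb_exists => /forallP e.
  by apply/eqP/permP=> x; apply/eqP; have := e x; rewrite negbK.
have [mx|] := eqVneq (m x) x.
  have nkx : k x != x by rewrite -{2}mx eq_sym.
  exists (k x); rewrite kK; split; last 1 first.
  - by apply: contraNneq nkx => e; rewrite -[k x]mK e mx.
  - by apply: contraNneq nkx => /mf/(_ mx) ->.
  by rewrite eq_sym.
have [kx|] := eqVneq (k x) x; last by exists x.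
move=> nmx; exists (m x); rewrite mK; split.
- by rewrite eq_sym.
- by apply: contraNneq nmx => /kf/(_ kx) ->.
by rewrite eq_sym; apply: contraNneq nmx => e; rewrite -[m x]kK e kx.
Qed.

Lemma ex_notin (s : seq T) : size s < #|T| -> exists x, x \notin s.
Proof.
move=> szs; apply/existsP; rewrite -negb_forall; apply: contraL szs => /forallP ins.
rewrite -leqNgt cardE; apply: uniq_leq_size (enum_uniq _) _ => x _; exact: ins.
Qed.

Lemma ex_notin_fix (m : {perm T}) (s : seq T) :
    (forall x y, m x = x -> m y = y -> x = y) -> (size s).+1 < #|T| ->
  exists2 x, x \notin s & m x != x.
Proof.
move=> mf szs; case: (pickP (fun x => m x == x)) => [f /eqP mff | nof].
  have [x] := ex_notin (s := f :: s) szs; rewrite inE negb_or => /andP[nxf nxs].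
  by exists x => //; apply: contraNneq nxf => /mf/(_ mff) ->.
by have [x nxs] := ex_notin (ltnW szs); exists x; rewrite ?nof.
Qed.

(** If x has different partners under m and k, take an m-pair {y, m y} avoiding x, m x, k x, and
    then a k-pair {z, k z} avoiding all of these points. The elements (x mx)(y my) and (x kx)(z kz)
    of H meet only in x, against [single_meet]. Choosing z excludes 8 points and possibly an
    unmatched one, whence the bound 10. *)
Lemma good_matching_unique m k : 9 < #|T| ->
  good_matching m -> good_matching k -> m = k.
Proof.
move=> T10 gm gk; apply/eqP; apply: contraT => nmk.
have [x [nmx nkx nmkx]] := matching_differ gm gk nmk.
case: gm gk => [mK mf mH] [kK kf kH].
have [|y ny nmy] := ex_notin_fix (s := [:: x; m x; k x; m (k x)]) mf.
  exact: leq_trans T10.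
have [|z nz nkz] := ex_notin_fix
  (s := [:: x; k x; m x; k (m x); y; k y; m y; k (m y)]) kf.
  exact: leq_trans T10.
have Hs := mH x y nmx nmy; have Ht := kH x z nkx nkz.
move: ny nz; rewrite !inE !negb_or => /and4P[y1 y2 y3 y4].
case/and5P=> z1 z2 z3 z4 /and4P[z5 z6 z7 z8].
have inv_neq (p : {perm T}) u v : involutive p -> u != p v -> p u != v.
  by move=> pK; apply: contraNneq => <-; rewrite pK.
have [k1 k2 k3] : [/\ k z != m x, k z != y & k z != m y].
  by split; apply: inv_neq.
have [m1 m2] : m y != x /\ m y != k x by split; apply: inv_neq.
have k4 : k z != k x by rewrite (inj_eq perm_inj).
have /eqP : (tperm x (k x) * tperm z (k z)) x = x.
  by apply: (single_meet Hs Ht) => //; tperm_tac.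
by tperm_tac; rewrite (negPf nkx).
Qed.

End TwoElements.

Section Matching.

Variable n : nat.

(** Exchanges 2k and 2k+1; when n is odd, the default of [insubd] fixes the last index, which has no
    partner. *)
Definition pair_ord (i : 'I_n) : 'I_n := insubd i (if odd i then i.-1 else i.+1).

Lemma pair_ordE i : pair_ord i = (if odd i then i.-1 else if i.+1 < n then i.+1 else i) :> nat.
Proof.
rewrite /pair_ord val_insubd; case: (odd i) => //.
by rewrite (leq_ltn_trans (leq_pred i) (ltn_ord i)).
Qed.

Lemma pair_ordK : involutive pair_ord.
Proof.
move=> i; apply/val_inj; rewrite /= !pair_ordE; have := ltn_ord i.
case: (boolP (odd i)) => oi lt_in.
  have [-> ->] : odd i.-1 = false /\ (i.-1.+1 < n) = true by split; lia.
  by lia.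
case: (boolP (i.+1 < n)) => lti; last by rewrite (negPf oi) (negPf lti).
by have -> : odd i.+1 by lia.
Qed.

Lemma pair_ord_fix i j : pair_ord i = i -> pair_ord j = j -> i = j.
Proof.
move=> /(congr1 val) + /(congr1 val) + ; rewrite /= !pair_ordE => ei ej.
apply/val_inj => /=; have := ltn_ord i; have := ltn_ord j.
move: ei ej; case: (boolP (odd i)) => oi; case: (boolP (odd j)) => oj; try by lia.
by case: ifP; case: ifP; lia.
Qed.

Definition pair_perm : {perm 'I_n} := perm (can_inj pair_ordK).

End Matching.

Lemma commute_matching (T : finType) (m : {perm T}) x y :
  involutive m -> commute (tperm x (m x)) (tperm y (m y)).
Proof.
move=> mK; apply/commgP/conjg_fixP; rewrite tpermJ.
have [->|nxy] := eqVneq x y; first by rewrite tpermL tpermR tpermC.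
have [exy|nxmy] := eqVneq x (m y).
  by rewrite exy mK tpermL tpermR tpermC.
have nmxy : m x != y by apply: contraNneq nxmy => <-; rewrite mK.
have nmm : m x != m y by rewrite (inj_eq perm_inj).
by tperm_tac.
Qed.

(** Products of two transpositions of the standard matching are commuting elements of square 1, so
    they generate a 2-group, which has a conjugate in H. *)
Lemma ex_good_matching n (H : {group {perm 'I_n}}) :
  H \subset 'Alt_('I_n) -> odd #|'Alt_('I_n) : H| ->
  exists m, good_matching H m.
Proof.
move=> sHA oddH; pose m := pair_perm n.
have mK : involutive m by move=> x; rewrite !permE pair_ordK.
have mf x y : m x = x -> m y = y -> x = y by rewrite !permE; apply: pair_ord_fix.
pose S := [set tperm z.1 (m z.1) * tperm z.2 (m z.2) |
             z : 'I_n * 'I_n & (m z.1 != z.1) && (m z.2 != z.2)].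
have cmS x y z t : commute (tperm x (m x) * tperm y (m y))
                           (tperm z (m z) * tperm t (m t)).
  by apply: commuteM; apply: commute_sym; apply: commuteM; apply: commute_matching.
have pS : 2.-group <<S>>.
  apply: gen_involutions_2group => [_ /imsetP[z _ ->]|].
    rewrite expgMn; last exact: commute_matching.
    by rewrite !expg2 !tperm2 mulg1.
  by move=> _ _ /imsetP[z _ ->] /imsetP[t _ ->].
have sSA : <<S>> \subset 'Alt_('I_n).
  rewrite gen_subG; apply/subsetP=> t /imsetP[z]; rewrite inE => /andP[z1 z2] ->.
  by rewrite Alt_even odd_permM !odd_tperm eq_sym z1 eq_sym z2.
have [s As] := odd_index_conj sHA oddH sSA pS.
rewrite -genJ gen_subG => /subsetP sSH; exists (m ^ s).
have E x : (m ^ s) x = s (m (s^-1 x)) by rewrite -{1}(permKV s x) permJ.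
split=> [x | x y | x y].
- by rewrite !E permK mK permKV.
- rewrite !E => /(canRL (permK s)) /mf sx /(canRL (permK s)) /sx.
  exact: perm_inj.
rewrite !E => nx ny; apply: sSH; rewrite -{1}(permKV s x) -{1}(permKV s y).
rewrite -!tpermJ -conjMg memJ_conjg; apply/imsetP.
exists (s^-1 x, s^-1 y) => //; rewrite inE /=; apply/andP; split.
  by apply: contraNneq nx => ->; rewrite permKV.
by apply: contraNneq ny => ->; rewrite permKV.
Qed.

Lemma alt_factors_ge10 n (H : {group {perm 'I_n}}) : 9 < n ->
    H \subset 'Alt_('I_n) -> odd #|'Alt_('I_n) : H| -> free_of_cyc3 H ->
  alt_factors H.
Proof.
move=> n10 sHA oddH no3; have T10 : 9 < #|'I_n| by rewrite card_ord.
have [m gm] := ex_good_matching sHA oddH.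
(* By uniqueness H centralizes its matching, so the pairs are blocks. *)
have mJ h x : h \in H -> h (m x) = m (h x).
  move=> Hh; have := good_matching_unique no3 T10 gm (good_matchingJ Hh gm).
  by move=> {2}->; rewrite permJ.
case: gm => mK mf _; pose d x := [set x; m x].
have dE x y : (d x == d y) = (y \in d x).
  apply/eqP/idP=> [->|]; first by rewrite !inE eqxx.
  by rewrite !inE => /orP[] /eqP -> //; rewrite /d mK setUC.
have sHW : H \subset block_stab d.
  apply/subsetP=> h Hh; apply/block_stabP=> x y; rewrite !dE !inE -mJ //.
  by rewrite !(inj_eq perm_inj).
have [x _ nmx] : exists2 x, x \notin [::] & m x != x.
  by apply: ex_notin_fix => //; apply: leq_trans T10.
apply: (alt_factors_small_blocks sHA oddH sHW nmx).
  by apply/eqP; rewrite dE !inE mK eqxx orbT.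
move=> z; apply: leq_trans (_ : #|[set z; m z]| <= 4).
  by apply/subset_leq_card/subsetP=> u; rewrite inE eq_sym dE.
by rewrite cards2; case: eqP.
Qed.

(** * Quads and their intersections *)

Lemma card4_ext (T : finType) (A : {set T}) x y :
    #|A| = 4 -> x \in A -> y \in A -> x != y ->
  exists u v, uniq [:: x; y; u; v] /\ A = [set x; y; u; v].
Proof.
move=> A4 Ax Ay nxy; have : #|A :\ x :\ y| == 2.
  have := cardsD1 x A; have := cardsD1 y (A :\ x).
  by rewrite !inE Ax Ay eq_sym nxy A4 /=; lia.
case/cards2P=> u [v [nuv defA]]; exists u, v.
have uA : u \in A :\ x :\ y by rewrite defA !inE eqxx.
have vA : v \in A :\ x :\ y by rewrite defA !inE eqxx orbT.
move: uA vA; rewrite !inE => /and3P[nuy nux Au] /and3P[nvy nvx Av]; split.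
  by rewrite /= !inE !negb_or nxy nuv !(eq_sym x u, eq_sym x v, eq_sym y u, eq_sym y v)
     nux nvx nuy nvy.
apply/setP=> z; rewrite !inE.
have [-> | nzx] := eqVneq z x; first by rewrite Ax.
have [-> | nzy] := eqVneq z y; first by rewrite Ay.
by have := congr1 (fun B : {set T} => z \in B) defA; rewrite /= !inE nzx nzy.
Qed.

Section Quads.

Variable T : finType.
Implicit Types (x y z a b c d : T) (A B : {set T}).

Definition quad (H : {set {perm T}}) A : bool :=
  (#|A| == 4) && [forall a in A, forall b in A, forall c in A, forall d in A,
     uniq [:: a; b; c; d] ==> (tperm a b * tperm c d \in H)].

Lemma quad_card (H : {set {perm T}}) A : quad H A -> #|A| = 4.
Proof. by case/andP=> /eqP. Qed.

Lemma quad_mem (H : {set {perm T}}) A a b c d :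
    quad H A -> a \in A -> b \in A -> c \in A -> d \in A ->
  uniq [:: a; b; c; d] -> tperm a b * tperm c d \in H.
Proof.
case/andP=> _ /forall_inP Aq Aa Ab Ac Ad u4.
have /forall_inP/(_ b Ab)/forall_inP/(_ c Ac)/forall_inP/(_ d Ad) := Aq a Aa.
by rewrite u4.
Qed.

(** The third involution of the Klein group is the product of the other two; the long case analysis
    only identifies the different ways of writing these three. *)
Lemma quad_intro (H : {group {perm T}}) a b c d : uniq [:: a; b; c; d] ->
    tperm a b * tperm c d \in H -> tperm a c * tperm b d \in H ->
  quad H [set a; b; c; d].
Proof.
move=> u4 H1 H2; have := u4; rewrite /= !inE !negb_or andbT.
case/and3P=> /and3P[nab nac nad] /andP[nbc nbd] ncd.
have tC p q r s : p != r -> p != s -> q != r -> q != s ->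
    tperm p q * tperm r s = tperm r s * tperm p q.
  move=> *; apply: (@perm_onC _ [set p; q] [set r; s]); try exact: tperm_on.
  rewrite disjoint_subset; apply/subsetP=> z; rewrite !inE negb_or.
  by case/orP=> /eqP ->; apply/andP.
have H3 : tperm a d * tperm b c \in H.
  suff -> : tperm a d * tperm b c = (tperm a b * tperm c d) * (tperm a c * tperm b d).
    by rewrite groupM.
  apply/permP=> z.
  have [-> | nza] := eqVneq z a; first by tperm_tac.
  have [-> | nzb] := eqVneq z b; first by tperm_tac.
  have [-> | nzc] := eqVneq z c; first by tperm_tac.
  have [-> | nzd] := eqVneq z d; first by tperm_tac.
  by tperm_tac.
have H1' : tperm c d * tperm a b \in H by rewrite tC // eq_sym.
have H2' : tperm b d * tperm a c \in H by rewrite tC // eq_sym.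
have H3' : tperm b c * tperm a d \in H by rewrite tC // eq_sym.
apply/andP; split.
  apply/eqP; rewrite -[4%N]/(size [:: a; b; c; d]) -(card_uniqP u4).
  by apply: eq_card => z; rewrite !inE -!orbA.
apply/forall_inP=> p Ap; apply/forall_inP=> q Aq.
apply/forall_inP=> r Ar; apply/forall_inP=> s As; apply/implyP.
have nrm := (tpermC b a, tpermC c a, tpermC d a, tpermC c b, tpermC d b, tpermC d c).
move: Ap Aq Ar As; rewrite !inE -!orbA.
case/or4P=> /eqP ->; case/or4P=> /eqP ->; rewrite /= ?inE ?eqxx //=;
case/or4P=> /eqP ->; rewrite ?inE ?eqxx ?orbT ?andbF //=;
case/or4P=> /eqP ->; rewrite ?inE ?eqxx ?orbT ?andbF //= => _; by rewrite ?nrm.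
Qed.

Lemma quadJ (H : {group {perm T}}) h A : h \in H -> quad H A -> quad H (h @: A).
Proof.
move=> Hh qA; have A4 := quad_card qA.
apply/andP; split; first by rewrite card_imset ?A4 //; apply: perm_inj.
apply/forall_inP=> _ /imsetP[a Aa ->]; apply/forall_inP=> _ /imsetP[b Ab ->].
apply/forall_inP=> _ /imsetP[c Ac ->]; apply/forall_inP=> _ /imsetP[d Ad ->].
apply/implyP=> u4; rewrite -!tpermJ -conjMg groupJ // (quad_mem qA) //.
by rewrite -(map_inj_uniq (@perm_inj _ h)).
Qed.

Lemma tperm_notin A a b z : a \in A -> b \in A -> z \notin A -> tperm a b z = z.
Proof. by move=> Aa Ab nAz; rewrite tpermD //; apply: contraNneq nAz => <-. Qed.

Variable H : {group {perm T}}.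

Lemma quad_move A x y : quad H A -> x \in A -> y \in A -> x != y ->
  exists2 s, s \in H & s x = y /\ forall z, z \notin A -> s z = z.
Proof.
move=> qA Ax Ay nxy; have [u [v [u4 defA]]] := card4_ext (quad_card qA) Ax Ay nxy.
have [Au Av] : u \in A /\ v \in A by rewrite defA !inE !eqxx !orbT.
exists (tperm x y * tperm u v); first exact: (quad_mem qA).
split=> [|z nAz]; last by rewrite permM !(tperm_notin (A := A)).
move: u4; rewrite /= !inE !negb_or => /and4P[_ /andP[nyu nyv] _ _].
by tperm_tac.
Qed.

Hypothesis no3 : free_of_cyc3 H.

(** An element of H moving the common point inside B fixes the other three points of A, against
    [single_meet]. *)
Lemma quad_meet1 A B : quad H A -> quad H B -> #|A :&: B| != 1%N.
Proof.
move=> qA qB; apply/negP=> /cards1P[x defx].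
have memAB z : (z \in A) && (z \in B) = (z == x) by rewrite -in_setI defx inE.
have /andP[Ax Bx] : (x \in A) && (x \in B) by rewrite memAB eqxx.
have [a /setD1P[nax Aa]] : exists a, a \in A :\ x.
  by apply/card_gt0P; have := cardsD1 x A; rewrite Ax (quad_card qA); lia.
have [p /setD1P[npx Bp]] : exists p, p \in B :\ x.
  by apply/card_gt0P; have := cardsD1 x B; rewrite Bx (quad_card qB); lia.
rewrite eq_sym in nax; rewrite eq_sym in npx.
have [b [c [uA defA]]] := card4_ext (quad_card qA) Ax Aa nax.
have [Ab Ac] : b \in A /\ c \in A by rewrite defA !inE !eqxx !orbT.
have [t Ht [tx tB]] := quad_move qB Bx Bp npx.
have Hs := quad_mem qA Ax Aa Ab Ac uA.
have nB z : z \in A -> z != x -> z \notin B by rewrite -memAB => ->.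
move: uA; rewrite /= !inE !negb_or => /and4P[/and3P[_ nxb nxc] _ _ _].
have tfix z : z \in A -> x != z -> t z = z.
  by move=> Az nxz; apply/tB/nB; rewrite // eq_sym.
have /eqP : t x = x by apply: (single_meet no3 Hs Ht); rewrite ?tfix // eq_sym.
by rewrite tx eq_sym (negPf npx).
Qed.

(** If the common points are z, u, v, and a, b are the remaining points of A and B, then (u v)(z a)
    and (u v)(z b) multiply to a 3-cycle on z, a, b. *)
Lemma quad_meet3 A B : quad H A -> quad H B -> #|A :&: B| != 3.
Proof.
move=> qA qB; apply/negP=> /eqP AB3.
have /eqP/cards1P[a defa] : #|A :\: B| = 1%N.
  by have := cardsID B A; rewrite AB3 (quad_card qA); lia.
have [b /setDP[Bb nAb]] : exists b, b \in B :\: A.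
  by apply/card_gt0P; have := cardsID A B; rewrite setIC AB3 (quad_card qB); lia.
have /setDP[Aa nBa] : a \in A :\: B by rewrite defa inE.
have [z /setIP[Az Bz]] : exists z, z \in A :&: B by apply/card_gt0P; rewrite AB3.
have naz : a != z by apply: contraNneq nBa => ->.
have [u [v [uA defA]]] := card4_ext (quad_card qA) Aa Az naz.
have [Au Av] : u \in A /\ v \in A by rewrite defA !inE !eqxx !orbT.
have inB w : w \in A -> a != w -> w \in B.
  move=> Aw naw; apply: contraT => nBw.
  have : w \in A :\: B by rewrite inE nBw.
  by rewrite defa inE eq_sym (negPf naw).
move: uA; rewrite /= !inE !negb_or => /and4P[/and3P[_ nau nav] /andP[nzu nzv] nuv _].
have [Bu Bv] := (inB u Au nau, inB v Av nav).
have nb w : w \in A -> b != w by move=> Aw; apply: contraNneq nAb => ->.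
have Hs : tperm u v * tperm z a \in H.
  apply: (quad_mem qA) => //; rewrite /= !inE !negb_or nuv.
  by rewrite 2!(eq_sym _ z) nzu nzv 3!(eq_sym _ a) nau nav naz.
have Ht : tperm u v * tperm z b \in H.
  apply: (quad_mem qB) => //; rewrite /= !inE !negb_or nuv.
  by rewrite 2!(eq_sym _ z) nzu nzv 3!(eq_sym _ b) !nb.
have := groupM (groupVr Hs) Ht; rewrite invMg !tpermV -mulgA.
rewrite (mulgA (tperm u v)) tperm2 mul1g; apply/negP/no3.
by rewrite /distinct3 (eq_sym z a) naz (eq_sym z b) (eq_sym a b) !nb.
Qed.

Lemma quad_meet_even A B : quad H A -> quad H B -> ~~ odd #|A :&: B|.
Proof.
move=> qA qB; have := quad_meet1 qA qB; have := quad_meet3 qA qB.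
have := subset_leq_card (subsetIl A B); rewrite (quad_card qA).
by case: #|_| => [|[|[|[|[|]]]]].
Qed.

Definition sdiff A B := (A :\: B) :|: (B :\: A).

Lemma in_sdiff A B z : (z \in sdiff A B) = (z \in A) (+) (z \in B).
Proof. by rewrite !inE; case: (z \in A); case: (z \in B). Qed.

(** With A = {x, y, a, b} and common points x, y, the element (x a)(y b) carries x, y to a, b and
    fixes the rest of B. Being an image of B under H, the symmetric difference is a quad. *)
Lemma quad_sdiff A B : quad H A -> quad H B -> #|A :&: B| = 2 ->
  exists2 s, s \in H & s @: B = sdiff A B.
Proof.
move=> qA qB /eqP/cards2P[x [y [nxy defI]]].
have memAB z : (z \in A) && (z \in B) = (z == x) || (z == y).
  by rewrite -in_setI defI !inE.
have /andP[Ax Bx] : (x \in A) && (x \in B) by rewrite memAB eqxx.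
have /andP[Ay By] : (y \in A) && (y \in B) by rewrite memAB eqxx orbT.
have [a [b [u4 defA]]] := card4_ext (quad_card qA) Ax Ay nxy.
have [Aa Ab] : a \in A /\ b \in A by rewrite defA !inE !eqxx !orbT.
have := u4; rewrite /= !inE !negb_or => /and4P[/and3P[_ nxa nxb] /andP[nya nyb] nab _].
have nBa : a \notin B by have := memAB a; rewrite Aa /= !(eq_sym a) (negPf nxa) (negPf nya) => ->.
have nBb : b \notin B by have := memAB b; rewrite Ab /= !(eq_sym b) (negPf nxb) (negPf nyb) => ->.
have Hs : tperm x a * tperm y b \in H.
  by apply: (quad_mem qA) => //; rewrite /= !inE !negb_or nxa nxy nxb nyb nab (eq_sym a) nya.
exists (tperm x a * tperm y b) => //; apply/setP=> z.
rewrite -preim_permV inE invMg !tpermV in_sdiff.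
case: (boolP (z \in A)) => Az; last first.
  by rewrite permM !(tperm_notin (A := A)).
move: Az; rewrite defA !inE -!orbA => /or4P[] /eqP ->; tperm_tac;
  by rewrite ?Bx ?By ?(negPf nBa) ?(negPf nBb).
Qed.

End Quads.

(** * Separating binary codes with all nonzero weights equal to 4 *)

Definition bool_comb (a b c p q r : bool) := (a && p) (+) (b && q) (+) (c && r).

Lemma bool_comb_inj a b c a' b' c' q1 q2 r1 r2 r3 r4 :
    q1 != q2 -> r3 != r4 ->
    bool_comb a b c true q1 r1 = bool_comb a' b' c' true q1 r1 ->
    bool_comb a b c true q2 r2 = bool_comb a' b' c' true q2 r2 ->
    bool_comb a b c true true r3 = bool_comb a' b' c' true true r3 ->
    bool_comb a b c true true r4 = bool_comb a' b' c' true true r4 ->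
  (a, b, c) = (a', b', c').
Proof.
move=> nq nr; have -> : q2 = ~~ q1 by case: q1 q2 nq => [] [].
have {nr nq} -> : r4 = ~~ r3 by case: r3 r4 nr => [] [].
by move: a b c a' b' c' q1 r1 r2 r3; do 10!case.
Qed.

(** Linear algebra over F_2, checked exhaustively over the seven nonzero functionals: for nonzero
    vectors v, v', v0 with v0 distinct from v and v', the only possible relations are v = v' and v +
    v' + v0 = 0, and both allow the values 1, 1, 0. *)
Lemma bool_comb_avoid p q r p' q' r' p0 q0 r0 :
    [|| p, q | r] -> [|| p', q' | r'] -> [|| p0, q0 | r0] ->
    ~~ [&& p == p0, q == q0 & r == r0] ->
    ~~ [&& p' == p0, q' == q0 & r' == r0] ->
  exists a b c, [/\ bool_comb a b c p q r, bool_comb a b c p' q' r'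
                  & ~~ bool_comb a b c p0 q0 r0].
Proof.
pose P z := [&& bool_comb z.1.1 z.1.2 z.2 p q r, bool_comb z.1.1 z.1.2 z.2 p' q' r'
                & ~~ bool_comb z.1.1 z.1.2 z.2 p0 q0 r0].
move=> h1 h2 h3 h4 h5.
suff /hasP[[[a b] c] _ /and3P[? ? ?]] : has P
    [:: (true, false, false); (false, true, false); (false, false, true);
        (true, true, false); (true, false, true); (false, true, true);
        (true, true, true)] by exists a, b, c.
by move: p q r p' q' r' p0 q0 r0 @P h1 h2 h3 h4 h5; do 9!case.
Qed.

(** The equation says (8 - d) e = 8. *)
Lemma seven_arith (e d x : nat) : 0 < e -> 8 <= e -> d <= x -> x <= 7 ->
  (4 * e.-1 * 2 = d * e)%N -> [/\ e = 8, d = 7 & x = 7].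
Proof.
move=> e0 e8 dx x7 ede; have [d7 | d7] : d = 7 \/ d <= 6 by lia.
  by rewrite d7 in ede; split; lia.
have := leq_mul d7 (leqnn e); lia.
Qed.

Section Seven.

Variables (T : finType) (X : {set T}) (E : {set {set T}}).
Hypothesis E0 : set0 \in E.
Hypothesis E4 : forall A, A \in E -> A != set0 -> #|A| = 4.
Hypothesis EX : forall A, A \in E -> A \subset X.
Hypothesis ED : forall A B, A \in E -> B \in E -> sdiff A B \in E.
Hypothesis Esep : forall x y, x \in X -> y \in X -> x != y ->
  exists2 A, A \in E & (x \in A) != (y \in A).
Hypothesis X7 : 4 < #|X| <= 7.

(** Adding [A0] exchanges the words containing x with those that do not. *)
Lemma covered_card x A0 : A0 \in E -> x \in A0 ->
  (#|[set A in E | x \in A]| * 2)%N = #|E|.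
Proof.
move=> EA0 A0x; pose P := [set A : {set T} | x \in A].
have -> : [set A in E | x \in A] = E :&: P by apply/setP=> A; rewrite !inE.
rewrite -(cardsID P E) muln2 -addnn; congr (_ + _)%N.
have sdK : involutive (sdiff A0).
  by move=> B; apply/setP=> z; rewrite !in_sdiff addbA addbb.
rewrite -(card_imset (mem (E :&: P)) (can_inj sdK)); apply: eq_card => A.
apply/imsetP/idP => [[B /setIP[EB]]|/setDP[EA]].
  rewrite inE => Bx ->; apply/setDP.
  by split; [apply: ED | rewrite inE in_sdiff A0x Bx].
rewrite inE => nAx; exists (sdiff A0 A); last by rewrite sdK.
by apply/setIP; split; [apply: ED | rewrite inE in_sdiff A0x (negPf nAx)].
Qed.

Definition comb (A B C : {set T}) (a b c : bool) : {set T} :=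
  [set x | (a && (x \in A)) (+) (b && (x \in B)) (+) (c && (x \in C))].

Lemma comb_in A B C a b c : A \in E -> B \in E -> C \in E -> comb A B C a b c \in E.
Proof.
move=> EA EB EC; pose pick (b : bool) (Y : {set T}) := if b then Y else set0.
have -> : comb A B C a b c = sdiff (sdiff (pick a A) (pick b B)) (pick c C).
  apply/setP=> x; rewrite inE !in_sdiff.
  by congr (_ (+) _ (+) _); [case: a | case: b | case: c]; rewrite ?inE.
by do 2?apply: ED; [case: a | case: b | case: c].
Qed.

(** Take a word A, a word B separating two points of A, and a word C separating two points of A :&:
    B: they are independent, so there are at least 8 words. Counting incidences, where each covered
    point lies on half of the words, [seven_arith] leaves exactly 8 words and 7 points, all covered.
    This is the simplex code, whose nonzero words are the complements of the lines of the Fano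
    plane. *)
Lemma seven_basis : [/\ #|E| = 8, #|X| = 7,
  forall x, x \in X -> exists2 A, A \in E & x \in A &
  exists A B C, [/\ A \in E, B \in E, C \in E &
    forall Y, Y \in E -> exists a b c, Y = comb A B C a b c]].
Proof.
have [A EA nA0] : exists2 A, A \in E & A != set0.
  have [x [y [Xx Xy nxy]]] : exists x y, [/\ x \in X, y \in X & x != y].
    have /card_gt1P[x [y [? ? ?]]] : 1 < #|X| by apply: leq_trans (proj1 (andP X7)).
    by exists x, y.
  have [A EA sepA] := Esep Xx Xy nxy; exists A => //.
  by apply: contraNneq sepA => ->; rewrite !inE.
have [x [y [Ax Ay nxy]]] : exists x y, [/\ x \in A, y \in A & x != y].
  have /card_gt1P[x [y [? ? ?]]] : 1 < #|A| by rewrite (E4 EA).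
  by exists x, y.
have sAX := subsetP (EX EA).
have [B EB sepB] := Esep (sAX x Ax) (sAX y Ay) nxy.
have nB0 : B != set0 by apply: contraNneq sepB => ->; rewrite !inE.
have nS0 : sdiff A B != set0.
  apply: contraNneq sepB => /setP S0.
  by have := S0 x; have := S0 y; rewrite !in_sdiff Ax Ay !inE /= => /negbFE -> /negbFE ->.
have [u [v [ABu ABv nuv]]] : exists u v, [/\ u \in A :&: B, v \in A :&: B & u != v].
  suff /card_gt1P[u [v [? ? ?]]] : 1 < #|A :&: B| by exists u, v.
  have := E4 (ED EA EB) nS0; rewrite cardsU.
  have -> : (A :\: B) :&: (B :\: A) = set0.
    by apply/setP=> z; rewrite !inE; case: (z \in A); case: (z \in B).
  rewrite cards0 subn0; have := cardsID B A; have := cardsID A B.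
  rewrite setIC (E4 EA) // (E4 EB) //.
  by move: #|A :\: B| #|B :\: A| #|A :&: B|; clear; lia.
move: ABu ABv; rewrite !inE => /andP[Au Bu] /andP[Av Bv].
have [C EC sepC] := Esep (sAX u Au) (sAX v Av) nuv.
(* The values at x, y, u and v determine the three coefficients. *)
have inj_comb : injective (fun z : bool * bool * bool => comb A B C z.1.1 z.1.2 z.2).
  move=> [[a b] c] [[a' b'] c'] /= /setP eqc.
  have := eqc u; have := eqc v; have := eqc x; have := eqc y.
  rewrite !inE Ax Ay Au Av Bu Bv => ey ex ev eu.
  by case: (bool_comb_inj sepB sepC ex ey eu ev) => -> -> ->.
pose I := [set comb A B C z.1.1 z.1.2 z.2 | z : bool * bool * bool].
have sIE : I \subset E by apply/subsetP=> _ /imsetP[z _ ->]; apply: comb_in.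
have oI : #|I| = 8 by rewrite card_imset // !card_prod !card_bool.
(* The covered points; both sides of [oE] are twice the number of incidences between points and
   words. *)
pose D := [set x in X | [exists A in E, x \in A]].
have oE : (4 * #|E|.-1 * 2 = #|D| * #|E|)%N.
  have sum1 : (\sum_(A in E) #|A| = 4 * #|E|.-1)%N.
    rewrite (bigD1 set0) //= cards0 add0n.
    rewrite (eq_bigr (fun _ => 4)) => [|Y /andP[EY nY]]; last exact: E4.
    rewrite sum_nat_const mulnC; congr (4 * _)%N; rewrite (cardsD1 set0 E) E0 /=.
    by apply: eq_card => Y; rewrite !inE andbC.
  have sum2 : (\sum_(A in E) #|A| = \sum_(z in X) #|[set A in E | z \in A]|)%N.
    under eq_bigr => Y EY.
      rewrite -sum1_card (eq_bigl (fun z => (z \in X) && (z \in Y))); first over.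
      by move=> z; rewrite andb_idl //; apply: (subsetP (EX EY)).
    rewrite (exchange_big_dep (mem X)) /=; last by move=> ? ? _ /andP[].
    apply: eq_bigr => z Xz; rewrite sum1dep_card; apply: eq_card => Y.
    by rewrite !inE Xz.
  have sum3 : ((\sum_(z in X) #|[set A in E | z \in A]|) * 2 = #|D| * #|E|)%N.
    rewrite big_distrl /= (bigID (mem D)) /= [X in (_ + X)%N]big1 ?addn0.
      rewrite -sum_nat_const; apply: eq_big => [z|z /andP[_]].
        by rewrite !inE andb_idl // => /andP[].
      by rewrite inE => /andP[_ /existsP[Y /andP[EY Yz]]]; apply: covered_card Yz.
    move=> z /andP[Xz]; rewrite inE Xz /= => nz.
    suff -> : [set A in E | z \in A] = set0 by rewrite cards0.
    apply/setP=> Y; rewrite !inE; apply: contraNF nz => EYz.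
    by apply/existsP; exists Y.
  by rewrite -sum3 -sum2 sum1.
have sDX : D \subset X by apply/subsetP=> z; rewrite inE => /andP[].
have leD := subset_leq_card sDX.
have leE := subset_leq_card sIE.
have E_gt0 : 0 < #|E| by apply/card_gt0P; exists set0.
rewrite oI in leE; have /andP[_ leX] := X7.
have [oE8 oD oX] := seven_arith E_gt0 leE leD leX oE.
split=> // [z|].
  have -> : X = D by apply/eqP; rewrite eq_sym eqEcard sDX oX oD.
  by rewrite inE => /andP[_ /existsP[Y /andP[]]]; exists Y.
exists A, B, C; split=> // Y; have -> : E = I.
  by apply/eqP; rewrite eq_sym eqEcard sIE oE8 oI.
by case/imsetP=> [[[a b] c] _ ->]; exists a, b, c.
Qed.

(** Membership in A, B, C turns the points of [X] into distinct nonzero vectors of F_2^3 and the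
    words into functionals, so [bool_comb_avoid] applies. *)
Lemma seven_avoid x y w : x \in X -> y \in X -> w \in X -> x != w -> y != w ->
  exists2 A, A \in E & [/\ x \in A, y \in A & w \notin A].
Proof.
move=> Xx Xy Xw nxw nyw.
have [_ _ cov [A [B [C [EA EB EC genE]]]]] := seven_basis.
have nz z : z \in X -> [|| z \in A, z \in B | z \in C].
  move=> Xz; have [Y EY] := cov z Xz; have [a [b [c ->]]] := genE Y EY.
  by rewrite inE; case: a; case: b; case: c; case: (z \in A); case: (z \in B).
have sepP z t : z \in X -> t \in X -> z != t ->
    ~~ [&& (z \in A) == (t \in A), (z \in B) == (t \in B) & (z \in C) == (t \in C)].
  move=> Xz Xt nzt; apply/negP=> /and3P[/eqP eA /eqP eB /eqP eC].
  have [Y EY] := Esep Xz Xt nzt; have [a [b [c ->]]] := genE Y EY.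
  by rewrite !inE eA eB eC eqxx.
have [a [b [c [ax ay aw]]]] := bool_comb_avoid (nz x Xx) (nz y Xy) (nz w Xw)
  (sepP x w Xx Xw nxw) (sepP y w Xy Xw nyw).
by exists (comb A B C a b c); [apply: comb_in | rewrite !inE].
Qed.

(** K is 2-transitive on the seven points of [X], whence the divisor 7 * 6: the Klein group on a
    word containing x and y but not w takes x to y and fixes w. *)
Lemma seven_dvd (K : {group {perm T}}) :
    (forall A, A \in E -> A != set0 -> quad K A) ->
    (forall s x, s \in K -> x \in X -> s x \in X) ->
  42 %| #|K|.
Proof.
move=> qK actK; have [_ oX _ _] := seven_basis.
have moveK x y w : x \in X -> y \in X -> w \in X -> x != w -> y != w -> x != y ->
    exists2 s, s \in K & s x = y /\ s w = w.
  move=> Xx Xy Xw nxw nyw nxy; have [A EA [Ax Ay nAw]] := seven_avoid Xx Xy Xw nxw nyw.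
  have qA : quad K A by apply: qK => //; apply: contraTneq Ax => ->; rewrite inE.
  by have [s Ks [sx sA]] := quad_move qA Ax Ay nxy; exists s => //; split=> //; apply: sA.
have [x Xx] : exists x, x \in X by apply/card_gt0P; rewrite oX.
have orbx : orbit 'P K x = X.
  apply/eqP; rewrite eqEsubset; apply/andP; split.
    by apply/subsetP=> _ /orbitP[s Ks <-]; apply: actK.
  apply/subsetP=> y Xy; have [<-|nxy] := eqVneq x y; first exact: orbit_refl.
  have [w Xw] : exists w, w \in X :\ x :\ y.
    apply/card_gt0P; have := cardsD1 x X; have := cardsD1 y (X :\ x).
    by rewrite oX; case: (_ \in _); case: (_ \in _); lia.
  move: Xw; rewrite !inE => /and3P[nwy nwx Xw].
  have [||s Ks [sx _]] := moveK x y w Xx Xy Xw _ _ nxy; rewrite 1?eq_sym //.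
  by apply/orbitP; exists s.
pose K1 := 'C_K[x | 'P]%G.
have [y Xy] : exists y, y \in X :\ x.
  by apply/card_gt0P; have := cardsD1 x X; rewrite oX; case: (_ \in _); lia.
have orby : orbit 'P K1 y = X :\ x.
  move: Xy; rewrite !inE => /andP[nyx Xy].
  apply/eqP; rewrite eqEsubset; apply/andP; split.
    apply/subsetP=> _ /orbitP[s /setIP[Ks /astab1P /= sx] <-] /=.
    have sx' : s x = x by [].
    apply/setD1P; split; last exact: actK.
    by rewrite /aperm -[X in _ != X]sx' (inj_eq perm_inj).
  apply/subsetP=> z; rewrite !inE => /andP[nzx Xz].
  have [<-|nyz] := eqVneq y z; first exact: orbit_refl.
  have [s Ks [sy sx]] := moveK y z x Xy Xz Xx nyx nzx nyz.
  apply/orbitP; exists s => //; apply/setIP; split=> //.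
  by apply/astab1P.
have oK := card_orbit_stab 'P K x.
have oK1 := card_orbit_stab 'P K1 y.
rewrite orbx oX in oK; rewrite orby in oK1.
have oX6 : #|X :\ x| = 6 by have := cardsD1 x X; rewrite oX Xx; lia.
rewrite oX6 in oK1; rewrite -oK -/K1 -oK1 mulnA.
exact: dvdn_mulr.
Qed.

End Seven.

Lemma uniq4P (T : eqType) (a b c d : T) : uniq [:: a; b; c; d] ->
  [/\ [/\ a != b, a != c & a != d], b != c, b != d & c != d].
Proof.
by rewrite /= !inE !negb_or andbT => /and3P[/and3P[-> -> ->] /andP[-> ->] ->].
Qed.

(** * Existence of quads *)

Section Klein.

Variable T : finType.
Implicit Types (a b c d : T).

Definition klein a b c d : {set {perm T}} :=
  [set tperm a b * tperm c d; tperm a c * tperm b d].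

Lemma kleinP a b c d s : uniq [:: a; b; c; d] -> s \in klein a b c d ->
  [/\ s ^+ 2 = 1, s \in 'Alt_T & perm_on [set a; b; c; d] s].
Proof.
move=> u4; have [[nab nac nad] nbc nbd ncd] := uniq4P u4.
have tsq p q r t : p != r -> p != t -> q != r -> q != t ->
    (tperm p q * tperm r t) ^+ 2 = 1.
  move=> npr npt nqr nqt; rewrite expgMn ?expg2 ?tperm2 ?mulg1 //.
  apply: (@perm_onC _ [set p; q] [set r; t]); try exact: tperm_on.
  rewrite disjoint_subset; apply/subsetP=> z; rewrite !inE negb_or.
  by case/orP=> /eqP ->; apply/andP.
have ton p q : p \in [set a; b; c; d] -> q \in [set a; b; c; d] ->
    perm_on [set a; b; c; d] (tperm p q).
  move=> Ap Aq; apply: subset_trans (tperm_on p q) _.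
  by apply/subsetP=> z; case/set2P=> ->.
case/set2P=> ->; split.
- by apply: tsq.
- by rewrite Alt_even odd_permM !odd_tperm nab ncd.
- by apply: perm_onM; apply: ton; rewrite !inE eqxx ?orbT.
- by apply: tsq => //; rewrite eq_sym.
- by rewrite Alt_even odd_permM !odd_tperm nac nbd.
by apply: perm_onM; apply: ton; rewrite !inE eqxx ?orbT.
Qed.

Lemma klein_commute a b c d s t : uniq [:: a; b; c; d] ->
  s \in klein a b c d -> t \in klein a b c d -> commute s t.
Proof.
move=> u4; have [[nab nac nad] nbc nbd ncd] := uniq4P u4.
have c12 : commute (tperm a b * tperm c d) (tperm a c * tperm b d).
  apply/permP=> z.
  have [-> | nza] := eqVneq z a; first by tperm_tac.
  have [-> | nzb] := eqVneq z b; first by tperm_tac.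
  have [-> | nzc] := eqVneq z c; first by tperm_tac.
  have [-> | nzd] := eqVneq z d; first by tperm_tac.
  by tperm_tac.
by case/set2P=> ->; case/set2P=> -> //; apply: commute_sym.
Qed.

Lemma klein_quad (H : {group {perm T}}) a b c d s : uniq [:: a; b; c; d] ->
  klein a b c d :^ s \subset H -> quad H (s @: [set a; b; c; d]).
Proof.
move=> u4 /subsetP sH.
have -> : s @: [set a; b; c; d] = [set s a; s b; s c; s d].
  by rewrite !imsetU !imset_set1.
apply: quad_intro; first by rewrite -(map_inj_uniq (@perm_inj _ s)) in u4.
  by rewrite -!tpermJ -conjMg; apply: sH; rewrite memJ_conjg !inE eqxx.
by rewrite -!tpermJ -conjMg; apply: sH; rewrite memJ_conjg !inE eqxx orbT.
Qed.

Variable H : {group {perm T}}.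
Hypotheses (sHA : H \subset 'Alt_T) (oddH : odd #|'Alt_T : H|).

(** The Klein group on any four points is an even 2-group, so it has a conjugate in H. *)
Lemma ex_quad : 3 < #|T| -> exists A, quad H A.
Proof.
case/card_geqP=> q []; case: q => [|a [|b [|c [|d [|? ?]]]]] // u4 _ _.
have pK : 2.-group <<klein a b c d>>.
  apply: gen_involutions_2group => [s Ks|s t]; last exact: klein_commute.
  by case: (kleinP u4 Ks).
have sKA : <<klein a b c d>> \subset 'Alt_T.
  by rewrite gen_subG; apply/subsetP=> s /(kleinP u4)[].
have [s _] := odd_index_conj sHA oddH sKA pK.
rewrite -genJ gen_subG => /(klein_quad u4) qA.
by exists (s @: [set a; b; c; d]).
Qed.

(** Klein groups on disjoint 4-sets commute, so together they generate a 2-group and a single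
    conjugation brings both into H. *)
Lemma ex_quad2 : 7 < #|T| ->
  exists A B, [/\ quad H A, quad H B & [disjoint A & B]].
Proof.
case/card_geqP=> q [].
case: q => [|a [|b [|c [|d [|a' [|b' [|c' [|d' [|? ?]]]]]]]]] // u8 _ _.
have : uniq ([:: a; b; c; d] ++ [:: a'; b'; c'; d']) by [].
rewrite cat_uniq => /and3P[u4 dis u4'].
pose A := [set a; b; c; d]; pose B := [set a'; b'; c'; d'].
have disAB : [disjoint A & B].
  rewrite disjoint_subset; apply/subsetP=> z Az; rewrite inE.
  apply: contra dis => Bz; apply/hasP; exists z.
    by move: Bz; rewrite !inE -!orbA.
  by move: Az; rewrite !inE -!orbA.
pose S := klein a b c d :|: klein a' b' c' d'.
have pK : 2.-group <<S>>.
  apply: gen_involutions_2group => [s|s t].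
    by case/setUP=> [/(kleinP u4)[]|/(kleinP u4')[]].
  case/setUP=> Ks; case/setUP=> Kt.
  - exact: klein_commute Ks Kt.
  - have [_ _ on_s] := kleinP u4 Ks; have [_ _ on_t] := kleinP u4' Kt.
    exact: perm_onC on_s on_t disAB.
  - have [_ _ on_s] := kleinP u4' Ks; have [_ _ on_t] := kleinP u4 Kt.
    by apply: commute_sym; apply: perm_onC on_t on_s disAB.
  exact: klein_commute Ks Kt.
have sKA : <<S>> \subset 'Alt_T.
  rewrite gen_subG; apply/subsetP=> s.
  by case/setUP=> [/(kleinP u4)[]|/(kleinP u4')[]].
have [s _] := odd_index_conj sHA oddH sKA pK.
rewrite -genJ gen_subG conjUg subUset => /andP[/(klein_quad u4) qA /(klein_quad u4') qB].
exists (s @: A), (s @: B); split=> //.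
rewrite -setI_eq0 -imsetI ?(disjoint_setI0 disAB) ?imset0 // => x y _ _.
exact: perm_inj.
Qed.

End Klein.

(** * No 3-cycles, at most seven points *)

Section AtMostSeven.

Variables (T : finType) (H : {group {perm T}}).
Hypotheses (sHA : H \subset 'Alt_T) (oddH : odd #|'Alt_T : H|).
Hypotheses (no3 : free_of_cyc3 H) (T7 : 4 < #|T| <= 7).

Let d x : {set {set T}} := [set A | quad H A & x \in A].

Definition quad_family := set0 |: [set A | quad H A].

Lemma quad_familyP A : reflect (A = set0 \/ quad H A) (A \in quad_family).
Proof. by rewrite !inE; apply: (iffP orP) => [] [/eqP|]; [left|right|left|right]. Qed.

Lemma quad_family0 : set0 \in quad_family.
Proof. by apply/quad_familyP; left. Qed.

Lemma quad_family4 A : A \in quad_family -> A != set0 -> #|A| = 4.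
Proof. by case/quad_familyP => [->|/quad_card //]; rewrite eqxx. Qed.

Lemma quad_familyX A : A \in quad_family -> A \subset setT.
Proof. by rewrite subsetT. Qed.

(** Two distinct quads among at most 7 points must meet, and they meet evenly, hence in exactly two
    points, so [quad_sdiff] applies. *)
Lemma quad_familyD A B : A \in quad_family -> B \in quad_family ->
  sdiff A B \in quad_family.
Proof.
have sd0 C : sdiff set0 C = C by apply/setP=> z; rewrite in_sdiff inE.
have sdC C D : sdiff C D = sdiff D C by apply/setP=> z; rewrite !in_sdiff addbC.
move=> EA EB; case: (quad_familyP A EA) => [->|qA]; first by rewrite sd0.
case: (quad_familyP B EB) => [->|qB]; first by rewrite sdC sd0.
have [->|nAB] := eqVneq A B.
  suff -> : sdiff B B = set0 by apply: quad_family0.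
  by apply/setP=> z; rewrite in_sdiff addbb inE.
have [A4 B4] := (quad_card qA, quad_card qB).
have : #|A :&: B| = 2.
  have ev := quad_meet_even no3 qA qB.
  have gt0 : 0 < #|A :&: B|.
    have := cardsUI A B; have := subset_leq_card (subsetT (A :|: B)); have /andP[_] := T7.
    by rewrite cardsT A4 B4; clear; lia.
  have lt4 : #|A :&: B| < 4.
    rewrite -A4; apply: proper_card; apply/properP; split; first exact: subsetIl.
    have /subsetPn[z Az nBz] : ~~ (A \subset B).
      by apply: contra nAB => sAB; rewrite eqEcard sAB A4 B4.
    by exists z; rewrite // inE Az (negPf nBz).
  by move: ev gt0 lt4; case: #|_| => [|[|[|[|]]]].
move/(quad_sdiff qA qB) => [s Hs <-].
by apply/quad_familyP; right; apply: quadJ.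
Qed.

Let dE x y : reflect (forall A, quad H A -> (x \in A) = (y \in A)) (d x == d y).
Proof.
apply: (iffP eqP) => [/setP dxy A qA | dxy]; first by have := dxy A; rewrite !inE qA.
by apply/setP=> A; rewrite !inE; case: (boolP (quad H A)) => //= /dxy.
Qed.

Let d_stab : H \subset block_stab d.
Proof.
have sub h x y : h \in H -> d x == d y -> d (h x) == d (h y).
  move=> Hh /dE dxy; apply/dE=> A qA.
  have := dxy _ (quadJ (groupVr Hh) qA).
  by rewrite im_permV !inE.
apply/subsetP=> h Hh; apply/block_stabP=> x y; apply/idP/idP=> [r|]; last exact: sub.
by have := sub _ _ _ (groupVr Hh) r; rewrite !permK.
Qed.

(** A class lies inside a given quad or inside its complement, which has at most 3 points. *)
Let d_le4 z : #|[set u | d u == d z]| <= 4.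
Proof.
have [A qA] : exists A, quad H A.
  by apply: ex_quad => //; case/andP: T7 => /ltnW.
have A4 := quad_card qA.
have [Az | nAz] := boolP (z \in A).
  rewrite -A4; apply/subset_leq_card/subsetP=> u; rewrite inE => /dE -> //.
apply: leq_trans (_ : #|~: A| <= 4).
  by apply/subset_leq_card/subsetP=> u; rewrite !inE => /dE ->.
by rewrite cardsCs setCK A4 leq_subLR; case/andP: T7 => _ /leq_trans; apply.
Qed.

Lemma blocks_or_separated :
  (exists x y, [/\ x != y & d x = d y]) \/
  (forall x y, x \in setT -> y \in setT -> x != y ->
     exists2 A, A \in quad_family & (x \in A) != (y \in A)).
Proof.
case: (pickP [pred z : T * T | (z.1 != z.2) && (d z.1 == d z.2)]).
  by case=> x y /= /andP[nxy /eqP dxy]; left; exists x, y.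
move=> inj_d; right=> x y _ _ nxy; have /= := inj_d (x, y); rewrite nxy /= => dxy.
have [A /andP[qA nA]] : exists A, quad H A && ((x \in A) != (y \in A)).
  apply/existsP; apply: contraFT dxy; rewrite negb_exists => /forallP dA.
  by apply/dE=> A qA; have := dA A; rewrite qA negbK => /eqP.
by exists A => //; apply/quad_familyP; right.
Qed.

Lemma alt_factors_or_separated : alt_factors H \/
  (forall x y, x \in setT -> y \in setT -> x != y ->
     exists2 A, A \in quad_family & (x \in A) != (y \in A)).
Proof.
case: blocks_or_separated => [[x [y [nxy dxy]]]|]; [left | by right].
exact: alt_factors_small_blocks sHA oddH d_stab nxy dxy d_le4.
Qed.

Lemma sol_le6_free : #|T| <= 6 -> solvable H.
Proof.
move=> T6; case: blocks_or_separated => [[x [y [nxy dxy]]]|sep].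
  exact: sol_Alt_blocks sHA oddH d_stab nxy dxy T6 d_le4.
have X7 : 4 < #|[set: T]| <= 7 by rewrite cardsT.
have [_ oX _ _] := seven_basis quad_family0 quad_family4 quad_familyX quad_familyD sep X7.
by rewrite cardsT in oX; rewrite oX in T6.
Qed.

End AtMostSeven.

(** * No 3-cycles, eight or nine points *)

Section EightNine.

Variables (T : finType) (H : {group {perm T}}).
Hypotheses (sHA : H \subset 'Alt_T) (oddH : odd #|'Alt_T : H|).
Hypotheses (no3 : free_of_cyc3 H) (T9 : #|T| <= 9).
Variables (A0 B0 : {set T}).
Hypotheses (qA0 : quad H A0) (qB0 : quad H B0) (dis0 : [disjoint A0 & B0]).

Let X := A0 :|: B0.

Lemma card_disjoint_quads C D : quad H C -> quad H D -> [disjoint C & D] ->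
  #|C :|: D| = 8.
Proof.
move=> qC qD dis; rewrite cardsU (quad_card qC) (quad_card qD).
by rewrite (disjoint_setI0 dis) cards0.
Qed.

(** At most one point lies outside the union of C and D, so a quad reaching outside would meet this
    union in three points, whereas it meets both C and D evenly. *)
Lemma disjoint_quads_union C D : quad H C -> quad H D -> [disjoint C & D] ->
  C :|: D = X.
Proof.
move=> qC qD dis; apply/eqP; rewrite eq_sym eqEcard !card_disjoint_quads // andbT.
apply: contraT => /subsetPn[q Xq nq].
have [Q qQ Qq] : exists2 Q, quad H Q & q \in Q.
  by case/setUP: Xq => ?; [exists A0 | exists B0].
have out1 : #|~: (C :|: D)| <= 1.
  by rewrite cardsCs setCK card_disjoint_quads // leq_subLR.
have Q1 : #|Q :\: (C :|: D)| = 1%N.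
  apply/eqP; rewrite eqn_leq; apply/andP; split.
    apply: leq_trans out1; apply/subset_leq_card/subsetP=> z.
    by rewrite in_setD in_setC => /andP[].
  by apply/card_gt0P; exists q; rewrite in_setD nq.
have := cardsID (C :|: D) Q; rewrite Q1 (quad_card qQ) setIUr cardsU.
have -> : Q :&: C :&: (Q :&: D) = set0.
  by rewrite setIACA (disjoint_setI0 dis) setI0.
have := quad_meet_even no3 qQ qC; have := quad_meet_even no3 qQ qD.
rewrite cards0 subn0; clear; lia.
Qed.

Lemma eight_stable h : h \in H -> h @: X = X.
Proof.
move=> Hh; rewrite imsetU; apply: disjoint_quads_union; try exact: quadJ.
rewrite -setI_eq0 -imsetI ?(disjoint_setI0 dis0) ?imset0 // => x y _ _.
exact: perm_inj.
Qed.

Lemma eight_stable_mem h x : h \in H -> (h x \in X) = (x \in X).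
Proof. by move=> Hh; rewrite -{1}(eight_stable Hh) mem_imset //; apply: perm_inj. Qed.

Lemma card_eight : #|X| = 8.
Proof. exact: card_disjoint_quads. Qed.

(** Requiring the complement too makes the family closed under complements in [X]: a word through a
    base point can be traded for one avoiding it. *)
Definition biquad A := quad H A && quad H (X :\: A).

Lemma biquad_sub A : biquad A -> A \subset X.
Proof.
case/andP=> qA qA'; have := cardsID A X; rewrite (quad_card qA') card_eight => XA.
suff /eqP <- : X :&: A == A by apply: subsetIl.
by rewrite eqEcard subsetIr (quad_card qA); move: XA; clear; lia.
Qed.

Lemma biquadC A : biquad A -> biquad (X :\: A).
Proof.
move=> bA; have /andP[qA qA'] := bA; rewrite /biquad qA' /=.
by rewrite setDDr setDv set0U; move/biquad_sub/setIidPr: bA => ->.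
Qed.

Lemma biquad0 : biquad A0.
Proof.
rewrite /biquad qA0 setDUl setDv set0U.
by have /setDidPl -> : [disjoint B0 & A0] by rewrite disjoint_sym.
Qed.

Lemma biquadJ h A : h \in H -> biquad A -> biquad (h @: A).
Proof.
move=> Hh /andP[qA qA']; rewrite /biquad quadJ //=.
suff -> : X :\: h @: A = h @: (X :\: A) by apply: quadJ.
apply/setP=> z; rewrite -(permKV h z) in_setD !(mem_imset _ _ (@perm_inj _ h)).
by rewrite in_setD eight_stable_mem.
Qed.

Let d x : {set {set T}} := [set A | biquad A & x \in A].

Let dE x y : reflect (forall A, biquad A -> (x \in A) = (y \in A)) (d x == d y).
Proof.
apply: (iffP eqP) => [/setP dxy A qA | dxy]; first by have := dxy A; rewrite !inE qA.
by apply/setP=> A; rewrite !inE; case: (boolP (biquad A)) => //= /dxy.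
Qed.

Let d_stab : H \subset block_stab d.
Proof.
have sub h x y : h \in H -> d x == d y -> d (h x) == d (h y).
  move=> Hh /dE dxy; apply/dE=> A qA.
  have := dxy _ (biquadJ (groupVr Hh) qA).
  by rewrite im_permV !inE.
apply/subsetP=> h Hh; apply/block_stabP=> x y; apply/idP/idP=> [r|]; last exact: sub.
by have := sub _ _ _ (groupVr Hh) r; rewrite !permK.
Qed.

Let d_le4 z : #|[set u | d u == d z]| <= 4.
Proof.
have bA := biquad0; have bB := biquadC bA.
have [Az | nAz] := boolP (z \in A0).
  rewrite -(quad_card qA0); apply/subset_leq_card/subsetP=> u.
  by rewrite inE => /dE ->.
have [Bz | nBz] := boolP (z \in X :\: A0).
  have /andP[qB _] := bB; rewrite -(quad_card qB).
  by apply/subset_leq_card/subsetP=> u; rewrite inE => /dE ->.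
apply: leq_trans (_ : #|~: X| <= 4); last first.
  by rewrite cardsCs setCK card_eight leq_subLR (leq_trans T9).
apply/subset_leq_card/subsetP=> u; rewrite inE => /dE du.
rewrite inE; apply/negP=> Xu; move: (du _ bA) (du _ bB).
by rewrite (negPf nAz) (negPf nBz) in_setD Xu andbT => ->.
Qed.

Lemma alt_factors_or_biquad_separated : alt_factors H \/
  (forall x y, x != y -> exists2 A, biquad A & (x \in A) != (y \in A)).
Proof.
case: (pickP [pred z : T * T | (z.1 != z.2) && (d z.1 == d z.2)]).
  case=> x y /= /andP[nxy /eqP dxy]; left.
  exact: alt_factors_small_blocks sHA oddH d_stab nxy dxy d_le4.
move=> inj_d; right=> x y nxy; have /= := inj_d (x, y); rewrite nxy /= => dxy.
have [A /andP[qA nA]] : exists A, biquad A && ((x \in A) != (y \in A)).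
  apply/existsP; apply: contraFT dxy; rewrite negb_exists => /forallP dA.
  by apply/dE=> A qA; have := dA A; rewrite qA negbK => /eqP.
by exists A.
Qed.

Hypothesis sep : forall x y, x != y -> exists2 A, biquad A & (x \in A) != (y \in A).

Section Pointed.

Variable p : T.
Hypothesis Xp : p \in X.

(** Taking [p] as origin leaves a code on the seven other points of [X], to which [seven_basis]
    applies. *)
Definition pointed_family := set0 |: [set A | biquad A & p \notin A].

Lemma pointed_familyP A :
  reflect (A = set0 \/ biquad A /\ p \notin A) (A \in pointed_family).
Proof.
rewrite !inE; apply: (iffP orP) => [[/eqP|/andP]|[->|/andP]]; by [left|right].
Qed.

Lemma pointed_family0 : set0 \in pointed_family.
Proof. by apply/pointed_familyP; left. Qed.

Lemma pointed_family4 A : A \in pointed_family -> A != set0 -> #|A| = 4.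
Proof.
case/pointed_familyP => [->|[/andP[/quad_card //]]]; by rewrite eqxx.
Qed.

Lemma pointed_familyX A : A \in pointed_family -> A \subset X :\ p.
Proof.
case/pointed_familyP => [->|[bA nAp]]; first exact: sub0set.
by rewrite subsetD1 biquad_sub.
Qed.

Lemma card_pointed : #|X :\ p| = 7.
Proof. by have := cardsD1 p X; rewrite Xp card_eight; clear; lia. Qed.

Lemma pointed_familyD A B : A \in pointed_family -> B \in pointed_family ->
  sdiff A B \in pointed_family.
Proof.
have sd0 (C : {set T}) : sdiff set0 C = C by apply/setP=> z; rewrite in_sdiff inE.
have sdC (C D : {set T}) : sdiff C D = sdiff D C.
  by apply/setP=> z; rewrite !in_sdiff addbC.
move=> EA EB; have [sA sB] := (pointed_familyX EA, pointed_familyX EB).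
case: (pointed_familyP A EA) => [->|[bA nAp]]; first by rewrite sd0.
case: (pointed_familyP B EB) => [->|[bB nBp]]; first by rewrite sdC sd0.
have [->|nAB] := eqVneq A B.
  suff -> : sdiff B B = set0 by apply: pointed_family0.
  by apply/setP=> z; rewrite in_sdiff addbb inE.
have [/andP[qA _] /andP[qB _]] := (bA, bB).
have [A4 B4] := (quad_card qA, quad_card qB).
have : #|A :&: B| = 2.
  have ev := quad_meet_even no3 qA qB.
  have gt0 : 0 < #|A :&: B|.
    have sAB : A :|: B \subset X :\ p by rewrite subUset sA.
    have := cardsUI A B; have := subset_leq_card sAB.
    by rewrite card_pointed A4 B4; clear; lia.
  have lt4 : #|A :&: B| < 4.
    rewrite -A4; apply: proper_card; apply/properP; split; first exact: subsetIl.
    have /subsetPn[z Az nBz] : ~~ (A \subset B).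
      by apply: contra nAB => sAB; rewrite eqEcard sAB A4 B4.
    by exists z; rewrite // inE Az (negPf nBz).
  by move: ev gt0 lt4; case: #|_| => [|[|[|[|]]]].
case/(quad_sdiff qA qB) => s Hs defs.
apply/pointed_familyP; right; split; last by rewrite in_sdiff (negPf nAp) (negPf nBp).
by rewrite -defs biquadJ.
Qed.

Lemma pointed_sep x y : x \in X :\ p -> y \in X :\ p -> x != y ->
  exists2 A, A \in pointed_family & (x \in A) != (y \in A).
Proof.
case/setD1P=> nxp Xx /setD1P[nyp Xy] /sep[A bA sepA].
have [Ap | nAp] := boolP (p \in A).
  exists (X :\: A); last by rewrite !in_setD Xx Xy !andbT; case: (_ \in _) (_ \in _) sepA => [] [].
  by apply/pointed_familyP; right; rewrite biquadC // in_setD Ap.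
by exists A => //; apply/pointed_familyP; right.
Qed.

Lemma pointed_card : 4 < #|X :\ p| <= 7.
Proof. by rewrite card_pointed. Qed.

Lemma pointed_stab_dvd : 42 %| #|'C_H[p | 'P]|.
Proof.
apply: (seven_dvd pointed_family0 pointed_family4 pointed_familyX
                  pointed_familyD pointed_sep pointed_card).
  move=> A /pointed_familyP[-> | [/andP[qA _] nAp] _]; first by rewrite eqxx.
  apply/andP; split; first by case/andP: qA.
  apply/forall_inP=> a Aa; apply/forall_inP=> b Ab.
  apply/forall_inP=> c Ac; apply/forall_inP=> e Ae; apply/implyP=> u4.
  apply/setIP; split; first exact: (quad_mem qA).
  by apply/astab1P; rewrite /= /aperm permM !(tperm_notin (A := A)).
move=> s x /setIP[Hs /astab1P sp] /setD1P[nxp Xx]; apply/setD1P.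
rewrite eight_stable_mem //; split=> //.
have sp' : s p = p by [].
by rewrite -[X in _ != X]sp' (inj_eq perm_inj).
Qed.

End Pointed.

(** H is transitive on the 8 points of [X], and point stabilizers have order divisible by 42. For
    transitivity, two points are joined by a quad found in the code based at a third point q. *)
Lemma eight_dvd : 336 %| #|H|.
Proof.
have [p Xp] : exists p, p \in X by apply/card_gt0P; rewrite card_eight.
have := card_orbit_stab 'P H p; have -> : orbit 'P H p = X.
  apply/eqP; rewrite eqEsubset; apply/andP; split.
    by apply/subsetP=> _ /orbitP[s Hs <-]; rewrite /= /aperm eight_stable_mem.
  apply/subsetP=> y Xy; have [<-|npy] := eqVneq p y; first exact: orbit_refl.
  have [q Xq [nqp nqy]] : exists2 q, q \in X & q != p /\ q != y.
    have [q] : exists q, q \in X :\ p :\ y.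
      apply/card_gt0P; have := cardsD1 p X; have := cardsD1 y (X :\ p).
      by rewrite card_eight; case: (_ \in _); case: (_ \in _); clear; lia.
    by rewrite !in_setD1 => /and3P[nqy nqp Xq]; exists q.
  have [w Xw [nwp nwy]] : exists2 w, w \in X :\ q & w != p /\ w != y.
    have [w] : exists w, w \in X :\ q :\ p :\ y.
      apply/card_gt0P; have := cardsD1 q X; have := cardsD1 p (X :\ q).
      have := cardsD1 y (X :\ q :\ p).
      by rewrite card_eight; case: (_ \in _); case: (_ \in _); case: (_ \in _); clear; lia.
    by rewrite in_setD1 in_setD1 => /and3P[nwy nwp Xw]; exists w.
  have [Xqp Xqy] : p \in X :\ q /\ y \in X :\ q.
    by rewrite !in_setD1 Xp Xy !andbT !(eq_sym _ q).
  rewrite eq_sym in nwp; rewrite eq_sym in nwy.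
  have [A EA [Ap Ay nAw]] := seven_avoid (pointed_family0 q)
    (@pointed_family4 q) (@pointed_familyX q) (@pointed_familyD q Xq)
    (@pointed_sep q) (pointed_card Xq) Xqp Xqy Xw nwp nwy.
  have [A_0 | [/andP[qA _] _]] := pointed_familyP q A EA.
    by rewrite A_0 inE in Ap.
  have [s Hs [sp _]] := quad_move qA Ap Ay npy.
  by apply/orbitP; exists s.
rewrite card_eight => <-; rewrite (_ : 336 = 8 * 42)%N //.
by rewrite dvdn_pmul2l // pointed_stab_dvd.
Qed.

End EightNine.

(** * Recognition of GL(3,2) and AGL(3,2) *)

Section AffineModel.

Import GRing.Theory.

Lemma card_GL32 : #|'GL_3(2)| = 168.
Proof.
rewrite (card_GL _ (isT : 0 < 3)) (card_Fp (isT : prime 2)).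
by do 2!rewrite big_ltn //; rewrite big_nat1.
Qed.

Lemma affine_inj (g : {'GL_3(2)}) (v : 'rV['F_2]_3) :
  injective (fun u : 'rV['F_2]_3 => u *m (g : 'M_3) + v)%R.
Proof. by move=> u w /addIr/(can_inj (mulmxK (GL_unitmx g))). Qed.

Definition affine_perm (z : {'GL_3(2)} * 'rV['F_2]_3) : {perm 'rV['F_2]_3} :=
  perm (@affine_inj z.1 z.2).

(** An upper bound is enough: the embedded group H, of order divisible by 1344, forces equality. *)
Lemma card_AGL32 : #|AGL 3 'F_2| <= 1344.
Proof.
have : AGL 3 'F_2 \subset [set affine_perm z | z in setX 'GL_3(2) setT].
  apply/subsetP=> s /AGLP[M [v [uM sE]]].
  apply/imsetP; exists ((FinRing.Unit (uM : M \is a GRing.unit) : {'GL_3(2)}), v).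
    by rewrite !inE.
  by apply/permP=> u; rewrite permE sE.
move/subset_leq_card/leq_trans; apply; apply: leq_trans (leq_imset_card _ _) _.
by rewrite cardsX card_GL32 cardsT card_mx card_Fp.
Qed.

Definition linear_perm (g : {'GL_3(2)}) : {perm 'rV['F_2]_3} := affine_perm (g, 0%R).

Lemma linear_permE g u : linear_perm g u = (u *m (g : 'M_3))%R.
Proof. by rewrite permE /= addr0. Qed.

Lemma linear_permM : {in 'GL_3(2) &, {morph linear_perm : g h / g * h}}.
Proof.
by move=> g h _ _; apply/permP=> u; rewrite permM !linear_permE mulmxA.
Qed.

Canonical linear_morphism := Morphism linear_permM.

Lemma injm_linear_perm : 'injm linear_perm.
Proof.
apply/injmP=> g h _ _ egh; apply/val_inj/row_matrixP => i /=.
by rewrite !rowE -!linear_permE egh.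
Qed.

Lemma addb_F2 (b1 b2 : bool) : ((b1 (+) b2)%:R = b1%:R + b2%:R :> 'F_2)%R.
Proof. by case: b1; case: b2; apply/val_inj. Qed.

Lemma andb_F2 (b1 b2 : bool) : ((b1 && b2)%:R = b2%:R * b1%:R :> 'F_2)%R.
Proof. by case: b1; case: b2; apply/val_inj. Qed.

Lemma bool_F2_inj : injective (fun b : bool => (b%:R : 'F_2)%R).
Proof. by case; case. Qed.

Variables (T : finType) (X A B C : {set T}) (H : {group {perm T}}).
Hypothesis X8 : #|X| = 8.
Hypothesis sepX : forall x y, x \in X -> y \in X -> (x \in A) = (y \in A) ->
  (x \in B) = (y \in B) -> (x \in C) = (y \in C) -> x = y.
Hypothesis HX : forall h x, h \in H -> (h x \in X) = (x \in X).
Hypothesis Hout : forall h x, h \in H -> x \notin X -> h x = x.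
Hypothesis Haff : forall h D, h \in H -> D \in [:: A; B; C] -> exists a b c e,
  forall x, x \in X ->
    (h x \in D) = bool_comb a b c (x \in A) (x \in B) (x \in C) (+) e.

Let Ds (i : 'I_3) : {set T} := tnth [tuple A; B; C] i.

Definition coord (x : T) : 'rV['F_2]_3 := \row_i (x \in Ds i)%:R%R.

Lemma coord_inj : {in X &, injective coord}.
Proof.
move=> x y Xx Xy /rowP exy.
have eD i : (x \in Ds i) = (y \in Ds i).
  by apply: bool_F2_inj; have := exy i; rewrite !mxE.
apply: sepX => //; first exact: (eD (@Ordinal 3 0 isT)).
  exact: (eD (@Ordinal 3 1 isT)).
exact: (eD (@Ordinal 3 2 isT)).
Qed.

Lemma coord_onto u : exists2 x, x \in X & coord x = u.
Proof.
have imX : coord @: X = setT.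
  apply/eqP; rewrite eqEcard subsetT cardsT card_in_imset ?X8; last exact: coord_inj.
  by rewrite card_mx card_Fp.
have : u \in coord @: X by rewrite imX inE.
by case/imsetP=> x Xx ->; exists x.
Qed.

Lemma affine_coord : exists j : 'rV['F_2]_3 -> T,
  [/\ injective j, forall u, j u \in X, forall u, coord (j u) = u
    & {in X, cancel coord j}].
Proof.
have [j jP] : exists j : 'rV['F_2]_3 -> T, forall u, j u \in X /\ coord (j u) = u.
  apply: (fin_all_exists (P := fun u x => x \in X /\ coord x = u)) => u.
  by have [x] := coord_onto u; exists x.
exists j; split=> [u v ejuv | u | u | x Xx]; try by case: (jP u).
  by rewrite -(proj2 (jP u)) ejuv (proj2 (jP v)).
by have [Xj ej] := jP (coord x); apply: coord_inj.
Qed.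

Variable j : 'rV['F_2]_3 -> T.
Hypotheses (injj : injective j) (jX : forall u, j u \in X).
Hypotheses (jK : forall u, coord (j u) = u) (cK : {in X, cancel coord j}).

Lemma codom_affine x : (x \in codom j) = (x \in X).
Proof. by apply/codomP/idP=> [[u ->] // | /cK <-]; exists (coord x). Qed.

(** By [Haff] the coordinates of the image are affine functions of the coordinates of the point,
    with coefficients giving M and constant terms giving v; M is invertible because h is
    injective. *)
Lemma affine_mem h : h \in H -> exists M v, M \in unitmx /\
  forall u : 'rV['F_2]_3, h (j u) = j (u *m M + v)%R.
Proof.
move=> Hh.
have [f fP] : exists f : 'I_3 -> bool * bool * bool * bool, forall i x, x \in X ->
    (h x \in Ds i) = bool_comb (f i).1.1.1 (f i).1.1.2 (f i).1.2
      (x \in A) (x \in B) (x \in C) (+) (f i).2.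
  apply: (fin_all_exists (P := fun i (f : bool * bool * bool * bool) => forall x,
    x \in X -> (h x \in Ds i) = bool_comb f.1.1.1 f.1.1.2 f.1.2
      (x \in A) (x \in B) (x \in C) (+) f.2)) => i.
  have [|a [b [c [e fE]]]] := Haff (D := Ds i) Hh; first exact: (mem_tnth i [tuple A; B; C]).
  by exists (a, b, c, e).
pose M := (\matrix_(k < 3, i < 3)
  (tnth [tuple (f i).1.1.1; (f i).1.1.2; (f i).1.2] k)%:R : 'M['F_2]_3)%R.
pose v := (\row_i ((f i).2)%:R : 'rV['F_2]_3)%R.
have hE u : h (j u) = j (u *m M + v)%R.
  rewrite -[h (j u)]cK ?HX //; congr j; apply/rowP=> i; rewrite !mxE fP //.
  rewrite addb_F2 /bool_comb !addb_F2 !andb_F2; congr (_ + _)%R.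
  have uE k : (u ord0 k = (j u \in Ds k)%:R)%R by rewrite -{1}(jK u) mxE.
  rewrite !big_ord_recl big_ord0 addr0 !mxE addrA !uE.
  by rewrite /Ds !(tnth_nth A) !(tnth_nth false).
exists M, v; split=> //; rewrite -row_free_unit; apply: inj_row_free => u uM0.
have := hE u; have := hE 0%R; rewrite uM0 mul0mx !add0r => <- /perm_inj.
exact: injj.
Qed.

Lemma affine_isog : 1344 %| #|H| -> H \isog AGL 3 'F_2.
Proof.
move=> dvdH; pose e := [morphism of ext_perm injj].
have sHA : H \subset e @* AGL 3 'F_2.
  apply/subsetP=> h Hh; have [M [v [uM hE]]] := affine_mem Hh.
  have [y jy | s defh] := ext_perm_onto injj (s := h).
    by apply: Hout => //; rewrite -codom_affine.
  apply/morphimP; exists s => //.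
  apply/AGLP; exists M, v; split=> // u; apply: injj.
  by rewrite -(ext_permE injj) -defh hE.
have injA := injm_ext_perm injj.
have -> : H = (e @* AGL 3 'F_2)%G.
  apply/val_inj/eqP; rewrite eqEcard sHA card_injm ?subsetT //=.
  exact: leq_trans card_AGL32 (dvdn_leq (cardG_gt0 H) dvdH).
by rewrite isog_sym; apply: sub_isog; rewrite ?subsetT.
Qed.

(** The fixed point p has zero coordinates, which kills the translation parts; the order then forces
    the embedding into the linear group to be onto. *)
Lemma linear_isog p : p \in X -> p \notin A -> p \notin B -> p \notin C ->
  (forall h, h \in H -> h p = p) -> 168 %| #|H| -> H \isog 'GL_3(2).
Proof.
move=> Xp nAp nBp nCp fixp dvdH.
have cp : coord p = 0%R.
  apply/rowP=> i; rewrite !mxE; case: i => [[|[|[|]]] //= lti];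
  by rewrite /Ds (tnth_nth A) /= ?(negPf nAp, negPf nBp, negPf nCp).
have j0 : j 0%R = p by rewrite -cp cK.
pose e := [morphism of ext_perm injj]; pose L := (linear_perm @* 'GL_3(2))%G.
have sHL : H \subset e @* L.
  apply/subsetP=> h Hh; have [M [v [uM hE]]] := affine_mem Hh.
  have v0 : v = 0%R.
    by have := hE 0%R; rewrite j0 fixp // mul0mx add0r -j0 => /injj.
  have [y jy | s defh] := ext_perm_onto injj (s := h).
    by apply: Hout => //; rewrite -codom_affine.
  apply/morphimP; exists s => //.
  pose g := (FinRing.Unit (uM : M \is a GRing.unit) : {'GL_3(2)}).
  apply/morphimP; exists g; rewrite ?inE //; apply/permP=> u.
  rewrite [RHS]linear_permE; apply: injj.
  by rewrite -(ext_permE injj) -defh hE v0 addr0.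
have injA := injm_ext_perm injj.
have cL : #|L| = 168 by rewrite /= card_injm ?card_GL32 ?injm_linear_perm.
have -> : H = (e @* L)%G.
  apply/val_inj/eqP; rewrite eqEcard sHL card_injm ?subsetT //= cL.
  exact: dvdn_leq (cardG_gt0 H) dvdH.
have isoL : 'GL_3(2) \isog L by apply: sub_isog; rewrite ?injm_linear_perm.
rewrite isog_sym; apply: isog_trans isoL _.
by apply: sub_isog; rewrite ?subsetT.
Qed.

End AffineModel.

(** * Odd index subgroups of alternating groups *)

Lemma odd_index_dvd (T : finType) (H : {group {perm T}}) k : 1 < #|T| ->
    H \subset 'Alt_T -> odd #|'Alt_T : H| -> 2 ^ k.+1 %| #|T|`! -> 2 ^ k %| #|H|.
Proof.
move=> T1 sHA oddH; rewrite -card_Alt // expnS dvdn_pmul2l // -(Lagrange sHA).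
by rewrite Gauss_dvdl // coprimeXl // coprime2n.
Qed.

Lemma dvdn_16_fact7 : 2 ^ 4 %| 7`!.
Proof. by rewrite (factS 6) (factS 5) dvdn_mull // (@dvdn_mul 2 6 8). Qed.

(** The seven points are the nonzero vectors of F_2^3; the added point [None] of [option 'I_7] is
    the zero vector, and the extended action fixes it. *)
Lemma seven_GL (H : {group {perm 'I_7}}) :
    H \subset 'Alt_('I_7) -> odd #|'Alt_('I_7) : H| -> free_of_cyc3 H ->
    (forall x y, x \in setT -> y \in setT -> x != y ->
     exists2 A, A \in quad_family H & (x \in A) != (y \in A)) ->
  H \isog 'GL_3(2).
Proof.
move=> sHA oddH no3 sep.
have T7 : 4 < #|'I_7| <= 7 by rewrite card_ord.
have X7 : 4 < #|[set: 'I_7]| <= 7 by rewrite cardsT.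
have F0 := quad_family0 H; have F4 := @quad_family4 _ H.
have FX := @quad_familyX _ H; have FD := quad_familyD no3 T7.
have [_ _ cov [A [B [C [EA EB EC genE]]]]] := seven_basis F0 F4 FX FD sep X7.
have dvd42 : 42 %| #|H|.
  apply: (seven_dvd F0 F4 FX FD sep X7) => [D /quad_familyP[->|//]|s x _ _].
    by rewrite eqxx.
  by rewrite inE.
have dvd8 : 2 ^ 3 %| #|H|.
  by apply: odd_index_dvd; rewrite // card_ord // dvdn_16_fact7.
(* 42 comes from 2-transitivity, 8 from the Sylow 2-subgroup of A_7. *)
have dvdH : 168 %| #|H|.
  by rewrite -[168]/(lcmn 42 (2 ^ 3)) dvdn_lcm dvd42 dvd8.
pose j := @Some 'I_7; have injj : injective j by move=> x y [].
have injE := injm_ext_perm injj.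
pose H' := (ext_perm injj @* H)%G.
have isoH : H \isog H' by apply: sub_isog; rewrite ?subsetT.
apply: isog_trans isoH _.
have mem_j (D : {set 'I_7}) x : (Some x \in j @: D) = (x \in D).
  exact: mem_imset.
have mem_N (D : {set 'I_7}) : (None \in j @: D) = false.
  by apply/imsetP=> [[]].
have H'P h' : h' \in H' -> exists2 h, h \in H & h' = ext_perm injj h.
  by case/morphimP=> h _ Hh ->; exists h.
have eN h : ext_perm injj h None = None.
  by rewrite ext_perm_out //; apply/codomP=> [[]].
have X8 : #|[set: option 'I_7]| = 8 by rewrite cardsT card_option card_ord.
have nz z : [|| z \in A, z \in B | z \in C].
  have [Y EY] := cov z (in_setT z); have [a [b [c ->]]] := genE Y EY.
  by rewrite inE; case: a; case: b; case: c; case: (z \in A); case: (z \in B).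
have sepX (x y : option 'I_7) : x \in setT -> y \in setT ->
    (x \in j @: A) = (y \in j @: A) -> (x \in j @: B) = (y \in j @: B) ->
    (x \in j @: C) = (y \in j @: C) -> x = y.
  case: x y => [x|] [y|] _ _ //; rewrite ?mem_j ?mem_N => eA eB eC.
  - congr Some; apply/eqP; apply: contraT => nxy.
    have [Y EY] := sep x y (in_setT x) (in_setT y) nxy.
    by have [a [b [c ->]]] := genE Y EY; rewrite !inE eA eB eC eqxx.
  - by have := nz x; rewrite eA eB eC.
  by have := nz y; rewrite -eA -eB -eC.
have Haff h' (D' : {set option 'I_7}) : h' \in H' ->
    D' \in [:: j @: A; j @: B; j @: C] -> exists a b c e,
    forall x, x \in [set: option 'I_7] -> (h' x \in D') =
      bool_comb a b c (x \in j @: A) (x \in j @: B) (x \in j @: C) (+) e.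
  move=> /H'P[h Hh ->] D'in.
  have [D ED ->] : exists2 D, D \in quad_family H & D' = j @: D.
    by move: D'in; rewrite !inE => /or3P[] /eqP ->; [exists A | exists B | exists C].
  have EhD : h^-1 @: D \in quad_family H.
    case/quad_familyP: ED => [->|qD]; first by rewrite imset0.
    by apply/quad_familyP; right; rewrite quadJ // groupV.
  have [a [b [c /setP defD]]] := genE _ EhD; exists a, b, c, false => x _.
  rewrite addbF; case: x => [x|]; last by rewrite eN !mem_N /bool_comb !andbF.
  rewrite (ext_permE injj h x) !mem_j; have := defD x.
  by rewrite im_permV !inE.
have Hfix h' : h' \in H' -> h' None = None by case/H'P=> h _ ->.
have HX h' x : h' \in H' -> (h' x \in [set: option 'I_7]) = (x \in setT).
  by rewrite !inE.
have Hout h' (x : option 'I_7) : h' \in H' -> x \notin [set: option 'I_7] -> h' x = x.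
  by rewrite inE.
have [k [injk kX kK cK]] := affine_coord X8 sepX.
apply: (linear_isog HX Hout Haff injk kX kK cK (p := None)); rewrite ?inE ?mem_N //.
by rewrite /= card_injm ?subsetT.
Qed.

Lemma eight_nine_AGL n (H : {group {perm 'I_n}}) : 8 <= n <= 9 ->
    H \subset 'Alt_('I_n) -> odd #|'Alt_('I_n) : H| -> free_of_cyc3 H ->
  alt_factors H \/ H \isog AGL 3 'F_2.
Proof.
case/andP=> n8 n9 sHA oddH no3.
have T8 : 7 < #|'I_n| by rewrite card_ord.
have T9 : #|'I_n| <= 9 by rewrite card_ord.
have [A0 [B0 [qA0 qB0 dis0]]] := ex_quad2 sHA oddH T8.
case: (alt_factors_or_biquad_separated sHA oddH no3 T9 qA0 qB0 dis0) => [|sep].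
  by left.
right; pose X := A0 :|: B0.
have X8 : #|X| = 8 by apply: card_eight qB0 dis0.
have [p Xp] : exists p, p \in X by apply/card_gt0P; rewrite X8.
have F0 := pointed_family0 H A0 B0 p; have F4 := @pointed_family4 _ H A0 B0 p.
have FX := fun A => pointed_familyX qA0 qB0 dis0 (p := p) (A := A).
have FD := pointed_familyD no3 T9 qA0 qB0 dis0 Xp.
have Fs := pointed_sep qA0 qB0 dis0 sep (p := p).
have Fc := pointed_card qA0 qB0 dis0 Xp.
have [_ _ cov [A [B [C [EA EB EC genE]]]]] := seven_basis F0 F4 FX FD Fs Fc.
(* 336 comes from the action on [X], 64 from the Sylow 2-subgroup; 8! and 9! have the same
   2-part. *)
have dvdH : 1344 %| #|H|.
  have dvd64 : 2 ^ 6 %| #|H|.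
    apply: odd_index_dvd => //; first exact: leq_trans T8.
    have dvd8 : 2 ^ 7 %| 8`! by rewrite (expnD 2 3 4) factS dvdn_mul ?dvdn_16_fact7.
    rewrite card_ord; have [-> // | ->] : n = 8 \/ n = 9.
      by move: n8 n9; clear; lia.
    by rewrite factS dvdn_mull.
  have dvd336 := eight_dvd no3 T9 qA0 qB0 dis0 sep.
  by rewrite -[1344]/(lcmn 336 (2 ^ 6)) dvdn_lcm dvd336 dvd64.
have nz z : z \in X :\ p -> [|| z \in A, z \in B | z \in C].
  move=> Xz; have [Y EY] := cov z Xz; have [a [b [c ->]]] := genE Y EY.
  by rewrite inE; case: a; case: b; case: c; case: (z \in A); case: (z \in B).
have np D : D \in pointed_family H A0 B0 p -> p \notin D.
  by move/FX/subsetP=> sD; apply/negP=> /sD; rewrite !inE eqxx.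
have sepX x y : x \in X -> y \in X -> (x \in A) = (y \in A) ->
    (x \in B) = (y \in B) -> (x \in C) = (y \in C) -> x = y.
  move=> Xx Xy eA eB eC; apply/eqP; apply: contraT => nxy.
  have [xp | nxp] := eqVneq x p.
    have := nz y; rewrite in_setD1 Xy andbT -xp eq_sym nxy -eA -eB -eC xp.
    by rewrite (negPf (np A EA)) (negPf (np B EB)) (negPf (np C EC)) => /(_ isT).
  have [yp | nyp] := eqVneq y p.
    have := nz x; rewrite in_setD1 Xx andbT -yp nxy eA eB eC yp.
    by rewrite (negPf (np A EA)) (negPf (np B EB)) (negPf (np C EC)) => /(_ isT).
  have [||Y EY] := Fs x y _ _ nxy; rewrite ?in_setD1 ?nxp ?nyp //.
  by have [a [b [c ->]]] := genE Y EY; rewrite !inE eA eB eC eqxx.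
have HX h x : h \in H -> (h x \in X) = (x \in X).
  by move=> Hh; apply: (eight_stable_mem no3 T9 qA0 qB0 dis0).
(* H preserves [X], and at most one point lies outside it. *)
have Hout h x : h \in H -> x \notin X -> h x = x.
  move=> Hh nXx; have : #|~: X| <= 1 by rewrite cardsCs setCK X8 leq_subLR.
  by move/card_le1_eqP; apply; rewrite in_setC ?HX.
have Haff h D : h \in H -> D \in [:: A; B; C] -> exists a b c e,
    forall x, x \in X -> (h x \in D) =
      bool_comb a b c (x \in A) (x \in B) (x \in C) (+) e.
  move=> Hh Din; have ED : D \in pointed_family H A0 B0 p.
    by move: Din; rewrite !in_cons orbF => /or3P[] /eqP ->.
  case/pointed_familyP: ED => [-> | [bD nDp]].
    by exists false, false, false, false => x _; rewrite inE.
  have bhD : biquad H A0 B0 (h^-1 @: D) by apply: (biquadJ no3 T9); rewrite ?groupV.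
  have hE x : (x \in h^-1 @: D) = (h x \in D) by rewrite im_permV inE.
  (* If the preimage of D contains the origin p, its complement in [X] is a word of the code;
     complementing is the constant term of the affine function. *)
  have [hp | nhp] := boolP (p \in h^-1 @: D).
    have EX : X :\: h^-1 @: D \in pointed_family H A0 B0 p.
      by apply/pointed_familyP; right; rewrite biquadC // in_setD hp.
    have [a [b [c /setP defD]]] := genE _ EX; exists a, b, c, true => x Xx.
    by have := defD x; rewrite in_setD Xx andbT hE inE addbT -/(bool_comb _ _ _ _ _ _) => <-; rewrite negbK.
  have EX : h^-1 @: D \in pointed_family H A0 B0 p.
    by apply/pointed_familyP; right.
  have [a [b [c /setP defD]]] := genE _ EX; exists a, b, c, false => x Xx.
  by have := defD x; rewrite hE inE addbF.
have [k [injk kX kK cK]] := affine_coord X8 sepX.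
exact (affine_isog HX Hout Haff injk kX kK cK dvdH).
Qed.

Definition has_cyc3 (T : finType) (H : {set {perm T}}) :=
  [exists x, exists y, exists z, distinct3 x y z && (cyc3 x y z \in H)].

Lemma cyc3_dec (T : finType) (H : {group {perm T}}) :
  (exists x y z, distinct3 x y z /\ cyc3 x y z \in H) \/ free_of_cyc3 H.
Proof.
case: (boolP (has_cyc3 H)) => [/existsP[x /existsP[y /existsP[z /andP[]]]]|].
  by left; exists x, y, z.
rewrite negb_exists => /forallP no; right=> x y z d3.
have := no x; rewrite negb_exists => /forallP/(_ y).
by rewrite negb_exists => /forallP/(_ z); rewrite d3.
Qed.

Theorem odd_index_Alt n (H : {group {perm 'I_n}}) : 5 <= n ->
    H \subset 'Alt_('I_n) -> odd #|'Alt_('I_n) : H| ->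
  alt_factors H \/
  [\/ n = 7 /\ H \isog 'GL_3(2), n = 8 /\ H \isog AGL 3 'F_2
    | n = 9 /\ H \isog AGL 3 'F_2].
Proof.
move=> n5 sHA oddH; have [[x [y [z [d3 Hc]]]] | no3] := cyc3_dec H.
  by left; apply: alt_factors_cyc3 sHA oddH d3 Hc.
have [n10 | n10] := ltnP 9 n; first by left; apply: alt_factors_ge10.
have [n8 | n8] := leqP 8 n.
  have n89 : 8 <= n <= 9 by rewrite n8.
  case: (eight_nine_AGL n89 sHA oddH no3) => [|isoH]; [by left | right].
  move: n10; rewrite leq_eqVlt ltnS => /orP[/eqP n9|n8']; first by constructor 3.
  by constructor 2; split=> //; apply/eqP; rewrite eqn_leq n8'.
have T7 : 4 < #|'I_n| <= 7 by rewrite card_ord n5.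
case: (alt_factors_or_separated sHA oddH T7) => [|sep]; [by left | right].
have X7 : 4 < #|[set: 'I_n]| <= 7 by rewrite cardsT.
have [_ oX _ _] := seven_basis (quad_family0 H) (@quad_family4 _ H)
  (@quad_familyX _ H) (quad_familyD no3 T7) sep X7.
rewrite cardsT card_ord in oX; constructor 1; split=> //.
by subst n; apply: seven_GL.
Qed.

(** * Telling 3-cycles from other elements of order 3 *)

Section ThreeCycleClass.

Variable T : finType.
Implicit Types (a b c d e p q r x y z : T) (s t g : {perm T}).

Definition is_cyc3 s : Prop := exists a b c, distinct3 a b c /\ s = cyc3 a b c.

Lemma is_cyc3J s g : is_cyc3 s -> is_cyc3 (s ^ g).
Proof.
case=> a [b [c [d3 ->]]]; exists (g a), (g b), (g c); rewrite cyc3J; split=> //.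
by rewrite /distinct3 !(inj_eq perm_inj).
Qed.

Definition ord235 s := [|| s ^+ 2 == 1, s ^+ 3 == 1 | s ^+ 5 == 1].

Lemma expg_cyc3 a b c : distinct3 a b c -> cyc3 a b c ^+ 3 = 1.
Proof.
move=> d3; apply/permP=> z; rewrite permX perm1 /=.
have [-> | nza] := eqVneq z a; first by rewrite cyc3_x // cyc3_y // cyc3_z.
have [-> | nzb] := eqVneq z b; first by rewrite cyc3_y // cyc3_z // cyc3_x.
have [-> | nzc] := eqVneq z c; first by rewrite cyc3_z // cyc3_x // cyc3_y.
by rewrite !cyc3_out.
Qed.

(** The order depends on how {e, f} meets {b, c}: 3 or 1 if they coincide, 2 or 3 if they share one
    point, and a 5-cycle if they are disjoint. *)
Lemma ord235_share x b c e f : distinct3 x b c -> distinct3 x e f ->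
  ord235 (cyc3 x b c * cyc3 x e f).
Proof.
move=> d1 d2; have /and3P[nxb nxc nbc] := d1; have /and3P[nxe nxf nef] := d2.
have [eb | neb] := eqVneq e b; first rewrite {}eb in d2 nxe nef *.
  have [fc | nfc] := eqVneq f c.
    rewrite fc; apply/or3P; constructor 2; apply/eqP.
    by rewrite -expg2 -expgM mulnC expgM expg_cyc3 // expg1n.
  apply/or3P; constructor 1; apply/eqP/permP=> z; rewrite permX perm1 /= /cyc3.
  have [-> | ?] := eqVneq z x; first by tperm_tac.
  have [-> | ?] := eqVneq z b; first by tperm_tac.
  have [-> | ?] := eqVneq z c; first by tperm_tac.
  have [-> | ?] := eqVneq z f; first by tperm_tac.
  by tperm_tac.
have [ec | nec] := eqVneq e c; first rewrite {}ec in d2 nxe nef neb *.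
  have [fb | nfb] := eqVneq f b.
    by rewrite fb -(cyc3V x b c) mulgV /ord235 !expg1n eqxx.
  apply/or3P; constructor 2; apply/eqP/permP=> z; rewrite permX perm1 /= /cyc3.
  have [-> | ?] := eqVneq z x; first by tperm_tac.
  have [-> | ?] := eqVneq z b; first by tperm_tac.
  have [-> | ?] := eqVneq z c; first by tperm_tac.
  have [-> | ?] := eqVneq z f; first by tperm_tac.
  by tperm_tac.
have [fb | nfb] := eqVneq f b; first rewrite {}fb in d2 nxf nef *.
  apply/or3P; constructor 2; apply/eqP/permP=> z; rewrite permX perm1 /= /cyc3.
  have [-> | ?] := eqVneq z x; first by tperm_tac.
  have [-> | ?] := eqVneq z b; first by tperm_tac.
  have [-> | ?] := eqVneq z c; first by tperm_tac.
  have [-> | ?] := eqVneq z e; first by tperm_tac.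
  by tperm_tac.
have [fc | nfc] := eqVneq f c; first rewrite {}fc in d2 nxf nef nfb *.
  apply/or3P; constructor 1; apply/eqP/permP=> z; rewrite permX perm1 /= /cyc3.
  have [-> | ?] := eqVneq z x; first by tperm_tac.
  have [-> | ?] := eqVneq z b; first by tperm_tac.
  have [-> | ?] := eqVneq z c; first by tperm_tac.
  have [-> | ?] := eqVneq z e; first by tperm_tac.
  by tperm_tac.
apply/or3P; constructor 3; apply/eqP/permP=> z; rewrite permX perm1 /= /cyc3.
have [-> | ?] := eqVneq z x; first by tperm_tac.
have [-> | ?] := eqVneq z b; first by tperm_tac.
have [-> | ?] := eqVneq z c; first by tperm_tac.
have [-> | ?] := eqVneq z e; first by tperm_tac.
have [-> | ?] := eqVneq z f; first by tperm_tac.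
by tperm_tac.
Qed.

Lemma ord235_cyc3M s t : is_cyc3 s -> is_cyc3 t -> ord235 (s * t).
Proof.
have rot s' u : is_cyc3 s' -> s' u != u -> exists b c,
    distinct3 u b c /\ s' = cyc3 u b c.
  case=> a [b [c [d3 ->]]] nu.
  have dr := d3; rewrite distinct3_rot in dr.
  have drr := dr; rewrite distinct3_rot in drr.
  have [-> | nua] := eqVneq u a; first by exists b, c.
  have [-> | nub] := eqVneq u b; first by exists c, a; split; last exact: cyc3_rot.
  have [-> | nuc] := eqVneq u c; first by exists a, b; split; last by rewrite cyc3_rot // cyc3_rot.
  by rewrite cyc3_out ?eqxx in nu.
move=> s3 t3; case: (pickP (fun u => (s u != u) && (t u != u))) => [u | nofix].
  case/andP=> su tu; have [b [c [d1 ->]]] := rot s u s3 su.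
  by have [e [f [d2 ->]]] := rot t u t3 tu; apply: ord235_share.
have s31 : s ^+ 3 = 1 by case: s3 => a [b [c [d3 ->]]]; apply: expg_cyc3.
have t31 : t ^+ 3 = 1 by case: t3 => a [b [c [d3 ->]]]; apply: expg_cyc3.
have st : commute s t.
  apply: (@perm_onC _ [set u | s u != u] [set u | t u != u]).
  - by apply/subsetP=> u; rewrite !inE.
  - by apply/subsetP=> u; rewrite !inE.
  rewrite disjoint_subset; apply/subsetP=> u; rewrite !inE => su.
  by have := nofix u; rewrite su /= => ->.
by apply/or3P; constructor 2; rewrite expgMn // s31 t31 mulg1.
Qed.

(** The commutator is the product of the 3-cycles s^-1 and s ^ g. *)
Lemma ord235_comm s g : is_cyc3 s -> ord235 [~ s, g].
Proof.
move=> s3; apply: ord235_cyc3M (is_cyc3J _ s3).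
case: s3 => a [b [c [d3 ->]]]; exists a, c, b; rewrite cyc3V; split=> //.
by move: d3; rewrite /distinct3 (eq_sym c b) => /and3P[-> -> ->].
Qed.

Lemma ord3_orbit s x : s ^+ 3 = 1 -> s x != x -> distinct3 x (s x) (s (s x)) /\ s (s (s x)) = x.
Proof.
move=> s3 sx; have s3x : s (s (s x)) = x by rewrite -[LHS]/(iter 3 s x) -permX s3 perm1.
split=> //; apply/and3P; split; first by rewrite eq_sym.
  by apply: contraNneq sx => e; rewrite -[X in _ == X]s3x -e.
by rewrite (inj_eq perm_inj) eq_sym.
Qed.

Lemma not_cyc3_orbits s : s ^+ 3 = 1 -> s != 1 -> ~ is_cyc3 s ->
  exists a p, [/\ s a != a, s p != p &
    uniq [:: a; s a; s (s a); p; s p; s (s p)]].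
Proof.
move=> s3 s1 ns3; have [a sa] : exists a, s a != a.
  apply/existsP; apply: contraR s1; rewrite negb_exists => /forallP fix_s.
  by apply/eqP/permP=> x; rewrite perm1; apply/eqP; rewrite -[_ == _]negbK.
have [d3 s3a] := ord3_orbit s3 sa.
have [p [np sp]] : exists p, p \notin [:: a; s a; s (s a)] /\ s p != p.
  case: (pickP (fun p => (p \notin [:: a; s a; s (s a)]) && (s p != p))).
    by move=> p /andP[]; exists p.
  move=> nop; case: ns3; exists a, (s a), (s (s a)); split=> //.
  apply/permP=> z.
  have [-> | nza] := eqVneq z a; first by rewrite cyc3_x.
  have [-> | nzb] := eqVneq z (s a); first by rewrite cyc3_y.
  have [-> | nzc] := eqVneq z (s (s a)); first by rewrite cyc3_z // s3a.
  rewrite cyc3_out //; have := nop z; rewrite !inE !negb_or nza nzb nzc /=.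
  by move/negbFE/eqP.
exists a, p; split=> //.
have [d3p s3p] := ord3_orbit s3 sp.
have out u : u \notin [:: a; s a; s (s a)] -> s u \notin [:: a; s a; s (s a)].
  apply: contra; rewrite !inE => /or3P[] /eqP e.
  - by rewrite -{1}s3a in e; rewrite (perm_inj e) eqxx !orbT.
  - by rewrite (perm_inj e) eqxx.
  by rewrite (perm_inj e) eqxx orbT.
have np1 := out _ np; have np2 := out _ np1.
rewrite -[[:: a; _; _; _; _; _]]/([:: a; s a; s (s a)] ++ [:: p; s p; s (s p)]).
rewrite cat_uniq; apply/and3P; split.
- by move: d3; rewrite /distinct3 /= !inE negb_or => /and3P[-> -> ->].
- apply/hasPn=> u u_in; have : [\/ u = p, u = s p | u = s (s p)].
    by move: u_in; rewrite !inE => /or3P[] /eqP ->; [constructor 1 | constructor 2 | constructor 3].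
  by case=> ->.
by move: d3p; rewrite /distinct3 /= !inE negb_or => /and3P[-> -> ->].
Qed.

(* With s = (a b c)(p q r)... and t a further point, the commutator of s and *)
(* (a p)(b t) exchanges a and p and maps b to q and q to t.                  *)
Lemma not_ord235_comm s : 6 < #|T| -> s ^+ 3 = 1 -> s != 1 -> ~ is_cyc3 s ->
  exists2 g, g \in 'Alt_T & ~~ ord235 [~ s, g].
Proof.
move=> T7 s3 s1 ns3; have [a [p [sa sp u6]]] := not_cyc3_orbits s3 s1 ns3.
have [t nt] := ex_notin (s := [:: a; s a; s (s a); p; s p; s (s p)]) T7.
have [_ s3a] := ord3_orbit s3 sa; have [_ s3p] := ord3_orbit s3 sp.
have st u : u \in [:: a; s a; s (s a); p; s p; s (s p)] -> u != s t.
  apply: contraTneq => ->; apply: contra nt; rewrite !inE.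
  case/or4P=> [/eqP e|/eqP e|/eqP e|/or3P[]/eqP e].
  - by rewrite -{1}s3a in e; rewrite (perm_inj e) eqxx !orbT.
  - by rewrite (perm_inj e) eqxx.
  - by rewrite (perm_inj e) eqxx !orbT.
  - by rewrite -{1}s3p in e; rewrite (perm_inj e) eqxx !orbT.
  - by rewrite (perm_inj e) eqxx !orbT.
  by rewrite (perm_inj e) eqxx !orbT.
have [ta tb tc] : [/\ a != s t, s a != s t & s (s a) != s t].
  by split; apply: st; rewrite !inE eqxx ?orbT.
have [tp tq] : p != s t /\ s p != s t.
  by split; apply: st; rewrite !inE eqxx ?orbT.
move: u6 nt; rewrite /= !inE !negb_or.
case/and5P=> /and5P[ab ac ap aq ar] /and4P[bc bp bq br] /and3P[cp cq cr].
case/andP=> pq pr /andP[qr _] /and5P[nta ntb ntc ntp /andP[ntq ntr]].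
exists (tperm a p * tperm (s a) t).
  by rewrite Alt_even odd_permM !odd_tperm ap eq_sym ntb.
set z := [~ _, _].
have zE : z = tperm (s (s a)) (s t) * tperm (s a) (s p) * (tperm a p * tperm (s a) t).
  rewrite /z commgEr invMg !tpermV conjMg !tpermJ //.
have za : z a = p by rewrite zE; tperm_tac.
have zp : z p = a by rewrite zE; tperm_tac.
have zb : z (s a) = s p by rewrite zE; tperm_tac.
have zq : z (s p) = t by rewrite zE; tperm_tac.
rewrite /ord235 !negb_or; apply/and3P; split; apply/eqP.
- move/permP/(_ (s a)); rewrite permX /= zb zq perm1 => /eqP.
  by rewrite (negPf ntb).
- move/permP/(_ a); rewrite permX /= za zp za perm1 => /eqP.
  by rewrite eq_sym (negPf ap).
move/permP/(_ a); rewrite permX /= za zp za zp za perm1 => /eqP.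
by rewrite eq_sym (negPf ap).
Qed.

End ThreeCycleClass.

(** * Automorphisms preserving 3-cycles are conjugations *)

(** The transposition t of [u] and [v] normalizes K, and K with t generates all transpositions
    inside fibers, hence the whole Young subgroup; an even element then needs no factor t. *)
Lemma Alt_color_sub (T : finType) (C : eqType) (c : T -> C)
    (K : {group {perm T}}) u v :
    u != v -> c u = c v -> K \subset 'Alt_T -> K \subset color_sym c ->
    (forall a b d e, a != b -> d != e -> c a = c b -> c d = c e ->
       tperm a b * tperm d e \in K) ->
  'Alt_T :&: color_sym c \subset K.
Proof.
move=> nuv cuv sKA sKc Ktt; pose t := tperm u v.
have nKt : t \in 'N(K).
  apply/normP/eqP; rewrite eqEcard cardJg leqnn andbT.
  apply/subsetP=> _ /imsetP[k Kk ->].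
  have -> : k ^ t = k * (tperm (k u) (k v) * t).
    by rewrite -tpermJ /conjg tpermV !mulgA mulgV mul1g.
  have ck := color_symP (subsetP sKc k Kk).
  by rewrite groupMl // Ktt ?(inj_eq perm_inj) ?ck.
have sct : color_sym c \subset K <*> <[t]>.
  apply: color_sym_gen => x y cxy; have [->|nxy] := eqVneq x y.
    by rewrite tperm1 group1.
  have -> : tperm x y = (tperm x y * t) * t by rewrite -mulgA tperm2 mulg1.
  rewrite groupM //; first by apply: (subsetP (joing_subl _ _)); apply: Ktt.
  by apply: (subsetP (joing_subr _ _)); apply: cycle_id.
apply/subsetP=> s /setIP[As cs].
have : s \in K * <[t]> by rewrite -norm_joinEr ?cycle_subG // (subsetP sct).
case/mulsgP=> k _ Kk /cycleP[i ->] defs; rewrite defs.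
have Ak := subsetP sKA k Kk.
have ti : t ^+ i = t ^+ odd i.
  rewrite -{1}(odd_double_half i) expgD -muln2 mulnC expgM expg2 tperm2 expg1n.
  by rewrite mulg1.
move: As; rewrite defs ti Alt_even odd_permM; rewrite Alt_even in Ak.
case: (odd i); first by rewrite expg1 odd_tperm nuv (negPf Ak).
by rewrite expg0 mulg1.
Qed.

Lemma card_two_color (T : finType) (U : {set T}) :
  #|color_sym (fun x => x \in U)| <= #|U|`! * #|~: U|`!.
Proof.
pose D := color_sym (fun x => x \in U).
have sN s : s \in D -> s \in 'N(U | 'P) /\ s \in 'N(~: U | 'P).
  move=> /color_symP cs; split; apply/astabsP=> x; rewrite /= /aperm ?cs //.
  by rewrite !inE cs.
pose F s := (restr_perm U s, restr_perm (~: U) s).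
have injF : {in D &, injective F}.
  move=> s t /sN[s1 s2] /sN[t1 t2] [e1 e2]; apply/permP=> x.
  case: (boolP (x \in U)) => Ux.
    by rewrite -(restr_permE s1 Ux) -(restr_permE t1 Ux) e1.
  have Ux' : x \in ~: U by rewrite inE.
  by rewrite -(restr_permE s2 Ux') -(restr_permE t2 Ux') e2.
rewrite -(card_in_imset injF) -!card_perm -![#|perm_on _|]cardsE -cardsX.
apply/subset_leq_card/subsetP.
by move=> _ /imsetP[s _ ->]; apply/setXP; split; rewrite in_set; apply: restr_perm_on.
Qed.

Lemma factE k : 0 < k -> k`! = (k * k.-1`!)%N.
Proof. by case: k. Qed.

Lemma ltn_fact_mul a b : 1 < a -> 1 < b -> a`! * b`! < (a + b).-1`!.
Proof.
case: a => // a; rewrite ltnS => a0 b1; rewrite addSn /=.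
elim: a a0 => // a IHa _; have [-> | a_gt0] := posnP a.
  by rewrite add1n (factS b) ltn_pmul2r ?fact_gt0.
rewrite factS -mulnA addSn factS.
apply: leq_trans (_ : a.+2 * (a + b)`! <= _); first by rewrite ltn_pmul2l // IHa.
by rewrite leq_mul2r; apply/orP; right; move: b1; clear; lia.
Qed.

Section AltAut.

Variable T : finType.
Hypothesis T5 : 4 < #|T|.

Lemma ex_third (s : seq T) : size s < 5 -> exists z, z \notin s.
Proof. by move=> s5; apply: ex_notin; apply: leq_trans T5. Qed.

Lemma Alt_sub_rel3 (K : {group {perm T}}) : K \subset 'Alt_T ->
  (forall a b, rel3 K a b) -> 'Alt_T \subset K.
Proof.
move=> sKA Krel; have [u _] := ex_third (s := [::]) isT.
have [v] := ex_third (s := [:: u]) isT; rewrite inE => nvu.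
have cT (S : {set {perm T}}) : S \subset color_sym (fun _ : T => tt).
  by apply/subsetP=> s _; apply/color_symP.
rewrite -(setIidPl (cT 'Alt_T)).
apply: (Alt_color_sub nvu) => // a b d e nab nde _ _.
by apply: block3_tperm2.
Qed.

Lemma Alt_orbit x : orbit 'P 'Alt_T x = setT.
Proof.
apply/setP=> y; rewrite inE; apply/orbitP.
have [-> | nxy] := eqVneq x y; first by exists 1; rewrite ?group1 //= /aperm perm1.
have [z] := ex_third (s := [:: x; y]) isT; rewrite !inE negb_or => /andP[nzx nzy].
have d3 : distinct3 x y z by rewrite /distinct3 nxy eq_sym nzx eq_sym nzy.
by exists (cyc3 x y z); rewrite ?cyc3_Alt //= /aperm cyc3_x.
Qed.

Lemma Alt_move x y : exists2 s, s \in 'Alt_T & s x = y.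
Proof.
have : y \in orbit 'P 'Alt_T x by rewrite Alt_orbit inE.
by case/orbitP=> s As <-; exists s.
Qed.

Definition Alt_stab (p : T) := ('Alt_T :&: color_sym (fun x => x == p))%G.

Lemma Alt_stabP p s : reflect (s \in 'Alt_T /\ s p = p) (s \in Alt_stab p).
Proof.
apply: (iffP setIP) => [] [As sp]; split=> //.
  by have := color_symP sp p; rewrite eqxx => /eqP.
by apply/color_symP=> x; rewrite -{1}sp (inj_eq perm_inj).
Qed.

Lemma card_Alt_stab p : (2 * #|Alt_stab p|)%N = (#|T|.-1)`!.
Proof.
have := card_orbit_stab 'P ('Alt_T)%G p; rewrite Alt_orbit cardsT.
have -> : 'C_('Alt_T)[p | 'P] = Alt_stab p.
  apply/setP=> s; apply/setIP/Alt_stabP=> [[As /astab1P sp] //|[As sp]].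
  by split; last exact/astab1P.
have T0 : 0 < #|T| by apply: ltn_trans T5.
have oA := card_Alt (ltn_trans (isT : 1 < 4) T5); rewrite factE // in oA => oS.
by apply/eqP; rewrite -(eqn_pmul2l T0) -oA -oS; apply/eqP; clear; lia.
Qed.

Variable f : {perm {perm T}}.
Hypothesis Af : f \in Aut 'Alt_T.

Lemma Aut_Alt_closed s : s \in 'Alt_T -> f s \in 'Alt_T.
Proof. exact: Aut_closed. Qed.

Lemma Aut_AltM s t : s \in 'Alt_T -> t \in 'Alt_T -> f (s * t) = f s * f t.
Proof. by move=> As At; rewrite -!(autmE Af) morphM. Qed.

Lemma Aut_Alt_onto t : t \in 'Alt_T -> exists2 s, s \in 'Alt_T & t = f s.
Proof.
rewrite -{1}(im_autm Af) => /morphimP[s _ As ->]; exists s => //.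
Qed.

Hypothesis f3 : forall s, is_cyc3 s -> is_cyc3 (f s).

Let M p := (autm Af @* Alt_stab p)%G.

Let card_M p : (2 * #|M p|)%N = (#|T|.-1)`!.
Proof. by rewrite card_injm ?injm_autm ?subsetIl // card_Alt_stab. Qed.

Let sMA p : M p \subset 'Alt_T.
Proof.
apply/subsetP=> _ /morphimP[s As _ ->]; rewrite /= autmE.
exact: Aut_Alt_closed.
Qed.

(** Let K be the part of [Alt_stab p] whose image under f preserves every block. A 3-cycle fixing p
    goes to a 3-cycle of [M p], whose points share a block, so K contains it; by [Alt_color_sub]
    these elements give all of [Alt_stab p]. *)
Let M_blocks p : M p \subset color_sym (block3 (M p)).
Proof.
pose K := (Alt_stab p :&: autm Af @*^-1 (color_sym_group (block3 (M p))))%G.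
suff sSK : Alt_stab p \subset K.
  apply/subsetP=> _ /morphimP[s As Ss ->].
  by have /setIP[_ /morphpreP[_]] := subsetP sSK s Ss.
have K3 x y z : distinct3 x y z -> x != p -> y != p -> z != p -> cyc3 x y z \in K.
  move=> d3 nx ny nz; have A3 := cyc3_Alt d3.
  have S3 : cyc3 x y z \in Alt_stab p.
    by apply/Alt_stabP; rewrite A3 cyc3_out // eq_sym.
  apply/setIP; split=> //; apply/morphpreP; split=> //.
  have M3 : autm Af (cyc3 x y z) \in M p by apply: mem_morphim.
  have /f3[a [b [c [e3 fE]]]] : is_cyc3 (cyc3 x y z) by exists x, y, z.
  have aE : autm Af (cyc3 x y z) = cyc3 a b c by rewrite autmE.
  suff : cyc3 a b c \in color_sym (block3 (M p)) by rewrite -aE.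
  rewrite {}aE in M3.
  have rab : rel3 (M p) a b by apply: rel3_cyc e3 M3.
  have rbc : rel3 (M p) b c.
    have e3' : distinct3 b c a by rewrite -distinct3_rot.
    by apply: (rel3_cyc e3'); rewrite -mem_cyc3_rot.
  have eab : block3 (M p) a = block3 (M p) b by apply/eqP; rewrite block3_eq.
  have ebc : block3 (M p) b = block3 (M p) c by apply/eqP; rewrite block3_eq.
  apply/color_symP=> u.
  have [-> | na] := eqVneq u a; first by rewrite cyc3_x.
  have [-> | nb] := eqVneq u b; first by rewrite cyc3_y.
  have [-> | nc] := eqVneq u c; first by rewrite cyc3_z // eab.
  by rewrite cyc3_out.
have Krel a b : a != p -> b != p -> rel3 K a b.
  move=> na nb; have [-> | nab] := eqVneq a b; first exact: rel3_refl.
  have [z] := ex_third (s := [:: a; b; p]) isT.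
  rewrite !inE !negb_or => /and3P[nza nzb nzp].
  have d3 : distinct3 a b z by rewrite /distinct3 nab eq_sym nza eq_sym nzb.
  by apply: (rel3_cyc d3); apply: K3.
have [u] := ex_third (s := [:: p]) isT; rewrite inE => nup.
have [v] := ex_third (s := [:: p; u]) isT; rewrite !inE negb_or => /andP[nvp nvu].
apply: (Alt_color_sub nvu).
- by rewrite (negPf nup) (negPf nvp).
- by apply: subset_trans (subsetIl _ _) _; apply: subsetIl.
- by apply: subset_trans (subsetIl _ _) _; apply: subsetIr.
move=> a b d e nab nde cab cde.
have np x y : x != y -> (x == p) = (y == p) -> x != p.
  by move=> nxy exy; apply: contraNneq nxy => ex; move: exy; rewrite ex eqxx => /esym/eqP ->.
have [na nd] := (np _ _ nab cab, np _ _ nde cde).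
have [nb ne] : b != p /\ e != p by rewrite -cab -cde.
by apply: block3_tperm2 => //; apply: Krel.
Qed.

(** [M p] is too small to contain A_n, so it has more than one block, and it preserves a block U and
    its complement. If both had two points or more, then 2|M p| would be at most |U|! times the
    factorial of the size of the complement, which [ltn_fact_mul] puts below (n-1)! = 2|M p|. So one
    of them is a single fixed point. *)
Lemma Aut_Alt_stab p : exists q, forall s, s \in 'Alt_T -> s p = p -> f s q = q.
Proof.
have T1 : 1 < #|T| by apply: ltn_trans T5.
have oM := card_M p; have oA := card_Alt T1.
have T0 : 0 < #|T| by apply: ltnW.
have [x [y nxy]] : exists x y, block3 (M p) x != block3 (M p) y.
  case: (pickP [pred z : T * T | block3 (M p) z.1 != block3 (M p) z.2]).
    by case=> x y; exists x, y.
  move=> allM; have Mrel a b : rel3 (M p) a b.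
    by rewrite -block3_eq; have := allM (a, b); move/negbFE.
  have := Alt_sub_rel3 (sMA p) Mrel.
  move/subset_leq_card; rewrite -(leq_pmul2l (isT : 0 < 2)) oM oA.
  rewrite factE // leqNgt => /negP[].
  by rewrite -{1}(mul1n (_`!)) ltn_pmul2r ?fact_gt0.
pose U := block3 (M p) x.
have sMU : M p \subset color_sym (fun z => z \in U).
  apply: subset_trans (M_blocks p) _; apply/subsetP=> s /color_symP cs.
  apply/color_symP=> z; rewrite !inE -!block3_eq.
  by rewrite cs.
have Ux : x \in U by rewrite inE rel3_refl.
have nUy : y \notin U by rewrite inE -block3_eq.
have fixU z : (forall w, w \in U -> w = z) \/ (forall w, w \notin U -> w = z) ->
    exists q, forall s, s \in 'Alt_T -> s p = p -> f s q = q.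
  move=> Uz; exists z => s As sp.
  have Mfs : f s \in M p.
    by rewrite -(autmE Af); apply: mem_morphim => //; apply/Alt_stabP.
  have := color_symP (subsetP sMU _ Mfs) z => e.
  case: Uz => Uz; apply: (Uz (f s z)); first by rewrite e -(Uz x Ux).
  by rewrite e -(Uz y nUy).
(* The factor 2 comes from the coset of [M p] under a transposition preserving U, since [M p] is
   even. *)
have leq2M : #|M p| * 2 <= #|U|`! * #|~: U|`!.
  apply: leq_trans (card_two_color U).
  have [a [b [nab cab]]] : exists a b, a != b /\ (a \in U) = (b \in U).
    have [z1] := ex_third (s := [:: x; y]) isT; rewrite !inE negb_or => /andP[z1x z1y].
    case: (boolP (z1 \in U)) => Uz1; first by exists z1, x; rewrite z1x Ux Uz1.
    by exists z1, y; rewrite z1y (negPf nUy) (negPf Uz1).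
  pose t := tperm a b; pose D := color_sym (fun z => z \in U).
  have sMt : M p :|: M p :* t \subset D.
    rewrite subUset sMU; apply/subsetP=> _ /rcosetP[m Mm ->].
    by apply: groupM; [apply: (subsetP sMU) | rewrite tperm_color_sym cab].
  apply: leq_trans (subset_leq_card sMt).
  rewrite cardsU card_rcoset muln2 -addnn (_ : _ :&: _ = set0) ?cards0 ?subn0 //.
  apply/setP=> s; rewrite !inE; apply/negP=> /andP[Ms /rcosetP[m Mm defs]].
  have := subsetP (sMA p) s Ms; have := subsetP (sMA p) m Mm.
  by rewrite defs !Alt_even odd_permM odd_tperm nab => /negPf ->.
have cU : #|U| + #|~: U| = #|T| by apply: cardsC.
have [U2 | U1] := ltnP 1 #|U|; last first.
  apply: (fixU x); left=> w Uw.
  exact: (card_le1_eqP U1).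
have [V2 | V1] := ltnP 1 #|~: U|; last first.
  apply: (fixU y); right=> w Uw.
  by apply: (card_le1_eqP V1); rewrite inE.
have := ltn_fact_mul U2 V2; rewrite cU -oM mulnC ltnNge => /negP[].
by rewrite mulnC (mulnC (#|~: U|`!)).
Qed.

(** Points are cosets of the stabilizer of p, which f maps into the stabilizer of q. The induced map
    g is a bijection with g (t x) = f t (g x), so f is conjugation by g. *)
Lemma Aut_Alt_conj : exists s, forall t, t \in 'Alt_T -> f t = t ^ s.
Proof.
have [p _] := ex_third (s := [::]) isT; have [q qP] := Aut_Alt_stab p.
have [w wP] : exists w : T -> {perm T}, forall x, w x \in 'Alt_T /\ w x p = x.
  apply: (fin_all_exists (P := fun x s => s \in 'Alt_T /\ s p = x)) => x.
  by have [s] := Alt_move p x; exists s.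
pose g x := f (w x) q.
have gE s x : s \in 'Alt_T -> s p = x -> g x = f s q.
  move=> As sp; have [Aw wp] := wP x.
  have e : w x = (w x * s^-1) * s by rewrite mulgKV.
  rewrite /g e Aut_AltM ?groupM ?groupV // permM qP ?groupM ?groupV //.
  by rewrite permM wp -sp permK.
have gJ t x : t \in 'Alt_T -> g (t x) = f t (g x).
  move=> At; have [Aw wp] := wP x.
  by rewrite (gE (w x * t)) ?groupM ?permM ?wp // Aut_AltM // permM.
have g_onto y : exists x, g x = y.
  have [t At tq] := Alt_move q y; have [s As defs] := Aut_Alt_onto At.
  by exists (s p); rewrite (gE s) // -defs.
have inj_g : injective g.
  have /image_injP gi : #|[seq g x | x in T]| == #|T|.
    rewrite eqn_leq leq_image_card /=; apply/subset_leq_card/subsetP=> y _.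
    by have [x <-] := g_onto y; apply: codom_f.
  by move=> x y; apply: gi.
exists (perm inj_g) => t At; apply/permP=> y; have [x <-] := g_onto y.
by rewrite -gJ // -[g x](permE inj_g) permJ permE.
Qed.

End AltAut.

(** * The action of automorphisms on 3-cycles *)

Section AutCyc3.

Variable T : finType.
Implicit Types (a b c p x y z : T) (s t g : {perm T}).
Hypothesis T5 : 4 < #|T|.

Lemma is_cyc3_dec s : is_cyc3 s \/ ~ is_cyc3 s.
Proof.
case: (boolP [exists a, exists b, exists c, distinct3 a b c && (s == cyc3 a b c)]).
  case/existsP=> a /existsP[b /existsP[c /andP[d3 /eqP ->]]].
  by left; exists a, b, c.
move=> no; right=> [[a [b [c [d3 e]]]]]; case/negP: no.
apply/existsP; exists a; apply/existsP; exists b; apply/existsP; exists c.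
by rewrite d3 e eqxx.
Qed.

Lemma is_cyc3_Alt s : is_cyc3 s -> s \in 'Alt_T.
Proof. by case=> a [b [c [d3 ->]]]; apply: cyc3_Alt. Qed.

Lemma uniq_card_le (s : seq T) : uniq s -> size s <= #|T|.
Proof. by move/card_uniqP=> <-; apply: max_card. Qed.

Section OneAut.

Variable f : {perm {perm T}}.
Hypothesis Af : f \in Aut 'Alt_T.

Lemma Aut_Alt1 : f 1 = 1.
Proof. by rewrite -(autmE Af) morph1. Qed.

Lemma Aut_AltX s k : s \in 'Alt_T -> f (s ^+ k) = f s ^+ k.
Proof. by move=> As; rewrite -!(autmE Af) morphX. Qed.

Lemma Aut_AltJ s g : s \in 'Alt_T -> g \in 'Alt_T -> f (s ^ g) = f s ^ f g.
Proof. by move=> As Ag; rewrite -!(autmE Af) morphJ. Qed.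

Lemma Aut_AltR s g : s \in 'Alt_T -> g \in 'Alt_T -> f [~ s, g] = [~ f s, f g].
Proof. by move=> As Ag; rewrite -!(autmE Af) morphR. Qed.

Lemma Aut_cyc3_order s : is_cyc3 s -> f s ^+ 3 = 1 /\ f s != 1.
Proof.
move=> s3; have As := is_cyc3_Alt s3; case: s3 As => a [b [c [d3 ->]]] As.
rewrite -Aut_AltX // expg_cyc3 // Aut_Alt1; split=> //.
rewrite -[X in _ != X]Aut_Alt1 (inj_eq perm_inj); apply/eqP=> /permP/(_ a).
by rewrite cyc3_x // perm1; case/and3P: d3 => /eqP nab _ _ /esym.
Qed.

(** Otherwise f s has two orbits of length 3, so there are at least 7 points, and [not_ord235_comm]
    yields a commutator with f s that violates [ord235]; it is the image of a commutator with the
    3-cycle s, which satisfies it. *)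
Lemma Aut_Alt_cyc3 s : #|T| <> 6 -> is_cyc3 s -> is_cyc3 (f s).
Proof.
move=> T6 s3; have [//|ns3] := is_cyc3_dec (f s).
have As := is_cyc3_Alt s3; have [f3 f1] := Aut_cyc3_order s3.
have [a [p [_ _ /uniq_card_le /= T6']]] := not_cyc3_orbits f3 f1 ns3.
have T7 : 6 < #|T| by rewrite ltn_neqAle T6' andbT eq_sym; apply/eqP.
have [g Ag] := not_ord235_comm T7 f3 f1 ns3.
have [g' Ag' ->] := Aut_Alt_onto Af Ag; rewrite -Aut_AltR //.
have AR : [~ s, g'] \in 'Alt_T by rewrite groupR.
case/negP; rewrite /ord235 -!Aut_AltX //.
by have /or3P[] := ord235_comm g' s3 => /eqP ->; rewrite Aut_Alt1 eqxx ?orbT.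
Qed.

End OneAut.

Lemma perm_of_lists (s1 s2 : seq T) : uniq s1 -> uniq s2 ->
  size s1 = #|T| -> size s2 = #|T| -> exists g : {perm T}, map g s1 = s2.
Proof.
move=> u1 u2 z1 z2.
have full x : x \in s1.
  apply: contraT => nx; have : uniq (x :: s1) by rewrite /= nx.
  by move/uniq_card_le; rewrite /= z1 ltnn.
have inj_g : injective (fun x => nth x s2 (index x s1)).
  move=> x y; rewrite (set_nth_default y) ?z2 -?z1 ?index_mem // => /eqP.
  rewrite nth_uniq ?z2 -?z1 ?index_mem // => /eqP e.
  exact: (index_inj x (full x) (full y) e).
have [x0 _] := ex_third T5 (s := [::]) isT.
exists (perm inj_g); apply: (@eq_from_nth _ x0); rewrite size_map ?z1 ?z2 // => i lti.
rewrite (nth_map x0) ?z1 // permE index_uniq ?z1 //.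
by apply: set_nth_default; rewrite z2.
Qed.

(** An odd permutation centralizing t repairs the parity of the conjugating element. *)
Lemma conj_even s t g u : s ^ g = t -> odd_perm u -> commute t u ->
  exists2 h, h \in 'Alt_T & t = s ^ h.
Proof.
move=> sg ou tu; have [og | eg] := boolP (odd_perm g); last first.
  by exists g; rewrite ?Alt_even.
exists (g * u); first by rewrite Alt_even odd_permM og ou.
by rewrite conjgM sg; apply/esym/conjg_fixP/commgP.
Qed.

Hypothesis T6 : #|T| = 6.

Lemma cyc3_conj6 s t : is_cyc3 s -> is_cyc3 t -> exists2 h, h \in 'Alt_T & t = s ^ h.
Proof.
have complete s' : is_cyc3 s' -> exists a b c u v w,
    [/\ distinct3 a b c, s' = cyc3 a b c & uniq [:: u; v; w; a; b; c]].
  case=> a [b [c [d3 ->]]]; have u3 : uniq [:: a; b; c].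
    by move: d3; rewrite /distinct3 /= !inE negb_or => /and3P[-> -> ->].
  have ext (l : seq T) : uniq l -> size l < 6 -> exists u, uniq (u :: l).
    by move=> ul; rewrite -T6 => /ex_notin[u nu]; exists u; rewrite /= nu.
  have [w uw] := ext _ u3 isT; have [v uv] := ext _ uw isT.
  by have [u uu] := ext _ uv isT; exists a, b, c, u, v, w.
case/complete=> [a [b [c [u [v [w [d3 -> l1]]]]]]].
case/complete=> [a' [b' [c' [u' [v' [w' [d3' -> l2]]]]]]].
have [g [_ _ _ ga gb gc]] := perm_of_lists l1 l2 (esym T6) (esym T6).
have sg : cyc3 a b c ^ g = cyc3 a' b' c' by rewrite cyc3J ga gb gc.
apply: (conj_even sg (u := tperm u' v')).
  by rewrite odd_tperm; move: l2; rewrite /= !inE !negb_or => /andP[/andP[]].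
apply/commgP/conjg_fixP; rewrite cyc3J.
move: l2; rewrite /= !inE !negb_or.
case/and4P=> /and5P[_ _ ? ? ?] /and4P[_ ? ? ?] _ _.
by tperm_tac.
Qed.

Lemma ord3_conj6 s t : s ^+ 3 = 1 -> s != 1 -> ~ is_cyc3 s ->
    t ^+ 3 = 1 -> t != 1 -> ~ is_cyc3 t ->
  exists2 h, h \in 'Alt_T & t = s ^ h.
Proof.
move=> s3 s1 ns3 t3 t1 nt3.
have [a [p [sa sp l1]]] := not_cyc3_orbits s3 s1 ns3.
have [b [q [tb tq l2]]] := not_cyc3_orbits t3 t1 nt3.
have [_ s3a] := ord3_orbit s3 sa; have [_ s3p] := ord3_orbit s3 sp.
have [_ t3b] := ord3_orbit t3 tb; have [_ t3q] := ord3_orbit t3 tq.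
have [g [g0 g1 g2 g3 g4 g5]] := perm_of_lists l1 l2 (esym T6) (esym T6).
have full l z : uniq l -> size l = 6 -> z \in l.
  move=> ul sl; apply: contraT => nz; have : uniq (z :: l) by rewrite /= nz.
  by move/uniq_card_le; rewrite /= sl T6.
have sg : s ^ g = t.
  apply/permP=> z; rewrite -(permKV g z) permJ; move: (g^-1 z) => {}z.
  have := full _ z l1 erefl; rewrite !inE.
  case/or4P=> [/eqP ->|/eqP ->|/eqP ->|/or3P[] /eqP ->].
  - by rewrite g0 g1.
  - by rewrite g1 g2.
  - by rewrite s3a g2 t3b g0.
  - by rewrite g3 g4.
  - by rewrite g4 g5.
  by rewrite s3p g5 t3q g3.
(* This exchanges the two 3-cycles of t, so it commutes with t, and it is a product of three
   transpositions, hence odd. *)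
pose u := tperm b q * (tperm (t b) (t q) * tperm (t (t b)) (t (t q))).
apply: (conj_even sg (u := u)).
  rewrite !odd_permM !odd_tperm !(inj_eq perm_inj).
  by move: l2; rewrite /= !inE !negb_or => /andP[/and5P[_ _ -> _ _]].
have full2 z := full _ z l2 erefl.
apply/permP=> z; rewrite [LHS]permM [RHS]permM /u.
move: l2; rewrite /= !inE !negb_or.
case/and5P=> /and5P[? ? ? ? ?] /and4P[? ? ? ?] /and3P[? ? ?] /andP[? ?] /andP[? _].
have := full2 z; rewrite !inE.
case/or4P=> [/eqP ->|/eqP ->|/eqP ->|/or3P[] /eqP ->]; rewrite ?t3b ?t3q;
  by tperm_tac; rewrite ?t3b ?t3q.
Qed.

(** The elements of order 3 form two classes in A_6, and f keeps or exchanges them. If neither f s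
    nor f (f s) were a 3-cycle, they would be conjugate in A_6; pulling back by f, so would s and f
    s be. *)
Lemma Aut_Alt6_cyc3 f s : f \in Aut 'Alt_T -> is_cyc3 s -> is_cyc3 (f (f s)).
Proof.
move=> Af s3; have As := is_cyc3_Alt s3; have [f3 f1] := Aut_cyc3_order Af s3.
have Afs := Aut_Alt_closed Af As.
have [fs3 | nfs3] := is_cyc3_dec (f s).
  have [h Ah eh] := cyc3_conj6 s3 fs3.
  by rewrite eh Aut_AltJ //; apply: is_cyc3J.
have [// | nffs3] := is_cyc3_dec (f (f s)).
have ff3 : f (f s) ^+ 3 = 1 by rewrite -Aut_AltX // f3 Aut_Alt1.
have ff1 : f (f s) != 1.
  by rewrite -[X in _ != X](Aut_Alt1 Af) (inj_eq perm_inj).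
have [h Ah eh] := ord3_conj6 f3 f1 nfs3 ff3 ff1 nffs3.
have [h' Ah' eh'] := Aut_Alt_onto Af Ah.
case: nfs3; suff -> : f s = s ^ h' by apply: is_cyc3J.
by apply: (@perm_inj _ f); rewrite Aut_AltJ // -eh'.
Qed.

End AutCyc3.

(** * The exceptional degree 6, and conjugation as a map to Aut(A_n) *)

(** Without 3-cycles [sol_le6_free] applies, and with blocks of at most 4 points [sol_Alt_blocks]
    does. A block of 6 points would make H all of A_6; one of 5 points puts H in a point stabilizer,
    of even index 6. *)
Lemma sol_proper_odd_Alt6 (T : finType) (H : {group {perm T}}) : #|T| = 6 ->
  H \proper 'Alt_T -> odd #|'Alt_T : H| -> solvable H.
Proof.
move=> T6 /andP[sHA nAH] oddH.
have T5 : 4 < #|T| by rewrite T6.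
have T7 : 4 < #|T| <= 7 by rewrite T6.
have T6' : #|T| <= 6 by rewrite T6.
have [[x [y [z [d3 Hc]]]] | no3] := cyc3_dec H; last exact: sol_le6_free T7 T6'.
have nxy : x != y by case/and3P: d3.
have dxy : block3 H x = block3 H y by apply/eqP; rewrite block3_eq (rel3_cyc d3).
have sHW := block3_stab H.
case: (pickP (fun z => 4 < #|[set u | block3 H u == block3 H z]|)) => [u U5 | le4].
  set U := [set _ | _] in U5.
  have [w nUw] : exists w, w \notin U.
    apply/existsP; apply: contraR nAH; rewrite negb_exists => /forallP allU.
    apply: Alt_sub_rel3 => // a b; rewrite -block3_eq.
    have := allU a; have := allU b; rewrite !negbK !inE => /eqP -> /eqP ->.
    exact: eqxx.
  have Uc v : v \notin U -> v = w.
    move=> nUv; have : #|~: U| <= 1.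
      by have := cardsC U; rewrite T6; move: U5; clear; lia.
    by move/card_le1_eqP; apply; rewrite in_setC.
  have sHw : H \subset Alt_stab w.
    apply/subsetP=> h Hh; apply/Alt_stabP; split; first exact: (subsetP sHA).
    apply: (Uc (h w)); apply/negP=> Uhw.
    have [v] : exists v, v \in U :\ h w.
      by apply/card_gt0P; have := cardsD1 (h w) U; rewrite Uhw; move: U5; clear; lia.
    case/setD1P=> nv Uv; case/negP: nv; rewrite -(permKV h v) (inj_eq perm_inj).
    apply/eqP/Uc; apply: contra nUw; rewrite !inE => /eqP e.
    have Wh := block_stabP _ _ (subsetP sHW h Hh).
    rewrite -e -Wh permKV; move: Uhw Uv; rewrite !inE => /eqP -> /eqP ->.
    exact: eqxx.
  have sSA : Alt_stab w \subset 'Alt_T by apply: subsetIl.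
  have := oddH; rewrite -(Lagrange_index sSA sHw) oddM => /andP[oddS _]; move: oddS.
  have := Lagrange sSA; have := card_Alt_stab T5 w; have := card_Alt (ltnW (ltnW (ltnW T5))).
  rewrite T6 -[6`!]/720 -[(6.-1)`!]/120.
  move: #|Alt_stab w| #|'Alt_T| #|'Alt_T : Alt_stab w| => S A i; clear=> oA oS.
  have [-> ->] : S = 60 /\ A = 360 by lia.
  by lia.
apply: (sol_Alt_blocks sHA oddH sHW nxy dxy T6') => v.
by rewrite leqNgt le4.
Qed.

Lemma cent_Alt (T : finType) : 4 < #|T| -> 'C('Alt_T) = 1.
Proof.
move=> T5; apply/trivgP/subsetP=> s /centP cs; rewrite inE; apply/eqP/permP=> x.
rewrite perm1; apply/eqP; apply: contraT => sx.
have [u] := ex_third T5 (s := [:: x; s x]) isT; rewrite !inE negb_or => /andP[ux us].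
have [v] := ex_third T5 (s := [:: x; s x; u]) isT.
rewrite !inE !negb_or => /and3P[vx vs vu].
have d3 : distinct3 (s x) u v.
  by rewrite /distinct3 eq_sym us (eq_sym _ v) vs eq_sym vu.
have /permP/(_ x) := cs _ (cyc3_Alt d3); rewrite [LHS]permM [RHS]permM cyc3_x // cyc3_out.
- by move/eqP; rewrite (negPf us).
- by rewrite eq_sym.
- by rewrite eq_sym.
by rewrite eq_sym.
Qed.

Section AltConj.

Variable T : finType.
Hypothesis T5 : 4 < #|T|.
Let rho := conj_aut ('Alt_T)%G.

Lemma norm_Alt : 'N('Alt_T) = [set: {perm T}].
Proof. by apply/eqP; rewrite eqEsubset subsetT Alt_norm. Qed.

Lemma in_norm_Alt (s : {perm T}) : s \in 'N('Alt_T).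
Proof. by rewrite norm_Alt inE. Qed.

Lemma injm_conj_Alt : 'injm rho.
Proof. by rewrite ker_conj_aut cent_Alt. Qed.

Lemma conj_AltE s t : t \in 'Alt_T -> rho s t = t ^ s.
Proof. by move=> At; apply: norm_conj_autE => //; apply: in_norm_Alt. Qed.

Lemma Aut_rho s : rho s \in Aut 'Alt_T.
Proof. exact: Aut_aut. Qed.

Lemma Aut_Alt_rho f : f \in Aut 'Alt_T -> (forall s, is_cyc3 s -> is_cyc3 (f s)) ->
  exists s, f = rho s.
Proof.
move=> Af f3; have [s fs] := Aut_Alt_conj T5 Af f3; exists s.
by apply: eq_Aut Af (Aut_rho s) _ => t At; rewrite fs // conj_AltE.
Qed.

Lemma rho_Alt_norm f s : f \in Aut 'Alt_T -> s \in 'Alt_T -> rho s ^ f = rho (f s).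
Proof.
move=> Af As; apply: (eq_Aut (A := 'Alt_T)); rewrite ?Aut_rho //.
  by rewrite groupJ ?Aut_rho.
move=> t At; have [t' At' ->] := Aut_Alt_onto Af At.
rewrite permJ !conj_AltE ?Aut_Alt_closed //.
by rewrite Aut_AltJ.
Qed.

End AltConj.

Lemma Alt_or_Sym (T : finType) (B : {group {perm T}}) :
  'Alt_T \subset B -> B :=: 'Alt_T \/ B :=: 'Sym_T.
Proof.
move=> sAB; have [sBA | /subsetPn[b Bb nAb]] := boolP (B \subset 'Alt_T).
  by left; apply/eqP; rewrite eqEsubset sBA.
right; apply/eqP; rewrite eqEsubset subsetT; apply/subsetP=> s _.
have [As | nAs] := boolP (s \in 'Alt_T); first exact: (subsetP sAB).
rewrite -(mulgKV b s) groupMr // (subsetP sAB) // Alt_even odd_permM odd_permV.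
by move: nAs nAb; rewrite !Alt_even !negbK => -> ->.
Qed.

(** The quotient of A by the inner automorphisms I is a 2-group. So K cannot contain I, since its
    index would be an odd power of 2 greater than 1; hence K meets I in a proper odd index subgroup,
    soluble by [sol_proper_odd_Alt6], with a 2-group as quotient. *)
Lemma no_odd_index_Aut_Alt6 (A K : {group {perm {perm 'I_6}}}) :
    conj_aut ('Alt_('I_6))%G @* 'Alt_('I_6) \subset A ->
    A \subset Aut 'Alt_('I_6) -> K \proper A -> odd #|A : K| -> solvable K.
Proof.
move=> sIA sAA /andP[sKA nAK] oddK.
have T6 : #|'I_6| = 6 by apply: card_ord.
have T5 : 4 < #|'I_6| by rewrite T6.
pose rho := conj_aut ('Alt_('I_6))%G; pose I := (rho @* 'Alt_('I_6))%G.
have sAN : 'Alt_('I_6) \subset 'N('Alt_('I_6)) by rewrite norm_Alt subsetT.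
have nIA : I <| A.
  rewrite /normal sIA; apply/subsetP=> a Aa; rewrite inE.
  apply/subsetP=> _ /imsetP[_ /morphimP[s _ As ->] ->].
  have Aa' := subsetP sAA a Aa.
  rewrite [_ ^ _](rho_Alt_norm Aa' As); apply: mem_morphim; first exact: in_norm_Alt.
  exact: Aut_Alt_closed.
(* The square of a preserves 3-cycles, so it is conjugation by some s in S_6, and the square of s is
   even. *)
have A4 a : a \in A -> a ^+ 4 \in I.
  move=> Aa; have Aa' := subsetP sAA a Aa.
  have [|s es] := Aut_Alt_rho T5 (groupX 2 Aa').
    by move=> s s3; rewrite permX /=; apply: Aut_Alt6_cyc3.
  rewrite (expgM a 2 2) es -morphX; last exact: in_norm_Alt.
  apply: mem_morphim; first exact: in_norm_Alt.
  by rewrite Alt_even expg2 odd_permM addbb.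
have pAI : 2.-group (A / I).
  rewrite -pnat_exponent; apply: (@pnat_dvd _ 4) => //; apply/exponentP.
  move=> _ /morphimP[a Na Aa ->]; rewrite -morphX //=; apply: coset_id; exact: A4.
have [sIK | nIK] := boolP (I \subset K).
  case/negP: nAK; rewrite -indexg_eq1; apply/eqP; apply: (@pnat_1 2).
    apply: pnat_dvd pAI; rewrite card_quotient ?normal_norm //.
    exact: indexgS.
  by rewrite p'natE // dvdn2 oddK.
have oddI := odd_index_normal sKA nIA oddK.
pose H1 := ('Alt_('I_6) :&: rho @*^-1 K)%G.
have imH1 : rho @* H1 = I :&: K.
  rewrite morphimGI ?ker_conj_aut; last first.
    by rewrite cent_Alt // sub1G.
  apply/setP=> g; rewrite !in_setI; case: (boolP (g \in rho @* 'Alt_('I_6))) => //=.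
  case/morphimP=> s Ns As ->.
  apply/morphimP/idP => [[t Nt /morphpreP[_ Kt] ->] // | Ks].
  by exists s => //; apply/morphpreP.
have injr := injm_conj_Alt T5.
have oddH1 : odd #|'Alt_('I_6) : H1|.
  by rewrite -(index_injm H1 injr sAN) imH1.
have prH1 : H1 \proper 'Alt_('I_6).
  rewrite properE subsetIl /=; apply: contra nIK => sAH1.
  have : rho @* 'Alt_('I_6) \subset rho @* H1 by apply: morphimS.
  by rewrite imH1 subsetI => /andP[].
have solN : solvable (I :&: K).
  by rewrite -imH1 morphim_sol // (sol_proper_odd_Alt6 T6 prH1 oddH1).
have nIK' : K \subset 'N(I) by apply: subset_trans sKA (normal_norm nIA).
have nNK : (I :&: K)%G <| K by rewrite /normal subsetIr normsI ?normG.
rewrite (series_sol nNK) solN /= (isog_sol (second_isog nIK')).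
exact: solvableS (quotientS _ sKA) (pgroup_sol pAI).
Qed.

(** * Conclusion for almost simple groups *)

Lemma odd_index_Alt_or_Sym (n : nat) (gT : finGroupType) (G H : {group gT})
    (B : {group {perm 'I_n}}) : 5 <= n -> G \isog B ->
    B :=: 'Alt_('I_n) \/ B :=: 'Sym_('I_n) -> H \subset G -> odd #|G : H| ->
  (G \isog 'Alt_('I_n) \/ G \isog 'Sym_('I_n)) /\
  ((forall U : section gT, composition_factor H U -> ~~ solvable U ->
      exists m : nat, U \isog 'Alt_('I_m))
   \/
   [\/ G \isog 'Alt_('I_7) /\ H \isog 'GL_3(2),
       G \isog 'Alt_('I_8) /\ H \isog AGL 3 'F_2
     | G \isog 'Alt_('I_9) /\ H \isog AGL 3 'F_2]).
Proof.
move=> n5 isoG defB sHG oddH; have /isogP[f injf imf] := isoG.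
have isoH : H \isog f @* H by apply: sub_isog.
have oddF : odd #|B : f @* H| by rewrite -imf index_injm.
have sFB : f @* H \subset B by rewrite -imf morphimS.
have comp : alt_factors (f @* H)%G -> forall U : section gT,
    composition_factor H U -> ~~ solvable U -> exists m : nat, U \isog 'Alt_('I_m).
  move=> altF U; apply: alt_factors_composition.
  exact: alt_factors_isog isoH altF.
case: defB => defB; rewrite defB in isoG sFB oddF; split; try by [left | right].
- case: (odd_index_Alt n5 sFB oddF) => [/comp | exc]; [by left | right].
  case: exc => [] [en isoF]; [constructor 1 | constructor 2 | constructor 3];
  by split; [rewrite -en | apply: isog_trans isoH isoF].
(* S_n is the Young subgroup of a constant coloring. *)
left; apply: comp; have cT : color_sym (fun _ : 'I_n => tt) = 'Sym_('I_n).
  by apply/eqP; rewrite eqEsubset subsetT; apply/subsetP=> s _; apply/color_symP.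
by apply: (alt_factors_odd_color_sym (c := fun _ => tt)); rewrite cT.
Qed.

Theorem theorem1p2 (n : nat) (gT : finGroupType) (G H : {group gT})
    (n_ge5 : 5 <= n)
    (asG : almost_simple_with_socle G ('Alt_('I_n))%G)
    (insolH : ~~ solvable H)
    (ltHG : H \proper G)
    (oddHG : odd #|G : H|) :
  (G \isog 'Alt_('I_n) \/ G \isog 'Sym_('I_n)) /\
  ((forall U : section gT, composition_factor H U -> ~~ solvable U ->
      exists m : nat, U \isog 'Alt_('I_m))
   \/
   [\/ G \isog 'Alt_('I_7) /\ H \isog 'GL_3(2),
       G \isog 'Alt_('I_8) /\ H \isog AGL 3 'F_2
     | G \isog 'Alt_('I_9) /\ H \isog AGL 3 'F_2]).
Proof.
case: asG => _ _ [A [sIA sAA isoGA]]; have sHG := proper_sub ltHG.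
have [n6 | n6] := eqVneq n 6.
  subst n; case/negP: insolH; have /isogP[f injf imf] := isoGA.
  rewrite -(injm_sol injf sHG) (no_odd_index_Aut_Alt6 sIA sAA) //.
    by rewrite -imf /= injm_proper.
  by rewrite -imf index_injm.
have T5 : 4 < #|'I_n| by rewrite card_ord.
pose rho := conj_aut ('Alt_('I_n))%G; pose B := (rho @*^-1 A)%G.
have injr : 'injm rho := injm_conj_Alt T5.
(* Outside degree 6 all automorphisms preserve 3-cycles, hence are conjugations by elements of S_n;
   so A pulls back to a group B between A_n and S_n. *)
have imB : rho @* B = A.
  rewrite morphpreK //; apply/subsetP=> f Af; have Af' := subsetP sAA f Af.
  have [s s3 | s ->] := Aut_Alt_rho T5 Af'.
    by apply: Aut_Alt_cyc3 => //; rewrite card_ord; apply/eqP.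
  by apply: mem_morphim; apply: in_norm_Alt.
have sBN : B \subset 'N('Alt_('I_n)) by rewrite norm_Alt subsetT.
have isoGB : G \isog B.
  by rewrite (isog_transl _ isoGA) -imB isog_sym sub_isog.
apply: (odd_index_Alt_or_Sym n_ge5 isoGB) => //; apply: Alt_or_Sym.
by rewrite -sub_morphim_pre // norm_Alt subsetT.
Qed.
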